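(* There are no finite regular polyhedra of index $2$ with directed type whose vertices coincide with those of a regular cuboctahedron. Up to similarity, there are exactly two finite regular polyhedra of index $2$ with directed type whose vertices coincide with those of a regular icosidodecahedron $S$. These have edge length $d=(1+\sqrt5)/2$. One has type $\{5,4\}$, with genus $4$, and is orientable with planar faces in two orbits under $G^+(S)$, the faces being convex pentagons of shape $[r,r,r,r]$ and pentagrams of shape $[l,l,l,l]$ (for a suitable choice of the orbit of starting edges). The other is its Petrie dual with type $\{6,4\}$, and genus $12$, and is non-orientable with non-planar hexagonal faces in one orbit under $G^+(S)$, and is of shape $[r,l,r,l]$.
   Context: Maps and polyhedra: a finite map $M$ is a decomposition of a closed compact surface into simply connected faces by edges meeting at vertices, identified with its partially ordered set of vertices, edges, faces; it has type $\{p,q\}$ if each face has $p$ edges and each vertex lies on $q$ edges; it is regular if its automorphism group $\Gamma(M)$ is transitive on flags (mutually incident vertex–edge–face triples). A polyhedron $P$ is a faithful realization of a map $M$ in $\mathbb{E}^3$: vertices, edges, faces correspond bijectively (preserving incidence) to points, line segments, and closed simple sequences of edges; faces may be non-planar; $p,q\ge 3$ and no two edges join the same two vertices. Put $\Gamma(P)=\Gamma(M)$. $G(P)$ is the group of isometries of $\mathbb{E}^3$ preserving $P$, $G^+(P)$ its rotation subgroup. $P$ is a regular polyhedron of index $2$ if $M$ is regular and $G(P)$ has index $2$ in $\Gamma(P)$. $G^+(S)$ denotes the rotation group of $S$. Genus and orientability refer to the underlying surface (non-orientable genus $=2-\chi$). The Petrie dual has the same vertices and edges as $P$, and as faces the Petrie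 polygons (edge paths such that every two, but no three, consecutive edges lie in a common face). Edge length and type: for $S$ (the convex hull of the vertices of $P$) a cuboctahedron or icosidodecahedron with edge length $1$, the length of an edge of $P$ is the length of a shortest path joining its endpoints along diagonals of faces of $S$, where the diagonals of a triangle are its edges (length $1$) and the diagonals of a square, resp. pentagon, have length $d=\sqrt2$ (cuboctahedron), resp. $d=(1+\sqrt5)/2$ (icosidodecahedron). The notion of type concerns regular polyhedra of index $2$ whose vertices form one orbit under $G(P)$ and all of whose edges have the same length: $P$ has directed type if for one (equivalently every) edge with vertices $u,v$ the directed edges $\{u,v\}$ (from $u$ to $v$) and $\{v,u\}$ are not equivalent under $G^+(P)$. Face shapes: project the edges of $P$ from the center of $S$ onto the circumsphere, viewed from outside. Each vertex lies on four edges. When the boundary of a face arrives at a vertex $v$ along a directed edge $\{u,v\}$, it continues along one of the three other edges of $P$ at $v$; these, in counterclockwise order about $v$ starting from the arriving edge, are the changes of direction $r,f,l$ (right, forward, left). A face $F$ has shape $[a,b,c,d]$ if, starting along a directed starting edge $\{v_0,v_1\}$ of its boundary, the changes of direction at $v_1,v_2,v_3,\dots$ are $a,b,c,d,a,b,c,d,\dots$. All starting edges are taken from one fixed orbit of directed edges of $P$ under $G^+(S)$. *)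

(* Defs.v *)
From HB Require Import structures.
From mathcomp Require Import all_boot all_order all_algebra all_fingroup.
From mathcomp Require Import boolp classical_sets reals.

Set Implicit Arguments.
Unset Strict Implicit.
Unset Printing Implicit Defensive.

Import Order.TTheory GRing.Theory Num.Theory.

Local Open Scope ring_scope.

(* A finite map, given by its vertices, edges and faces and their incidences.
   The partial order of the map is recovered from vertex-edge and edge-face
   incidence: a vertex is incident with a face iff they share an edge.
   The conditions say that the complex is a closed connected surface whose
   edges are not loops and whose face boundaries are simple circuits (as is the
   case for every map with a faithful realization): each edge has two ends and
   two sides, a face has two edges at each of its vertices, its edges form a
   single circuit, and the edges around a vertex form a single cycle. *)
Record finite_map : Type := FiniteMap {
  vertex : finType;
  edge : finType;
  face : finType;
  ve : vertex -> edge -> bool;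
  ef : edge -> face -> bool;
  map_inhabited : exists v : vertex, true;
  vertex_nonisolated : forall v, exists e, ve v e;
  face_nonempty : forall f, exists e, ef e f;
  edge_ends : forall e, #|[set v | ve v e]%SET| = 2%N;
  edge_sides : forall e, #|[set f | ef e f]%SET| = 2%N;
  face_corners : forall v f, (exists e, ve v e && ef e f) ->
    #|[set e | ve v e && ef e f]%SET| = 2%N;
  face_circuit : forall f e e', ef e f -> ef e' f ->
    connect (fun x y => [&& ef x f, ef y f & [exists v, ve v x && ve v y]])
            e e';
  vertex_cycle : forall v e e', ve v e -> ve v e' ->
    connect (fun x y => [&& ve v x, ve v y & [exists f, ef x f && ef y f]])
            e e';
  map_connected : forall u v,
    connect (fun x y => [exists e, ve x e && ve y e]) u v
}.

Notation cell_perm M :=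
  ({perm vertex M} * {perm edge M} * {perm face M})%type.

Section Maps.
Variable M : finite_map.

Definition has_type (p q : nat) : Prop :=
  (forall f : face M, #|[set e | ef e f]%SET| = p) /\
  (forall v : vertex M, #|[set e | ve v e]%SET| = q).

Definition flag (v : vertex M) (e : edge M) (f : face M) : bool :=
  ve v e && ef e f.

Definition vperm (s : cell_perm M) : {perm vertex M} := s.1.1.
Definition eperm (s : cell_perm M) : {perm edge M} := s.1.2.
Definition fperm (s : cell_perm M) : {perm face M} := s.2.

Definition automorphisms : {set cell_perm M} :=
  [set s | [forall v, [forall e, ve (vperm s v) (eperm s e) == ve v e]]
        && [forall e, [forall f, ef (eperm s e) (fperm s f) == ef e f]]]%SET.

Lemma automorphismP (s : cell_perm M) :
  reflect ((forall v e, ve (vperm s v) (eperm s e) = ve v e) /\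
           (forall e f, ef (eperm s e) (fperm s f) = ef e f))
          (s \in automorphisms).
Proof.
rewrite inE; apply: (iffP andP) => -[H1 H2]; split.
- by move=> v e; apply/eqP; move/forallP/(_ v)/forallP/(_ e): H1.
- by move=> e f; apply/eqP; move/forallP/(_ e)/forallP/(_ f): H2.
- by apply/forallP => v; apply/forallP => e; rewrite H1.
- by apply/forallP => e; apply/forallP => f; rewrite H2.
Qed.

Lemma automorphisms_group_set : group_set automorphisms.
Proof.
apply/group_setP; split.
  by apply/automorphismP; split=> x y; rewrite /vperm /eperm /fperm /= !perm1.
move=> s t /automorphismP[s1 s2] /automorphismP[t1 t2].
apply/automorphismP; split=> x y; rewrite /vperm /eperm /fperm /= !permM.
  by rewrite -[LHS]/(ve (vperm t (vperm s x)) (eperm t (eperm s y))) t1 s1.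
by rewrite -[LHS]/(ef (eperm t (eperm s x)) (fperm t (fperm s y))) t2 s2.
Qed.
Canonical automorphism_group : {group cell_perm M} := Group automorphisms_group_set.

Definition regular_map : Prop :=
  forall v e f v' e' f', flag v e f -> flag v' e' f' ->
  exists2 s, s \in automorphisms &
    [/\ vperm s v = v', eperm s e = e' & fperm s f = f'].

Definition euler_characteristic : int :=
  #|vertex M|%:Z - #|edge M|%:Z + #|face M|%:Z.

(* o v e f tells whether the orientation chosen for f runs through its edge e
   starting from v; the three conditions say that e is run through from exactly
   one of its ends, that this is consistent along the boundary of f, and that
   the two faces at e run through it in opposite directions. *)
Definition orientable : Prop :=
  exists o : vertex M -> edge M -> face M -> bool,
  [/\ forall u v e f, flag u e f -> flag v e f -> u <> v -> o u e f <> o v e f,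
      forall v d e f, flag v d f -> flag v e f -> d <> e -> o v d f <> o v e f
    & forall v e f g, flag v e f -> flag v e g -> f <> g -> o v e f <> o v e g].

Definition orientable_genus (g : nat) : Prop :=
  orientable /\ euler_characteristic = 2 - 2 * g%:Z.

Definition nonorientable_genus (g : nat) : Prop :=
  ~ orientable /\ euler_characteristic = 2 - g%:Z.

Definition joined (u v : vertex M) : bool :=
  (u != v) && [exists e, ve u e && ve v e].

(* traversal of the boundary of the face f *)
Definition face_walk (f : face M) (w : nat -> vertex M) : Prop :=
  forall i, [/\ w i <> w i.+1, w i <> w i.+2
    & exists e, [/\ ef e f, ve (w i) e & ve (w i.+1) e]].

(* (e i) are the edges of a Petrie polygon *)
Definition petrie_path (e : nat -> edge M) : Prop :=
  [/\ exists w : nat -> vertex M,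
        forall i, [/\ w i <> w i.+1, ve (w i) (e i) & ve (w i.+1) (e i)],
      forall i, exists f, ef (e i) f /\ ef (e i.+1) f
    & forall i, ~ exists f, [/\ ef (e i) f, ef (e i.+1) f & ef (e i.+2) f]].

End Maps.

Local Open Scope classical_set_scope.

Section Space.
Variable R : realType.

Notation point := 'rV[R]_3.

Definition vec3 (x y z : R) : point := \row_(i < 3) [:: x; y; z]`_i.

Definition dotmul (x y : point) : R := (x *m y^T) 0 0.

(* the Euclidean distance (the library norm on row vectors is the sup norm) *)
Definition dist (x y : point) : R := Num.sqrt (dotmul (x - y) (x - y)).

(* the triple product n . (x * y); positive iff, seen with n pointing towards
   the viewer, y lies counterclockwise from x by an angle less than pi *)
Definition triple (n x y : point) : R :=
  \det (col_mx n (col_mx x y) : 'M[R]_3).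

Definition similarity (c : R) (g : point -> point) : Prop :=
  0 < c /\ forall x y, dist (g x) (g y) = c * dist x y.

Definition euclid_isometry (g : point -> point) : Prop :=
  forall x y, dist (g x) (g y) = dist x y.

(* For isometries preserving a finite nonempty set, which fix its centroid,
   these are the rotations. *)
Definition direct_isometry (g : point -> point) : Prop :=
  exists (A : 'M[R]_3) (b : point),
    [/\ A *m A^T = 1%:M, \det A = 1 & forall x, g x = x *m A + b].

(* the group G^+(S) *)
Definition rotation_of (S : set point) (g : point -> point) : Prop :=
  direct_isometry g /\ g @` S = S.

Definition golden : R := (1 + Num.sqrt 5) / 2.

Definition cyclic_shifts (x y z : R) : set point :=
  [set p | p = vec3 x y z \/ p = vec3 y z x \/ p = vec3 z x y].

(* vertices of the cuboctahedron with edge length 1: the permutations of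
   (+-1, +-1, 0), scaled *)
Definition unit_cuboctahedron : set point :=
  [set p | exists i j : bool,
    cyclic_shifts ((-1) ^+ i / Num.sqrt 2) ((-1) ^+ j / Num.sqrt 2) 0 p].

(* vertices of the icosidodecahedron with edge length 1: the even permutations
   of (+-golden, 0, 0) and of (+-1, +-golden, +-golden^2) / 2 *)
Definition unit_icosidodecahedron : set point :=
  [set p | (exists i : bool, cyclic_shifts ((-1) ^+ i * golden) 0 0 p) \/
    exists i j k : bool,
      cyclic_shifts ((-1) ^+ i / 2) ((-1) ^+ j * golden / 2)
                    ((-1) ^+ k * golden ^+ 2 / 2) p].

(* S is the vertex set of a regular cuboctahedron of edge length a *)
Definition is_cuboctahedron (a : R) (S : set point) : Prop :=
  exists2 g, similarity a g & S = g @` unit_cuboctahedron.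

Definition is_icosidodecahedron (a : R) (S : set point) : Prop :=
  exists2 g, similarity a g & S = g @` unit_icosidodecahedron.

(* F is the set of the points of S on a 2-face of the convex hull of S *)
Definition hull_face (S F : set point) : Prop :=
  exists (n : point) (c : R),
  [/\ n <> 0, forall x, S x -> dotmul n x <= c,
      F = S `&` [set x | dotmul n x = c]
    & exists x y z, [/\ F x, F y, F z & row_free (col_mx (y - x) (z - x))]].

(* Sides of faces count as diagonals: for the polyhedra S considered here every
   side is a side, hence a diagonal, of a triangle. *)
Definition face_diagonal (S : set point) (x y : point) : Prop :=
  x <> y /\ exists F, [/\ hull_face S F, F x & F y].

Inductive diagonal_path (S : set point) : point -> point -> R -> Prop :=
| diagonal_nil x : diagonal_path S x x 0
| diagonal_cons x y z l : face_diagonal S x y -> diagonal_path S y z l ->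
    diagonal_path S x z (dist x y + l).

Definition shortest_diagonal_path (S : set point) (x y : point) (l : R) : Prop :=
  diagonal_path S x y l /\ forall l', diagonal_path S x y l' -> l <= l'.

(* x runs through the vertices of a convex polygon *)
Definition convex_polygon (x : nat -> point) : Prop :=
  exists n : point,
    (forall i, dotmul n (x i - x 0%N) = 0) /\
    (forall i j, x j <> x i -> x j <> x i.+1 ->
       0 < triple n (x i.+1 - x i) (x j - x i)).

(* For a closed walk with five vertices: the points x 0, x 2, x 4, x 6, ... run
   through the vertices of a regular pentagon, so that x runs through the
   pentagram formed by its diagonals. *)
Definition is_pentagram (x : nat -> point) : Prop :=
  let y i := x i.*2 in
  [/\ convex_polygon y,
      forall i, dist (y i) (y i.+1) = dist (y 0%N) (y 1%N)
    & forall i, dist (y i) (y i.+2) = dist (y 0%N) (y 2%N)].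

End Space.

(* A polyhedron: a faithful realization of a map of type {p, q}, p, q >= 3.
   Line segments are represented by the pairs of their ends. *)
Record polyhedron (R : realType) : Type := Polyhedron {
  pmap :> finite_map;
  pos : vertex pmap -> 'rV[R]_3;
  pos_inj : injective pos;
  edge_inj : injective (fun e : edge pmap => [set v | ve v e]%SET);
  face_inj : injective (fun f : face pmap => [set e | ef e f]%SET);
  pmap_type : exists p q, [/\ (3 <= p)%N, (3 <= q)%N & has_type pmap p q]
}.

Section Polyhedra.
Variable R : realType.
Implicit Types P Q : polyhedron R.

Definition vertex_set P : set ('rV[R]_3) := range (@pos R P).

Definition segment P (e : edge P) : set ('rV[R]_3) :=
  @pos R P @` [set v | ve v e].

Definition polygon P (f : face P) : set (set ('rV[R]_3)) :=
  @segment P @` [set e | ef e f].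

Definition segments P : set (set ('rV[R]_3)) := range (@segment P).

Definition polygons P : set (set (set ('rV[R]_3))) := range (@polygon P).

Definition directed_edges P : set ('rV[R]_3 * 'rV[R]_3) :=
  [set d | exists u v, joined u v /\ d = (@pos R P u, @pos R P v)].

Definition polygon_image (g : 'rV[R]_3 -> 'rV[R]_3) (F : set (set ('rV[R]_3))) :
  set (set ('rV[R]_3)) := (fun s => g @` s) @` F.

Definition maps_onto (g : 'rV[R]_3 -> 'rV[R]_3) P Q : Prop :=
  [/\ g @` vertex_set P = vertex_set Q,
      (fun s => g @` s) @` segments P = segments Q
    & polygon_image g @` polygons P = polygons Q].

Definition similar_polyhedra P Q : Prop :=
  exists c g, similarity c g /\ maps_onto g P Q.

(* the group G(P) *)
Definition symmetry P (g : 'rV[R]_3 -> 'rV[R]_3) : Prop :=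
  euclid_isometry g /\ maps_onto g P P.

(* G(P), viewed as a subgroup of the automorphism group of P *)
Definition symmetries P : {set cell_perm P} :=
  [set s in automorphisms P |
    `[< exists2 g, symmetry P g & forall v, pos (vperm s v) = g (pos v) >]]%SET.

Lemma polygon_image_comp (g h : 'rV[R]_3 -> 'rV[R]_3) :
  polygon_image (h \o g) = polygon_image h \o polygon_image g.
Proof.
apply: funext => F; rewrite /polygon_image /= image_comp.
by congr image; apply: funext => s /=; rewrite image_comp.
Qed.

Lemma symmetry_comp P g h :
  symmetry P g -> symmetry P h -> symmetry P (h \o g).
Proof.
move=> [ig [g1 g2 g3]] [ih [h1 h2 h3]]; split.
  by move=> x y /=; rewrite ih ig.
split.
- by rewrite -image_comp g1 h1.
- rewrite -[in RHS]h2 -[in RHS]g2 image_comp.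
  by congr image; apply: funext => s /=; rewrite image_comp.
- by rewrite polygon_image_comp -image_comp g3 h3.
Qed.

Lemma symmetry_id P : symmetry P id.
Proof.
split=> //; split; first by rewrite image_id.
- have -> : (fun s : set ('rV[R]_3) => id @` s) = id.
    by apply: funext => s; rewrite image_id.
  by rewrite image_id.
- have -> : @polygon_image id = id.
    apply: funext => F; rewrite /polygon_image.
    have -> : (fun s : set ('rV[R]_3) => id @` s) = id.
      by apply: funext => s; rewrite image_id.
    by rewrite image_id.
  by rewrite image_id.
Qed.

Lemma symmetriesP P (s : cell_perm P) :
  reflect (s \in automorphisms P /\
           exists2 g, symmetry P g & forall v, pos (vperm s v) = g (pos v))
          (s \in symmetries P).
Proof.
rewrite [s \in symmetries P]finset.in_set; apply: (iffP andP) => -[sA sg]; split=> //; exact/asboolP.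
Qed.

Lemma symmetries_group_set P : group_set (symmetries P).
Proof.
apply/group_setP; split.
  apply/symmetriesP; split; first exact: group1.
  exists id; first exact: symmetry_id.
  by move=> v; rewrite /vperm /= perm1.
move=> s t /symmetriesP[sA [g Sg gs]] /symmetriesP[tA [h Sh ht]].
apply/symmetriesP; split; first exact: groupM.
exists (h \o g); first exact: symmetry_comp.
by move=> v; rewrite /vperm /= permM -/(vperm t) ht gs.
Qed.
Canonical symmetry_group P : {group cell_perm P} :=
  Group (symmetries_group_set P).

Definition regular_index2 P : Prop :=
  regular_map P /\ #|automorphisms P : symmetries P|%g = 2%N.

(* all edges have length l, when the convex hull of the vertices is rescaled
   from edge length a to edge length 1 *)
Definition edges_have_length (a : R) P (l : R) : Prop :=
  forall u v, joined u v ->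
    shortest_diagonal_path (vertex_set P) (@pos R P u) (@pos R P v) (a * l).

Definition vertex_transitive P : Prop :=
  forall u v, exists2 g, symmetry P g & g (@pos R P u) = @pos R P v.

Definition directed_type (a : R) P : Prop :=
  [/\ regular_index2 P, vertex_transitive P,
      exists l, edges_have_length a P l
    & exists u v : vertex P, joined u v /\
        ~ exists g, [/\ symmetry P g, direct_isometry g,
                       g (pos u) = pos v & g (pos v) = pos u]].

Definition petrie_dual P Q : Prop :=
  [/\ vertex_set Q = vertex_set P, segments Q = segments P
    & polygons Q = [set F | exists2 e : nat -> edge P,
        petrie_path e & F = range (fun i => segment (e i))]].

(* orbits under G^+(S), where S is the convex hull of the vertices *)
Definition directed_edge_orbit P (O : set ('rV[R]_3 * 'rV[R]_3)) : Prop :=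
  O `<=` directed_edges P /\
  exists2 d, directed_edges P d &
    O = [set d' | exists2 g, rotation_of (vertex_set P) g
                           & d' = (g d.1, g d.2)].

Definition face_orbit P (A : set (set (set ('rV[R]_3)))) : Prop :=
  A `<=` polygons P /\
  exists2 F, polygons P F &
    A = [set F' | exists2 g, rotation_of (vertex_set P) g
                           & F' = polygon_image g F].

Definition planar_face P (f : face P) : Prop :=
  exists (n : 'rV[R]_3) (c : R), n <> 0 /\
    forall v e, flag v e f -> dotmul n (pos v) = c.

Definition convex_face P (f : face P) : Prop :=
  exists w, face_walk f w /\ convex_polygon (fun i => pos (w i)).

Definition pentagram_face P (f : face P) : Prop :=
  exists w, face_walk f w /\ is_pentagram (fun i => pos (w i)).

Definition centroid P : 'rV[R]_3 :=
  #|vertex P|%:R^-1 *: \sum_(v : vertex P) pos v.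

(* Counterclockwise cyclic order of the edges from v to x, y, z, seen from
   outside after projection from the center. Three distinct directions are in
   counterclockwise order iff at most one of the three successive angles is at
   least pi. Adding a multiple of n to the other arguments does not change
   triple n, hence the projection need not be computed. *)
Definition ccw P (v x y z : vertex P) : bool :=
  let n := pos v - centroid P in
  let pos_turn a b := 0 < triple n (pos a - pos v) (pos b - pos v) in
  (2 <= pos_turn x y + pos_turn y z + pos_turn z x)%N.

Inductive direction : Type := dir_r | dir_f | dir_l.

(* position in the counterclockwise order from the arriving edge *)
Definition direction_rank (d : direction) : nat :=
  match d with dir_r => 0 | dir_f => 1 | dir_l => 2 end.

(* arriving at v from u and leaving v for w is a change of direction d *)
Definition change_of_direction P (u v w : vertex P) (d : direction) : Prop :=
  [/\ joined u v, joined v w, u <> w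
    & #|[set x | joined v x && ccw v u x w]%SET| = direction_rank d].

Definition has_shape P (O : set ('rV[R]_3 * 'rV[R]_3)) (f : face P)
    (a b c d : direction) : Prop :=
  exists w : nat -> vertex P,
  [/\ face_walk f w, O (pos (w 0%N), pos (w 1%N))
    & forall i, change_of_direction (w i) (w i.+1) (w i.+2)
                  (nth a [:: a; b; c; d] (i %% 4)%N)].

End Polyhedra.

(* Main.v *)
(* Exact arithmetic in Z[tau] turns the two solids into finite tables: the inner
   product of two vertices lies in a short list, and its index there, their
   class, encodes their distance.

   Classification. If P has index 2 and type {p, q}, then |Gamma_v| >= 2q and
   vertex transitivity give |G_v| >= q >= 3, while a permutation of the vertices
   that preserves classes and fixes v is determined by the image of one suitable
   vertex, so that there are at most four of them. By Lagrange's theorem every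
   isometry of S is then a symmetry of P, q <= 4, and the edges of P are all
   pairs of one class. For most classes a half-turn exchanges the ends of an
   edge. For others, counting short walks in the edge graph separates the three
   further neighbours of v from a given one, whereas an automorphism has to
   exchange two of them. The one remaining class, the diagonals of the pentagons,
   forces the corners of the faces; the fourth vertex of a path along a face can
   be chosen in two ways, the same one everywhere by regularity, which gives the
   two polyhedra.

   Existence. Galois conjugation sqrt 5 -> - sqrt 5 yields an automorphism that
   is not an isometry; together with the symmetries of S it acts transitively on
   the flags, and freely, so that the index is 2. *)
Require Import Defs.
From Stdlib Require Import ZArith.
From mathcomp Require Import all_boot all_order all_algebra all_fingroup.
From mathcomp Require Import boolp classical_sets reals ring lra.
From mathcomp Require Import ssrZ zify.

Set Implicit Arguments.
Unset Strict Implicit.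
Unset Printing Implicit Defensive.

Import Order.TTheory GRing.Theory Num.Theory.

Local Open Scope ring_scope.

(** Orthogonality and antipodality are set apart from the other classes: their graph is
    disconnected, so some edge has another class. Each of the other classes has exactly four pairs
    at every vertex, as many as q <= 4 allows, and therefore a single class contains all edges. In
    the class of the pentagon diagonals the four vertices joined to v form a rectangle with sides of
    classes 1 and 5. Galois conjugation sends (1, tau, tau^2) to tau^-2 (tau^2, -tau, 1), which
    explains the scaling and the exchange of coordinates in [ico_conj]. On inner products it acts as
    conjugation followed by multiplication with tau^4. It thereby keeps the class of the pentagon
    diagonals and exchanges classes 1 and 5, hence convex pentagons and pentagrams. No count of
    walks can tell these two classes apart, so the argument that rules out the classes 1 and 5 as
    edges fails here, and what remains is precisely the freedom used by the non-isometric
    automorphism. *)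

(** * Exact arithmetic in Z[tau] and its evaluation in the reals *)

Notation zt := (Z * Z)%type.
Notation vt := (zt * zt * zt)%type.

Delimit Scope Z_scope with zz.

Definition ztD (x y : zt) : zt := (Z.add x.1 y.1, Z.add x.2 y.2).
Definition ztN (x : zt) : zt := (Z.opp x.1, Z.opp x.2).
Definition ztM (x y : zt) : zt :=
  (Z.add (Z.mul x.1 y.1) (Z.mul x.2 y.2),
   Z.add (Z.add (Z.mul x.1 y.2) (Z.mul x.2 y.1)) (Z.mul x.2 y.2)).
Definition ztB (x y : zt) : zt := ztD x (ztN y).
Definition zteq (x y : zt) : bool := Z.eqb x.1 y.1 && Z.eqb x.2 y.2.
(* sound because 1618/1000 < tau < 1619/1000 *)
Definition ztpos (x : zt) : bool :=
  if Z.leb 0%zz x.2 then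
    Z.ltb 0%zz (Z.add (Z.mul x.1 1000%zz) (Z.mul x.2 1618%zz))
  else Z.leb 0%zz (Z.add (Z.mul x.1 1000%zz) (Z.mul x.2 1619%zz)).

Definition vtB (p q : vt) : vt :=
  (ztB p.1.1 q.1.1, ztB p.1.2 q.1.2, ztB p.2 q.2).
Definition vtD (p q : vt) : vt :=
  (ztD p.1.1 q.1.1, ztD p.1.2 q.1.2, ztD p.2 q.2).
Definition vtZ (c : zt) (p : vt) : vt :=
  (ztM c p.1.1, ztM c p.1.2, ztM c p.2).
Definition vteq (p q : vt) : bool :=
  [&& zteq p.1.1 q.1.1, zteq p.1.2 q.1.2 & zteq p.2 q.2].
Definition zt0 : zt := (Z0, Z0).
Definition vt0 : vt := (zt0, zt0, zt0).
Definition ip (p q : vt) : zt :=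
  ztD (ztD (ztM p.1.1 q.1.1) (ztM p.1.2 q.1.2)) (ztM p.2 q.2).
Definition trp (p q r : vt) : zt :=
  let m a b c d := ztB (ztM a d) (ztM b c) in
  ztD (ztB (ztM p.1.1 (m q.1.2 q.2 r.1.2 r.2))
           (ztM p.1.2 (m q.1.1 q.2 r.1.1 r.2)))
      (ztM p.2 (m q.1.1 q.1.2 r.1.1 r.1.2)).

Section Eval.
Variable R : realType.
Notation tau := (golden R).

Lemma sqrt5_sqr : Num.sqrt 5 ^+ 2 = 5 :> R.
Proof. by rewrite sqr_sqrtr. Qed.

Lemma golden_sqr : tau ^+ 2 = tau + 1.
Proof. by rewrite /golden; have := sqrt5_sqr; set s := Num.sqrt 5 => h; field: h. Qed.

Lemma golden_bounds : 1618 / 1000 < tau < 1619 / 1000.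
Proof.
rewrite /golden; have := sqrt5_sqr; have : 0 <= Num.sqrt 5 :> R by exact: sqrtr_ge0.
by set s := Num.sqrt 5 => h0 h1; apply/andP; split; nra.
Qed.

Definition evZ (z : Z) : R := (int_of_Z z)%:~R.

Lemma evZD x y : evZ (Z.add x y) = evZ x + evZ y.
Proof. by rewrite /evZ -rmorphD /=; congr (_%:~R); lia. Qed.
Lemma evZN x : evZ (Z.opp x) = - evZ x.
Proof. by rewrite /evZ -rmorphN /=; congr (_%:~R); lia. Qed.
Lemma evZM x y : evZ (Z.mul x y) = evZ x * evZ y.
Proof. by rewrite /evZ -rmorphM /=; congr (_%:~R); lia. Qed.
Lemma evZ_ge0 x : Z.leb Z0 x -> 0 <= evZ x.
Proof. by move=> h; rewrite /evZ ler0z; lia. Qed.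
Lemma evZ_gt0 x : Z.ltb Z0 x -> 0 < evZ x.
Proof. by move=> h; rewrite /evZ ltr0z; lia. Qed.

Definition ev (x : zt) : R := evZ x.1 + evZ x.2 * tau.

Lemma evD x y : ev (ztD x y) = ev x + ev y.
Proof. by rewrite /ev !evZD; ring. Qed.
Lemma evN x : ev (ztN x) = - ev x.
Proof. by rewrite /ev !evZN; ring. Qed.
Lemma evB x y : ev (ztB x y) = ev x - ev y.
Proof. by rewrite evD evN. Qed.
Lemma evM x y : ev (ztM x y) = ev x * ev y.
Proof. by rewrite /ev /= !(evZD, evZM); have := golden_sqr => h; ring: h. Qed.
Lemma ev_eq x y : zteq x y -> ev x = ev y.
Proof.
by case: x y => [a b] [c d] /andP[/Z.eqb_eq/= -> /Z.eqb_eq/= ->].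
Qed.
Lemma ev0 : ev zt0 = 0.
Proof. by rewrite /ev /evZ /= mulr0z mul0r addr0. Qed.

Lemma ev_pos x : ztpos x -> 0 < ev x.
Proof.
case: x => a b; rewrite /ztpos /ev /=; have /andP[t1 t2] := golden_bounds.
case: ifP => hb.
  have hb' := evZ_ge0 hb; move/evZ_gt0.
  by rewrite evZD !evZM (_ : evZ 1000%zz = 1000) // (_ : evZ 1618%zz = 1618) // => ?; nra.
move/evZ_ge0; rewrite evZD !evZM (_ : evZ 1000%zz = 1000) // (_ : evZ 1619%zz = 1619) //.
have : evZ b < 0 by rewrite /evZ ltrz0; lia.
by move=> ? ?; nra.
Qed.

Definition vev (p : vt) : 'rV[R]_3 := vec3 (ev p.1.1) (ev p.1.2) (ev p.2).

Notation i0 := (ord0 : 'I_3).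
Notation i1 := (lift ord0 ord0 : 'I_3).
Notation i2 := (lift ord0 (lift ord0 ord0) : 'I_3).

Lemma sum3 (V : zmodType) (F : 'I_3 -> V) : \sum_i F i = F i0 + F i1 + F i2.
Proof. by rewrite !big_ord_recl big_ord0 addr0 addrA. Qed.

Lemma forall_ord3 (Pr : 'I_3 -> Prop) : Pr i0 -> Pr i1 -> Pr i2 -> forall i, Pr i.
Proof.
move=> h0 h1 h2 [[|[|[|//]]] hi].
- by have -> : Ordinal hi = i0 by apply/val_inj.
- by have -> : Ordinal hi = i1 by apply/val_inj.
- by have -> : Ordinal hi = i2 by apply/val_inj.
Qed.

Lemma dotmulE (x y : 'rV[R]_3) :
  dotmul x y = x 0 i0 * y 0 i0 + x 0 i1 * y 0 i1 + x 0 i2 * y 0 i2.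
Proof. by rewrite /dotmul mxE sum3 !mxE. Qed.

Lemma det_mx33 (M : 'M[R]_3) :
  \det M = M i0 i0 * (M i1 i1 * M i2 i2 - M i1 i2 * M i2 i1)
         - M i0 i1 * (M i1 i0 * M i2 i2 - M i1 i2 * M i2 i0)
         + M i0 i2 * (M i1 i0 * M i2 i1 - M i1 i1 * M i2 i0).
Proof.
(* Reading the entries through natural numbers brings the differently built column indices of the
   expansion to a common form. *)
pose f i j := M (inord i) (inord j).
have Mf i j : M i j = f i j by rewrite /f !inord_val.
rewrite (expand_det_row _ ord0) sum3 /cofactor.
rewrite !(expand_det_row _ ord0) !big_ord_recl !big_ord0 /cofactor !det_mx11.
by rewrite !mxE !Mf /= /bump /= !(expr0, expr1, expr2); ring.
Qed.

Lemma tripleE (n x y : 'rV[R]_3) :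
  triple n x y = n 0 i0 * (x 0 i1 * y 0 i2 - x 0 i2 * y 0 i1)
               - n 0 i1 * (x 0 i0 * y 0 i2 - x 0 i2 * y 0 i0)
               + n 0 i2 * (x 0 i0 * y 0 i1 - x 0 i1 * y 0 i0).
Proof.
pose M : 'M[R]_3 := col_mx n (col_mx x y : 'M_(1 + 1, 3)) : 'M_(1 + (1 + 1), 3).
rewrite /triple -[X in \det X]/M.
have M0 j : M i0 j = n 0 j.
  rewrite (_ : i0 = lshift (m:=1) 2 ord0); last by apply: val_inj.
  exact: (@col_mxEu _ 1 (1 + 1) 3 n (col_mx x y) ord0 j).
have M1 j : M i1 j = x 0 j.
  rewrite (_ : i1 = rshift 1 (lshift (m:=1) 1 ord0)); last by apply: val_inj.
  exact: etrans (@col_mxEd _ 1 (1 + 1) 3 n (col_mx x y) _ j) (col_mxEu x y _ j).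
have M2 j : M i2 j = y 0 j.
  rewrite (_ : i2 = rshift 1 (rshift (n:=1) 1 ord0)); last by apply: val_inj.
  exact: etrans (@col_mxEd _ 1 (1 + 1) 3 n (col_mx x y) _ j) (col_mxEd x y _ j).
by rewrite det_mx33 !M0 !M1 !M2.
Qed.

Lemma vev_dot p q : dotmul (vev p) (vev q) = ev (ip p q).
Proof. by rewrite dotmulE /vev !mxE /= !(evD, evM). Qed.

Lemma vev_triple p q r : triple (vev p) (vev q) (vev r) = ev (trp p q r).
Proof. by rewrite tripleE /vev !mxE /= !(evD, evB, evM). Qed.

Lemma rv3P (x y : 'rV[R]_3) : x 0 i0 = y 0 i0 -> x 0 i1 = y 0 i1 -> x 0 i2 = y 0 i2 -> x = y.
Proof. by move=> h0 h1 h2; apply/rowP; apply: forall_ord3. Qed.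

Lemma vevB p q : vev (vtB p q) = vev p - vev q.
Proof. by apply: rv3P; rewrite !mxE /= evB. Qed.

Lemma vevZ c p : vev (vtZ c p) = ev c *: vev p.
Proof. by apply: rv3P; rewrite !mxE /= evM. Qed.

Lemma vev_eq p q : vteq p q -> vev p = vev q.
Proof. by case/and3P=> /ev_eq h1 /ev_eq h2 /ev_eq h3; rewrite /vev h1 h2 h3. Qed.

Lemma vev0 : vev vt0 = 0.
Proof. by apply: rv3P; rewrite !mxE /= ev0. Qed.

End Eval.

(** * Euclidean geometry of row vectors and the affine form of similarities *)

Section Euclid.
Variable R : realType.
Notation point := 'rV[R]_3.
Implicit Types x y z : point.

Lemma dotmulC x y : dotmul x y = dotmul y x.
Proof. by rewrite !dotmulE; ring. Qed.
Lemma dotmulDl x y z : dotmul (x + y) z = dotmul x z + dotmul y z.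
Proof. by rewrite !dotmulE !mxE; ring. Qed.
Lemma dotmulZl a x y : dotmul (a *: x) y = a * dotmul x y.
Proof. by rewrite !dotmulE !mxE; ring. Qed.
Lemma dotmulNl x y : dotmul (- x) y = - dotmul x y.
Proof. by rewrite !dotmulE !mxE; ring. Qed.
Lemma dotmulDr x y z : dotmul z (x + y) = dotmul z x + dotmul z y.
Proof. by rewrite !dotmulE !mxE; ring. Qed.
Lemma dotmulZr a x y : dotmul y (a *: x) = a * dotmul y x.
Proof. by rewrite !dotmulE !mxE; ring. Qed.
Lemma dotmulNr x y : dotmul y (- x) = - dotmul y x.
Proof. by rewrite !dotmulE !mxE; ring. Qed.
Definition dotmul_lin := (dotmulDl, dotmulDr, dotmulZl, dotmulZr, dotmulNl, dotmulNr).

Lemma dotmul_ge0 x : 0 <= dotmul x x.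
Proof. by rewrite dotmulE -!expr2 !addr_ge0 // sqr_ge0. Qed.

Lemma dotmul_eq0 x : dotmul x x = 0 -> x = 0.
Proof.
rewrite dotmulE.
have h0 a b c : a*a + b*b + c*c = 0 -> a = 0 :> R by move=> ?; nra.
set a := x 0 _; set b := x 0 _; set c := x 0 _ => h.
apply: rv3P; rewrite mxE; first exact: h0 h.
- by apply: (h0 b a c); lra.
- by apply: (h0 c b a); lra.
Qed.

Lemma dist_sqr x y : dist x y ^+ 2 = dotmul (x - y) (x - y).
Proof. by rewrite sqr_sqrtr ?dotmul_ge0. Qed.

Lemma dist_ge0 x y : 0 <= dist x y. Proof. exact: sqrtr_ge0. Qed.

Lemma dist_eqP x y x' y' : dotmul (x - y) (x - y) = dotmul (x' - y') (x' - y') <-> dist x y = dist x' y'.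
Proof. by split=> [h|h]; [rewrite /dist h | rewrite -!dist_sqr h]. Qed.

Lemma dist_eq0 x y : dist x y = 0 -> x = y.
Proof.
move=> h; apply/eqP; rewrite -subr_eq0; apply/eqP/dotmul_eq0.
by rewrite -dist_sqr h expr0n.
Qed.

Lemma distxx x : dist x x = 0.
Proof. by rewrite /dist subrr -(scale0r x) dotmulZl mul0r sqrtr0. Qed.

Lemma cauchy_schwarz x y : dotmul x y ^+ 2 <= dotmul x x * dotmul y y.
Proof.
rewrite !dotmulE; set a := x 0 _; set b := x 0 _; set c := x 0 _.
set a' := y 0 _; set b' := y 0 _; set c' := y 0 _.
(* Lagrange's identity: the difference is the squared length of the cross product. *)
rewrite -subr_ge0 (_ : _ - _ = (a*b'-b*a')^+2 + (a*c'-c*a')^+2 + (b*c'-c*b')^+2); last ring.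
by rewrite !addr_ge0 // sqr_ge0.
Qed.

Lemma dist_triangle x y z : dist x z <= dist x y + dist y z.
Proof.
rewrite -(ler_pXn2r (n := 2)) ?nnegrE ?addr_ge0 ?dist_ge0 //.
rewrite sqrrD !dist_sqr.
have -> : dotmul (x - z) (x - z) =
    dotmul (x - y) (x - y) + dotmul (y - z) (y - z) + 2 * dotmul (x - y) (y - z).
  by rewrite !dotmulE !mxE; ring.
have h : dotmul (x - y) (y - z) <= dist x y * dist y z.
  rewrite (le_trans (ler_norm _)) // -(ler_pXn2r (n := 2)) ?nnegrE ?mulr_ge0 ?dist_ge0 //.
  by rewrite real_normK ?num_real // exprMn !dist_sqr cauchy_schwarz.
by rewrite mulr2n; lra.
Qed.

Lemma isometry_inj (g : point -> point) c : similarity c g -> injective g.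
Proof.
move=> [c0 h] x y e; apply: dist_eq0; have := h x y; rewrite e distxx.
by move/esym/eqP; rewrite mulf_eq0 gt_eqF //= => /eqP.
Qed.

Lemma dotmul_mx x y (A : 'M[R]_3) : A *m A^T = 1%:M -> dotmul (x *m A) (y *m A) = dotmul x y.
Proof. by move=> h; rewrite /dotmul trmx_mul mulmxA -(mulmxA x) h mulmx1. Qed.

Lemma dotmul_delta x j : dotmul x (delta_mx 0 j) = x 0 j.
Proof. by rewrite /dotmul trmx_delta -colE mxE. Qed.

(** After translation and rescaling, [g] becomes a map [f] that fixes 0 and, by polarization,
    preserves inner products. The images of the basis vectors under [f] are the rows of [A], and the
    squared length of [x *m A - f x] expands to 0. *)
Lemma similarity_affine c (g : point -> point) : similarity c g ->
  exists (A : 'M[R]_3) b, A *m A^T = 1%:M /\ forall x, g x = c *: (x *m A) + b.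
Proof.
move=> [c0 h]; have cn : c != 0 by rewrite gt_eqF.
have [f [f2 f0 fE]] : exists f : point -> point,
    [/\ forall x y, dotmul (f x - f y) (f x - f y) = dotmul (x - y) (x - y),
        f 0 = 0 & forall x, f x = c^-1 *: (g x - g 0)].
  exists (fun x => c^-1 *: (g x - g 0)); split=> // [x y|]; last by rewrite subrr scaler0.
  rewrite -scalerBr opprB addrA subrK.
  have := congr1 (fun t => t ^+ 2) (h x y); rewrite exprMn !dist_sqr => e.
  by rewrite dotmulZl dotmulZr e; field.
have fn x : dotmul (f x) (f x) = dotmul x x by have := f2 x 0; rewrite f0 !subr0.
have fd x y : dotmul (f x) (f y) = dotmul x y.
  have := f2 x y; rewrite !dotmul_lin !fn (dotmulC y x) (dotmulC (f y)) => e; lra.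
pose A : 'M[R]_3 := \matrix_(i, j) f (delta_mx 0 i) 0 j.
have rA i : delta_mx 0 i *m A = f (delta_mx 0 i).
  by rewrite -rowE; apply/rowP => j; rewrite !mxE.
have AA : A *m A^T = 1%:M.
  apply/matrixP => i j; rewrite [RHS]mxE.
  have e : dotmul (f (delta_mx 0 i)) (f (delta_mx 0 j)) = (i == j)%:R.
    by rewrite fd dotmul_delta mxE eqxx eq_sym.
  by rewrite mxE sum3 !mxE -e dotmulE.
exists A, (g 0); split=> // x.
have -> : x *m A = f x; last by rewrite fE scalerA divff // scale1r subrK.
have dA i : dotmul (delta_mx 0 i) (x *m A) = dotmul (delta_mx 0 i) (x *m A) by [].
apply/eqP; rewrite -subr_eq0; apply/eqP/dotmul_eq0.
rewrite !dotmul_lin dotmul_mx // fn.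
(* Only the argument of the linear map [A] is expanded in the basis, because [f] is not yet known to
   be additive. *)
have xf : dotmul (x *m A) (f x) = dotmul x x.
  rewrite {1}(row_sum_delta x) mulmx_suml.
  have dsum (F : 'I_3 -> point) y : dotmul (\sum_i F i) y = \sum_i dotmul (F i) y.
    by rewrite !sum3 !dotmulDl.
  rewrite dsum [in RHS](row_sum_delta x) [in RHS]dsum; apply: eq_bigr => i _.
  by rewrite -scalemxAl rA !dotmulZl fd -row_sum_delta.
by rewrite (dotmulC (f x)) xf; ring.
Qed.

End Euclid.

Local Close Scope ring_scope.

(** * Search by reachability in finite graphs *)

Section Bfs.
Variables (T : eqType) (succ : T -> seq T).

(** Breadth-first search with fuel [k]. What matters is soundness ([bfsP]), since the checks below
    only test that given elements occur in the output; too little fuel could merely make such a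
    check fail. *)
Fixpoint bfs (k : nat) (seen todo : seq T) : seq T :=
  if k is k'.+1 then
    if todo is x :: t then
      let new := undup [seq y <- succ x | y \notin seen] in
      bfs k' (new ++ seen) (t ++ new)
    else seen
  else seen.

Lemma bfsP (Pr : T -> Prop) x k : Pr x ->
  (forall u v, Pr u -> v \in succ u -> Pr v) ->
  forall y, y \in bfs k [:: x] [:: x] -> Pr y.
Proof.
move=> Px Ps.
move=> y; have : forall y, y \in [:: x] -> Pr y by move=> z; rewrite inE => /eqP->.
have : forall y, y \in [:: x] -> Pr y by move=> z; rewrite inE => /eqP->.
move: [:: x] {1 3}[:: x] => todo seen; elim: k seen todo => [|k IH] seen todo hs ht.
  exact: hs.
case: todo ht => [|u t] ht; first exact: hs.
rewrite /=; set new := undup _.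
have hn z : z \in new -> Pr z.
  rewrite mem_undup mem_filter => /andP[_]; apply: Ps.
  by apply: ht; rewrite mem_head.
apply: IH => z; rewrite mem_cat => /orP[hz|hz]; [exact: hn | exact: hs | | exact: hn].
by apply: ht; rewrite inE hz orbT.
Qed.
End Bfs.

Definition reach (T : eqType) (succ : T -> seq T) (k : nat) (x : T) :=
  bfs succ k [:: x] [:: x].

Lemma reachP (T : eqType) (succ : T -> seq T) (Pr : T -> Prop) x k : Pr x ->
  (forall u v, Pr u -> v \in succ u -> Pr v) ->
  forall y, y \in reach succ k x -> Pr y.
Proof. exact: bfsP. Qed.

Lemma all_ord n (P : pred nat) : all P (iota 0 n) -> forall i : 'I_n, P i.
Proof. by move=> /allP h i; apply: h; rewrite mem_iota ltn_ord. Qed.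

Lemma all_iota n (P : pred nat) : all P (iota 0 n) -> forall i, i < n -> P i.
Proof. by move=> /allP h i hi; apply: h; rewrite mem_iota. Qed.

Lemma card_ord_set n (P : pred nat) : #|[set i : 'I_n | P i]%SET| = count P (iota 0 n).
Proof.
by rewrite cardsE cardE size_filter -val_enum_ord count_map enumT; apply: eq_count.
Qed.

Lemma has_ord n (P : pred nat) : has P (iota 0 n) -> exists i : 'I_n, P i.
Proof. by case/hasP=> x; rewrite mem_iota /= => hx Px; exists (Ordinal hx). Qed.

Lemma ord_has n (P : pred nat) (i : 'I_n) : P i -> has P (iota 0 n).
Proof. by move=> h; apply/hasP; exists (val i) => //; rewrite mem_iota ltn_ord. Qed.

Definition nat_succ n (r : rel nat) (u : nat) : seq nat := [seq v <- iota 0 n | r u v].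

Lemma bfs_connect n (r : rel nat) (e : rel 'I_n) k :
  (forall i j : 'I_n, r i j -> e i j) ->
  forall x y : 'I_n,
    (y : nat) \in reach (nat_succ n r) k x -> connect e x y.
Proof.
move=> re x y hy.
suff /(_ _ hy) [y' hy' c] : forall u, u \in reach (nat_succ n r) k x ->
    exists2 u' : 'I_n, val u' = u & connect e x u'.
  by rewrite (_ : y = y') //; apply/val_inj.
move=> u hu; apply: (bfsP (Pr := fun u => exists2 u' : 'I_n, val u' = u & connect e x u') _ _ hu).
  by exists x.
move=> {hu}u v [u' <- cu]; rewrite mem_filter mem_iota /= => /andP[ruv vn].
by exists (Ordinal vn) => //; apply: connect_trans cu (connect1 _); apply: re.
Qed.

(** * Finite maps from lists of edges and faces, and their automorphisms *)

Section Complex.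
Variables (n : nat) (E : seq (nat * nat)) (F : seq (seq nat)).

(** The default [(n, n)] names no vertex below [n], so an index beyond the list of edges has no
    ends. *)
Definition cve (v e : nat) : bool :=
  let p := nth (n, n) E e in (v == p.1) || (v == p.2).
(** A face is stored by its vertices, and an edge counts as a side when both its ends are among
    them. This describes the boundary correctly as long as no edge is a chord of a face; the counts
    of edges in the checks confirm it. *)
Definition cef (e f : nat) : bool :=
  let p := nth (n, n) E e in let s := nth [::] F f in (p.1 \in s) && (p.2 \in s).

Let Vs := iota 0 n.
Let Es := iota 0 (size E).
Let Fs := iota 0 (size F).

Definition edges_at v := [seq e <- Es | cve v e].
Definition edges_of f := [seq e <- Es | cef e f].

Definition face_step f := nat_succ (size E) (fun e e' =>
  [&& cef e f, cef e' f & has (fun v => cve v e && cve v e') Vs]).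
Definition vertex_step v := nat_succ (size E) (fun e e' =>
  [&& cve v e, cve v e' & has (fun f => cef e f && cef e' f) Fs]).
Definition map_step := nat_succ n (fun u v => has (fun e => cve u e && cve v e) Es).

Definition complex_ok : bool :=
  [&& 0 < n,
      all (fun v => has (cve v) Es) Vs,
      all (fun f => has (cef^~ f) Es) Fs,
      all (fun e => count (cve^~ e) Vs == 2) Es &
      all (fun e => count (cef e) Fs == 2) Es] &&
  [&& all (fun v => all (fun f =>
         let k := count (fun e => cve v e && cef e f) Es in
         (k == 2) || (k == 0)) Fs) Vs,
      all (fun f => let s := edges_of f in
             all (mem (reach (face_step f) n.*2 (head 0 s))) s) Fs,
      all (fun v => let s := edges_at v in
             all (mem (reach (vertex_step v) n.*2 (head 0 s))) s) Vs &
      all (mem (reach map_step n.*2 0)) Vs].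

Hypothesis ok : complex_ok.

Lemma complex_vertex_nonisolated (v : 'I_n) : exists e : 'I_(size E), cve v e.
Proof. by case/andP: ok => /and5P[_ /all_ord/(_ v)/has_ord]. Qed.
Lemma complex_face_nonempty (f : 'I_(size F)) : exists e : 'I_(size E), cef e f.
Proof. by case/andP: ok => /and5P[_ _ /all_ord/(_ f)/has_ord]. Qed.
Lemma complex_edge_ends (e : 'I_(size E)) : #|[set v : 'I_n | cve v e]%SET| = 2.
Proof. by case/andP: ok => /and5P[_ _ _ /all_ord/(_ e)/eqP <- _] _; exact: (card_ord_set n (cve^~ e)). Qed.
Lemma complex_edge_sides (e : 'I_(size E)) : #|[set f : 'I_(size F) | cef e f]%SET| = 2.
Proof.
by case/andP: ok => /and5P[_ _ _ _ /all_ord/(_ e)/eqP <-] _; exact: (card_ord_set (size F) (cef e)).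
Qed.
Lemma complex_inhabited : exists v : 'I_n, true.
Proof. by case/andP: ok => /and5P[h _ _ _ _] _; exists (Ordinal h). Qed.
Lemma complex_face_corners (v : 'I_n) (f : 'I_(size F)) :
  (exists e : 'I_(size E), cve v e && cef e f) ->
  #|[set e : 'I_(size E) | cve v e && cef e f]%SET| = 2.
Proof.
move=> [e he]; rewrite -[LHS]/(#|[set e : 'I_(size E) | (fun e => cve v e && cef e f) e]%SET|) (card_ord_set _ (fun e => cve v e && cef e f)).
case/andP: ok => _ /and4P[/all_ord/(_ v)/all_ord/(_ f)/orP[/eqP//|/eqP h0] _ _ _].
by have := ord_has (P := fun e => cve v e && cef e f) he; rewrite has_count h0.
Qed.
Lemma bfs_connect_head m (r : rel nat) (e : rel 'I_m) k (s : seq nat) :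
  (forall i j : 'I_m, r i j -> e i j) -> symmetric e -> all (fun x => x < m) s ->
  all (mem (reach (nat_succ m r) k (head 0 s))) s ->
  forall x y : 'I_m, (x : nat) \in s -> (y : nat) \in s -> connect e x y.
Proof.
case: s => // a s re se /andP[am _] /allP h x y xs ys.
have ha (z : 'I_m) : (z : nat) \in a :: s -> connect e (Ordinal am) z.
  by move=> zs; apply: bfs_connect re _ _ _; apply: h.
by apply: connect_trans (ha y ys); rewrite sym_connect_sym //; apply: ha.
Qed.

Lemma filter_iota_lt m (P : pred nat) : all (fun x => x < m) [seq x <- iota 0 m | P x].
Proof. by apply/allP => x; rewrite mem_filter mem_iota => /and3P[]. Qed.

Lemma complex_face_circuit (f : 'I_(size F)) (e e' : 'I_(size E)) : cef e f -> cef e' f ->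
  connect (fun x y : 'I_(size E) => [&& cef x f, cef y f & [exists v : 'I_n, cve v x && cve v y]]) e e'.
Proof.
move=> h h'; case/andP: ok => _ /and4P[_ /all_ord/(_ f) + _ _].
move/bfs_connect_head; apply.
- move=> i j /and3P[-> -> /has_ord[v hv]] /=; by apply/existsP; exists v.
- move=> i j; rewrite andbCA; congr [&& _, _ & _]; apply: eq_existsb => v; exact: andbC.
- exact: filter_iota_lt.
- by rewrite mem_filter h mem_iota ltn_ord.
- by rewrite mem_filter h' mem_iota ltn_ord.
Qed.
Lemma complex_vertex_cycle (v : 'I_n) (e e' : 'I_(size E)) : cve v e -> cve v e' ->
  connect (fun x y : 'I_(size E) => [&& cve v x, cve v y & [exists f : 'I_(size F), cef x f && cef y f]]) e e'.
Proof.
move=> h h'; case/andP: ok => _ /and4P[_ _ /all_ord/(_ v) + _].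
move/bfs_connect_head; apply.
- move=> i j /and3P[-> -> /has_ord[f hf]] /=; by apply/existsP; exists f.
- move=> i j; rewrite andbCA; congr [&& _, _ & _]; apply: eq_existsb => f; exact: andbC.
- exact: filter_iota_lt.
- by rewrite mem_filter h mem_iota ltn_ord.
- by rewrite mem_filter h' mem_iota ltn_ord.
Qed.
Lemma complex_connected (u v : 'I_n) :
  connect (fun x y : 'I_n => [exists e : 'I_(size E), cve x e && cve y e]) u v.
Proof.
case/andP: ok => /andP[n0 _] /and4P[_ _ _ h].
apply: (bfs_connect_head (s := Vs) (r := fun u v => has (fun e => cve u e && cve v e) Es) (k := n.*2)).
- by move=> i j /has_ord[e he]; apply/existsP; exists e.
- by move=> i j; apply: eq_existsb => e; exact: andbC.
- by apply/allP => x; rewrite mem_iota => /andP[].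
- by rewrite (_ : head 0 Vs = 0) // /Vs; case: (n).
- by rewrite mem_iota ltn_ord.
- by rewrite mem_iota ltn_ord.
Qed.

Definition complex_map : finite_map :=
  @FiniteMap 'I_n 'I_(size E) 'I_(size F) (fun v e => cve v e) (fun e f => cef e f)
    complex_inhabited complex_vertex_nonisolated complex_face_nonempty
    complex_edge_ends complex_edge_sides complex_face_corners
    complex_face_circuit complex_vertex_cycle complex_connected.

(** If the image is not an edge, [find] returns the length of the list, which [perm_ok] rejects as
    out of range. The same holds for [face_image]. *)
Definition edge_image (g : seq nat) (e : nat) : nat :=
  let p := nth (n, n) E e in
  let a := nth 0 g p.1 in let b := nth 0 g p.2 in
  find (fun q : nat * nat => ((q.1 == a) && (q.2 == b)) || ((q.1 == b) && (q.2 == a))) E.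
Definition face_image (g : seq nat) (f : nat) : nat :=
  find (fun s => all (fun x => nth 0 g x \in s) (nth [::] F f)) F.

Definition perm_ok (k : nat) (h : nat -> nat) : bool :=
  let l := [seq h i | i <- iota 0 k] in uniq l && all (fun x => x < k) l.

Definition aut_ok (g : seq nat) : bool :=
  [&& perm_ok n (nth 0 g), perm_ok (size E) (edge_image g), perm_ok (size F) (face_image g),
      all (fun v => all (fun e => cve (nth 0 g v) (edge_image g e) == cve v e) Es) Vs &
      all (fun e => all (fun f => cef (edge_image g e) (face_image g f) == cef e f) Fs) Es].

Lemma perm_of k (h : nat -> nat) : perm_ok k h ->
  exists s : {perm 'I_k}, forall i, val (s i) = h i.
Proof.
case/andP=> hu /allP hl.
have hb (i : 'I_k) : h i < k by apply: hl; apply: map_f; rewrite mem_iota ltn_ord.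
have hi : injective (fun i : 'I_k => Ordinal (hb i)).
  move=> i j /(congr1 val) /= e; apply/val_inj.
  have si (a : 'I_k) : val a < size (iota 0 k) by rewrite size_iota ltn_ord.
  apply/eqP; rewrite -(nth_uniq 0 _ _ hu) ?size_map ?si //.
  by rewrite !(nth_map 0) ?si // !nth_iota ?ltn_ord //= !add0n e.
by exists (perm hi) => i; rewrite permE.
Qed.

Lemma aut_of g : aut_ok g -> exists2 s : cell_perm complex_map, s \in automorphisms complex_map &
  [/\ forall v, val (vperm s v) = nth 0 g (v : 'I_n),
      forall e, val (eperm s e) = edge_image g (e : 'I_(size E)) &
      forall f, val (fperm s f) = face_image g (f : 'I_(size F))].
Proof.
case/and5P=> /perm_of[s hs] /perm_of[t ht] /perm_of[u hu] hve hef.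
exists ((s, t), u); last by split.
apply/automorphismP; split => /= [v e|e f]; rewrite /vperm /eperm /fperm /=.
  by rewrite hs ht; apply/eqP; move: hve => /all_ord/(_ v)/all_ord/(_ e).
by rewrite hu ht; apply/eqP; move: hef => /all_ord/(_ e)/all_ord/(_ f).
Qed.

Definition flags : seq (nat * nat * nat) :=
  [seq x <- [seq (p, f) | p <- [seq (v, e) | v <- Vs, e <- Es], f <- Fs] | cve x.1.1 x.1.2 && cef x.1.2 x.2].
End Complex.

(** * Automorphisms act freely on flags *)

Section Flags.
Variable M : finite_map.

Lemma card2_other (T : finType) (A : {set T}) (x y z : T) :
  #|A| = 2 -> x \in A -> y \in A -> z \in A -> y != x -> z != x -> y = z.
Proof.
move=> /eqP/cards2P[a [b [_ ->]]]; rewrite !inE.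
by move=> /orP[]/eqP-> /orP[]/eqP-> /orP[]/eqP->; rewrite ?eqxx.
Qed.

(** The ends of an edge, its sides, and the edges of a face at a vertex come in pairs, so fixing one
    member of a pair fixes the other. [vertex_cycle] spreads this around a vertex and
    [map_connected] over the whole map. *)
Lemma flag_free (s : cell_perm M) v e f :
  s \in automorphisms M -> flag v e f ->
  vperm s v = v -> eperm s e = e -> fperm s f = f -> s = 1%g.
Proof.
move=> /automorphismP[sv sf] /andP[ve0 ef0] v0 e0 f0.
have otherE (w : vertex M) (d d' : edge M) (g : face M) : vperm s w = w -> eperm s d = d -> fperm s g = g ->
    ve w d -> ve w d' -> ef d g -> ef d' g -> eperm s d' = d'.
  move=> hw hd hg wd wd' dg d'g; have [->//|nd] := eqVneq d' d.
  apply: (card2_other (face_corners (v := w) (f := g) _) (x := d)).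
  - by exists d; rewrite wd dg.
  - by rewrite inE wd dg.
  - by rewrite inE -[X in ve X]hw -[X in ef _ X]hg sv sf wd' d'g.
  - by rewrite inE wd' d'g.
  - by rewrite -hd (inj_eq perm_inj).
  - exact: nd.
have otherF (d : edge M) (g g' : face M) : eperm s d = d -> fperm s g = g ->
    ef d g -> ef d g' -> fperm s g' = g'.
  move=> hd hg dg dg'; have [->//|ng] := eqVneq g' g.
  apply: (card2_other (edge_sides d) (x := g)); rewrite ?inE //.
  - by rewrite -[X in ef X]hd sf.
  - by rewrite -hg (inj_eq perm_inj).
have otherV (d : edge M) (w w' : vertex M) : eperm s d = d -> vperm s w = w ->
    ve w d -> ve w' d -> vperm s w' = w'.
  move=> hd hg dg dg'; have [->//|ng] := eqVneq w' w.
  apply: (card2_other (edge_ends d) (x := w)); rewrite ?inE //.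
  - by rewrite -[X in ve _ X]hd sv.
  - by rewrite -hg (inj_eq perm_inj).
(* One fixed side suffices here: the other side is then fixed as well, by [okF]. *)
pose ok (d : edge M) := eperm s d = d /\ exists2 g, ef d g & fperm s g = g.
have okF d g : ok d -> ef d g -> fperm s g = g.
  by move=> [hd [g' dg' hg']] dg; apply: otherF hd hg' dg' dg.
have okV w d d' : vperm s w = w -> ve w d -> ok d -> ve w d' -> ok d'.
  move=> hw wd okd wd'; have /connectP[p pp ->] := vertex_cycle wd wd'.
  elim: p d okd wd pp => //= a p IH d okd wd /andP[/and3P[_ wa /existsP[g /andP[dg ag]]] pp].
  apply: IH pp => //; have hg := okF _ _ okd dg; split; last by exists g.
  by case: okd => hd _; apply: otherE hw hd hg wd wa dg ag.
pose okw w := vperm s w = w /\ forall d, ve w d -> ok d.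
have all_ok w : okw w.
  have /connectP[p pp ->] := map_connected v w.
  have okv : okw v.
    split=> // d vd; apply: (okV v e d) => //.
    by split=> //; exists f.
  elim: p v okv pp {ve0 v0} => //= a p IH v okv /andP[/existsP[d /andP[vd ad]] pp].
  apply: IH pp; case: okv => hv hvd; have [hd hdd] := hvd d vd.
  have ha : vperm s a = a by apply: otherV hd hv vd ad.
  by split=> // d' ad'; apply: (okV a d d' ha ad _ ad').
have endE (d : edge M) : exists w, ve w d.
  have /eqP/cards2P[a [b [_ /setP/(_ a)]]] := edge_ends d; rewrite !inE eqxx => h.
  by exists a.
case: s @ok okF okV @okw all_ok sv sf v0 e0 f0 otherE otherF otherV => [[s1 s2] s3] ok okF okV okw all_ok _ _ _ _ _ _ _ _.
have okd d : ok d by have [w wd] := endE d; case: (all_ok w) => _; apply.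
congr ((_, _), _); apply/permP => x; rewrite perm1.
- by case: (all_ok x).
- by case: (okd x).
- by have [d dx] := face_nonempty x; apply: okF dx.
Qed.
End Flags.

(** * Tables of the cuboctahedron, the icosidodecahedron and the two polyhedra *)

Definition sgnZ (b : bool) : Z := if b then (-1)%zz else 1%zz.
Definition shifts (x y z : zt) : seq vt := [:: (x, y, z); (y, z, x); (z, x, y)].
Definition bools := [:: false; true].

(* The vertices of unit_icosidodecahedron, times 2. *)
Definition ico_pts : seq vt :=
  flatten [seq shifts (Z0, Z.mul 2%zz (sgnZ i)) zt0 zt0 | i <- bools] ++
  flatten [seq shifts (sgnZ b.1.1, Z0) (Z0, sgnZ b.1.2) (sgnZ b.2, sgnZ b.2)
          | b <- [seq (c, k) | c <- [seq (i, j) | i <- bools, j <- bools], k <- bools]].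
(* The vertices of unit_cuboctahedron, times the square root of 2. *)
Definition cub_pts : seq vt :=
  flatten [seq shifts (sgnZ b.1, Z0) (sgnZ b.2, Z0) zt0
          | b <- [seq (i, j) | i <- bools, j <- bools]].

(* Inner products of two points, in decreasing order: their index in this list,
   the class of the two points, encodes their distance. *)
Definition ico_vals : seq zt :=
  [:: (4, 4); (2, 4); (2, 2); (0, 2); (0, 0);
      (0, -2); (-2, -2); (-2, -4); (-4, -4)]%zz.
Definition cub_vals : seq zt := [:: (2, 0); (1, 0); (0, 0); (-1, 0); (-2, 0)]%zz.

Definition class_table (vals : seq zt) (pts : seq vt) : seq (seq nat) :=
  [seq [seq find (zteq (ip p q)) vals | q <- pts] | p <- pts].
(** The axes through vertices are two-fold axes of both solids. With [N] the squared length of a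
    vertex, the image [y] of [x] under the half-turn about [k] satisfies N y = 2 (x . k) k - N x,
    which avoids division. *)
Definition half_turns (N : zt) (pts : seq vt) : seq (seq nat) :=
  [seq [seq find (fun y => vteq (vtZ N y)
                   (vtB (vtZ (ztD (ip x k) (ip x k)) k) (vtZ N x))) pts
       | x <- pts] | k <- pts].
Definition antipodes (pts : seq vt) : seq nat :=
  [seq find (fun y => vteq y (vtB vt0 x)) pts | x <- pts].
Definition entry (T : seq (seq nat)) (i j : nat) : nat := nth 0 (nth [::] T i) j.

Definition ico_table := Eval vm_compute in class_table ico_vals ico_pts.
Definition cub_table := Eval vm_compute in class_table cub_vals cub_pts.
Definition ico_half := Eval vm_compute in half_turns (4, 4)%zz ico_pts.
Definition cub_half := Eval vm_compute in half_turns (2, 0)%zz cub_pts.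
Definition ico_anti := Eval vm_compute in antipodes ico_pts.
Definition cub_anti := Eval vm_compute in antipodes cub_pts.

(* Galois conjugation of Q(sqrt 5), followed by an exchange of two coordinates
   and a scaling, permutes the vertices of the icosidodecahedron. *)
Definition galois_conj (x : zt) : zt := (Z.add x.1 x.2, Z.opp x.2).
Definition ico_conj : seq nat := Eval vm_compute in
  [seq find (fun y => vteq y (vtZ (1, 1)%zz (galois_conj x.2, galois_conj x.1.2, galois_conj x.1.1))) ico_pts
  | x <- ico_pts].

Notation icl := (entry ico_table).

(* The edges of both polyhedra, directed from u to v for the pairs (u, v) in
   one orbit of the rotation group. *)
Definition ico_edges : seq (nat * nat) := Eval vm_compute in
  reach (fun p : nat * nat => [seq (nth 0 g p.1, nth 0 g p.2)
                              | g <- [seq nth [::] ico_half k | k <- [:: 0; 1; 6]]])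
        200 (7, 0).
Definition pent_faces : seq (seq nat) :=
 [:: [:: 7; 0; 10; 24; 18];
     [:: 22; 0; 19; 21; 27];
     [:: 8; 1; 11; 25; 19];
     [:: 23; 1; 20; 22; 28];
     [:: 6; 2; 9; 26; 20];
     [:: 21; 2; 18; 23; 29];
     [:: 16; 3; 13; 6; 12];
     [:: 25; 3; 28; 15; 9];
     [:: 17; 4; 14; 7; 13];
     [:: 26; 4; 29; 16; 10];
     [:: 15; 5; 12; 8; 14];
     [:: 24; 5; 27; 17; 11];
     [:: 7; 0; 19; 8; 14];
     [:: 22; 0; 10; 26; 20];
     [:: 8; 1; 20; 6; 12];
     [:: 23; 1; 11; 24; 18];
     [:: 6; 2; 18; 7; 13];
     [:: 21; 2; 9; 25; 19];
     [:: 16; 3; 28; 23; 29];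
     [:: 25; 3; 13; 17; 11];
     [:: 17; 4; 29; 21; 27];
     [:: 26; 4; 14; 15; 9];
     [:: 15; 5; 27; 22; 28];
     [:: 24; 5; 12; 16; 10] ].
Definition hex_faces : seq (seq nat) :=
 [:: [:: 7; 0; 10; 26; 4; 14];
     [:: 7; 0; 19; 21; 2; 18];
     [:: 22; 0; 19; 8; 1; 20];
     [:: 22; 0; 10; 24; 5; 27];
     [:: 8; 1; 11; 24; 5; 12];
     [:: 23; 1; 20; 6; 2; 18];
     [:: 23; 1; 11; 25; 3; 28];
     [:: 6; 2; 9; 25; 3; 13];
     [:: 21; 2; 9; 26; 4; 29];
     [:: 16; 3; 28; 15; 5; 12];
     [:: 16; 3; 13; 17; 4; 29];
     [:: 17; 4; 14; 15; 5; 27];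
     [:: 13; 6; 12; 8; 14; 7];
     [:: 20; 6; 12; 16; 10; 26];
     [:: 18; 7; 13; 17; 11; 24];
     [:: 19; 8; 14; 15; 9; 25];
     [:: 15; 9; 26; 20; 22; 28];
     [:: 16; 10; 24; 18; 23; 29];
     [:: 17; 11; 25; 19; 21; 27];
     [:: 29; 21; 27; 22; 28; 23] ].

Lemma pent_complex_ok : complex_ok 30 ico_edges pent_faces.
Proof. vm_cast_no_check (erefl true). Qed.
Lemma hex_complex_ok : complex_ok 30 ico_edges hex_faces.
Proof. vm_cast_no_check (erefl true). Qed.

(** The half-turns about vertices 0 and 1, on two coordinate axes, generate a Klein four-group. The
    only proper subgroup of A5 strictly above it is an A4, whose involutions all lie in the
    four-group; hence one further half-turn generates the rotation group. For the cuboctahedron the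
    three half-turns of [cub_gens] act on the diagonals of the cube as transpositions that generate
    S4. *)
Definition ico_gens : seq (seq nat) :=
  [:: nth [::] ico_half 0; nth [::] ico_half 1; nth [::] ico_half 6].
Definition cub_gens : seq (seq nat) :=
  [:: nth [::] cub_half 0; nth [::] cub_half 1; nth [::] cub_half 3].

Local Open Scope ring_scope.

(** * Isometries, half-turns, and the real points behind the tables *)

Section Isometries.
Variable R : realType.
Notation point := 'rV[R]_3.
Implicit Types (x y : point) (A : 'M[R]_3).

Lemma direct_isometry_isometry g : direct_isometry g -> euclid_isometry (g : point -> point).
Proof.
move=> [A [b [AA _ gE]]] x y; apply/dist_eqP; rewrite !gE.
by rewrite opprD addrACA subrr addr0 -mulmxBl dotmul_mx.
Qed.

Lemma isometry_similarity (g : point -> point) : euclid_isometry g -> similarity 1 g.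
Proof. by move=> h; split=> // x y; rewrite mul1r h. Qed.

Lemma orthogonal_tr A : A *m A^T = 1%:M -> A^T *m A = 1%:M.
Proof. by move/mulmx1C. Qed.

Lemma similarity_inverse c (g : point -> point) : similarity c g ->
  exists h, [/\ similarity c^-1 h, cancel g h & cancel h g].
Proof.
move=> sg; have [A [b [AA gE]]] := similarity_affine sg; case: sg => c0 gd.
have cn : c != 0 by rewrite gt_eqF.
pose h y := c^-1 *: ((y - b) *m A^T).
have hK : cancel h g.
  move=> y; rewrite gE /h -scalemxAl scalerA divff // scale1r.
  by rewrite -mulmxA orthogonal_tr // mulmx1 subrK.
exists h; split=> //.
- split; first by rewrite invr_gt0.
  by move=> x y; rewrite -{2}(hK x) -{2}(hK y) gd mulKf.
- by move=> x; rewrite /h gE addrK -scalemxAl scalerA mulVf // scale1r -mulmxA AA mulmx1.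
Qed.

Lemma direct_isometry_comp g h : direct_isometry g -> direct_isometry h ->
  direct_isometry (h \o g : point -> point).
Proof.
move=> [A [b [AA Ad gE]]] [B [d [BB Bd hE]]].
exists (A *m B), (b *m B + d); split.
- by rewrite trmx_mul mulmxA -(mulmxA A) BB mulmx1.
- by rewrite det_mulmx Ad Bd mulr1.
- by move=> x /=; rewrite hE gE mulmxDl mulmxA addrA.
Qed.

Lemma direct_isometry_inverse (g : point -> point) : direct_isometry g ->
  exists h, [/\ direct_isometry h, cancel g h & cancel h g].
Proof.
move=> [A [b [AA Ad gE]]]; exists (fun y => (y - b) *m A^T); split.
- exists A^T, (- b *m A^T); split; first by rewrite trmxK orthogonal_tr.
    by rewrite det_tr.
  by move=> x; rewrite mulmxDl.
- by move=> x; rewrite gE addrK -mulmxA AA mulmx1.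
- by move=> x; rewrite gE -mulmxA orthogonal_tr // mulmx1 subrK.
Qed.

(** Conjugation turns the matrix [B] of [h] into [A^T *m B *m A], of determinant 1 even if [g]
    reverses orientation. *)
Lemma direct_isometry_conj c (g h : point -> point) : similarity c g -> direct_isometry h ->
  exists2 k, direct_isometry k & forall x, k (g x) = g (h x).
Proof.
move=> sg [B [d [BB Bd hE]]]; have [A [b [AA gE]]] := similarity_affine sg.
exists (fun y => (y - b) *m (A^T *m B *m A) + (c *: (d *m A) + b)).
  exists (A^T *m B *m A), (- b *m (A^T *m B *m A) + (c *: (d *m A) + b)); split.
  - rewrite !trmx_mul trmxK !mulmxA -(mulmxA _ A) AA mulmx1.
    by rewrite -(mulmxA A^T B) BB mulmx1 orthogonal_tr.
  - by rewrite !det_mulmx Bd mulr1 -det_mulmx orthogonal_tr ?det1.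
  - by move=> x; rewrite mulmxDl -!addrA.
move=> x; rewrite !gE hE addrK mulmxDl scalerDr addrA; congr (_ + _ + _).
by rewrite -scalemxAl !mulmxA -(mulmxA x) AA mulmx1.
Qed.

Lemma dist_sqr_dot x y : dist x y ^+ 2 = dotmul x x + dotmul y y - 2 * dotmul x y.
Proof. by rewrite dist_sqr !dotmul_lin (dotmulC y x); ring. Qed.

Definition half_turn (k x : point) : point := (2 / dotmul k k * dotmul x k) *: k - x.

Lemma half_turn_direct k : dotmul k k != 0 -> direct_isometry (half_turn k).
Proof.
move=> k0; pose A : 'M[R]_3 := \matrix_(i, j) (2 / dotmul k k * k 0 i * k 0 j - (i == j)%:R).
exists A, 0; split.
- apply/matrixP => i j; rewrite [RHS]mxE mxE sum3 !mxE; move: k0; rewrite dotmulE => k0.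
  by move: i j; do 2 apply: forall_ord3; rewrite /=; field.
- by rewrite det_mx33 !mxE /=; move: k0; rewrite dotmulE => k0; field.
- move=> x; rewrite addr0 /half_turn; apply: rv3P; rewrite !mxE sum3 !mxE /=;
  by move: k0; rewrite !dotmulE => k0; field.
Qed.
End Isometries.

Definition points_ok (pts : seq vt) (vals : seq zt) (T H : seq (seq nat)) (a : seq nat) : bool :=
  let n := size pts in let I := iota 0 n in let K := iota 0 (size vals) in
  let p := nth vt0 pts in let v := nth zt0 vals in let N := v 0%N in
  [&& all (fun i => all (fun j => zteq (ip (p i) (p j)) (v (entry T i j))
                                && (entry T i j < size vals)%N) I) I,
      all (fun k => all (fun l => (k < l)%N ==> ztpos (ztB (v k) (v l))) K) K,
      all (fun i => all (fun j => (entry T i j == 0%N) == (i == j)) I) I,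
      ztpos N &
      all (fun k => all (fun i => vteq (vtZ N (p (entry H k i)))
              (vtB (vtZ (ztD (ip (p i) (p k)) (ip (p i) (p k))) (p k)) (vtZ N (p i)))
              && (entry H k i < n)%N) I) I] &&
  all (fun i => vteq (p (nth 0%N a i)) (vtB vt0 (p i)) && (nth 0%N a i < n)%N) I.

Lemma ico_points_ok : points_ok ico_pts ico_vals ico_table ico_half ico_anti.
Proof. vm_cast_no_check (erefl true). Qed.
Lemma cub_points_ok : points_ok cub_pts cub_vals cub_table cub_half cub_anti.
Proof. vm_cast_no_check (erefl true). Qed.

Section Points.
Variables (R : realType) (pts : seq vt) (vals : seq zt) (T H : seq (seq nat)) (a : seq nat).
Variable s : R.
Hypothesis ok : points_ok pts vals T H a.
Hypothesis s_gt0 : 0 < s.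
Notation n := (size pts).

Definition pt (i : nat) : 'rV[R]_3 := s *: vev R (nth vt0 pts i).

Lemma pt_dot i j : (i < n)%N -> (j < n)%N ->
  dotmul (pt i) (pt j) = s ^+ 2 * ev R (nth zt0 vals (entry T i j)).
Proof.
move=> hi hj; case/andP: ok => /and5P[/all_iota/(_ _ hi)/all_iota/(_ _ hj)/andP[e _] _ _ _ _] _.
by rewrite dotmulZl dotmulZr vev_dot (ev_eq _ e) mulrA expr2.
Qed.

Lemma entry_diag i : (i < n)%N -> entry T i i = 0%N.
Proof.
move=> hi; case/andP: ok => /and5P[_ _ /all_iota/(_ _ hi)/all_iota/(_ _ hi) + _ _] _.
by rewrite eqxx => /eqP/eqP.
Qed.

Lemma pt_dist2 i j : (i < n)%N -> (j < n)%N ->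
  dist (pt i) (pt j) ^+ 2 =
  2 * s ^+ 2 * (ev R (nth zt0 vals 0) - ev R (nth zt0 vals (entry T i j))).
Proof.
move=> hi hj; rewrite dist_sqr_dot !pt_dot //.
by rewrite !entry_diag //; ring.
Qed.

Lemma vals_inj k l : (k < size vals)%N -> (l < size vals)%N ->
  ev R (nth zt0 vals k) = ev R (nth zt0 vals l) -> k = l.
Proof.
move=> hk hl e; case/andP: ok => /and5P[_ h _ _ _] _.
have hlt k' l' : (k' < size vals)%N -> (l' < size vals)%N -> (k' < l')%N ->
    ev R (nth zt0 vals k') <> ev R (nth zt0 vals l').
  move=> hk' hl' kl e'; move: h => /all_iota/(_ _ hk')/all_iota/(_ _ hl').
  by rewrite kl => /(ev_pos R); rewrite evB e' subrr ltxx.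
by case: (ltngtP k l) => // [/hlt-/(_ hk hl)|/hlt-/(_ hl hk)] //; rewrite e.
Qed.

Lemma entry_bound i j : (i < n)%N -> (j < n)%N -> (entry T i j < size vals)%N.
Proof.
by move=> hi hj; case/andP: ok => /and5P[/all_iota/(_ _ hi)/all_iota/(_ _ hj)/andP[]].
Qed.

Lemma pt_dist_eq i j k l : (i < n)%N -> (j < n)%N -> (k < n)%N -> (l < n)%N ->
  dist (pt i) (pt j) = dist (pt k) (pt l) <-> entry T i j = entry T k l.
Proof.
move=> hi hj hk hl; split=> [e|e]; last first.
  apply/eqP; rewrite -(@eqrXn2 _ 2) ?dist_ge0 //.
  by rewrite !pt_dist2 // e.
apply: vals_inj; rewrite ?entry_bound //.
have := congr1 (fun t => t ^+ 2) e; rewrite /= !pt_dist2 //.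
have s2 : 2 * s ^+ 2 != 0 by rewrite mulf_neq0 ?expf_neq0 ?gt_eqF ?pnatr_eq0.
by move/(mulfI s2)/addrI/oppr_inj.
Qed.

Lemma pt_inj i j : (i < n)%N -> (j < n)%N -> pt i = pt j -> i = j.
Proof.
move=> hi hj e; have := (pt_dist_eq hi hj hi hi).1; rewrite e distxx => /(_ erefl).
rewrite entry_diag // => e0.
case/andP: ok => /and5P[_ _ /all_iota/(_ _ hi)/all_iota/(_ _ hj) + _ _] _.
by rewrite e0 eqxx => /eqP/esym/eqP.
Qed.

Lemma half_turn_pt k i : (k < n)%N -> (i < n)%N -> half_turn (pt k) (pt i) = pt (entry H k i).
Proof.
move=> hk hi; case/andP: ok => /and5P[_ _ _ /(ev_pos R) N0 /all_iota/(_ _ hk)/all_iota/(_ _ hi)/andP[/(vev_eq R) e _]] _.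
have := pt_dot hk hk; rewrite entry_diag // /half_turn /pt !dotmulZl !dotmulZr.
move: e; rewrite vevB !vevZ evD -vev_dot.
move: (vev _ (nth vt0 pts k)) (vev _ (nth vt0 pts i)) (vev _ _) (ev _ _) N0 => p q p' N N0 e eN.
have {}eN : dotmul p p = N.
  by apply: (mulfI (x := s ^+ 2)); rewrite ?expf_neq0 ?gt_eqF // -eN; ring.
have -> : p' = N^-1 *: ((dotmul q p + dotmul q p) *: p - N *: q).
  by rewrite -e scalerA mulVf ?gt_eqF // scale1r.
rewrite eN !scalerBr !scalerA; congr (_ *: _ - _ *: _); field; by rewrite !gt_eqF.
Qed.

Lemma half_entry_lt k i : (k < n)%N -> (i < n)%N -> (entry H k i < n)%N.
Proof.
by move=> hk hi; case/andP: ok => /and5P[_ _ _ _ /all_iota/(_ _ hk)/all_iota/(_ _ hi)/andP[]].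
Qed.

Lemma antipode_pt i : (i < n)%N -> pt (nth 0%N a i) = - pt i.
Proof.
move=> hi; case/andP: ok => _ /all_iota/(_ _ hi)/andP[/(vev_eq R) e _].
by rewrite /pt e vevB vev0 sub0r scalerN.
Qed.

Lemma pt_norm_neq0 k : (k < n)%N -> dotmul (pt k) (pt k) != 0.
Proof.
move=> hk; case/andP: ok => /and5P[_ _ _ /(ev_pos R) N0 _] _.
by rewrite pt_dot // entry_diag // mulf_neq0 ?expf_neq0 ?gt_eqF.
Qed.
End Points.

Section UnitSets.
Variable R : realType.
Notation golden := (golden R).

Lemma ev_sgn b : evZ R (sgnZ b) = (-1) ^+ b.
Proof. by case: b. Qed.

Lemma vec3Z c (x y z : R) : c *: vec3 x y z = vec3 (c * x) (c * y) (c * z).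
Proof. by apply: rv3P; rewrite !mxE. Qed.

Lemma cyclic_shiftsP (c : R) (x y z : zt) (x' y' z' : R) (p : 'rV[R]_3) :
  c * ev R x = x' -> c * ev R y = y' -> c * ev R z = z' ->
  cyclic_shifts x' y' z' p <-> exists2 q, q \in shifts x y z & p = c *: vev R q.
Proof.
move=> <- <- <-; split=> [[->|[->|->]]|[q]].
- by exists (x, y, z); rewrite ?mem_head // /vev vec3Z.
- by exists (y, z, x); rewrite ?inE ?eqxx ?orbT // /vev vec3Z.
- by exists (z, x, y); rewrite ?inE ?eqxx ?orbT // /vev vec3Z.
by rewrite !inE => /or3P[]/eqP-> ->; rewrite /vev vec3Z; [left|right; left|right; right].
Qed.

Lemma pts_range c (pts : seq vt) (p : 'rV[R]_3) :
  (exists2 q, q \in pts & p = c *: vev R q) <-> exists2 i, (i < size pts)%N & p = pt pts c i.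
Proof.
split=> [[q qp ->]|[i hi ->]]; last by exists (nth vt0 pts i); rewrite ?mem_nth.
by exists (index q pts); rewrite ?index_mem // /pt nth_index.
Qed.

Lemma evZ1 z : ev R (z, Z0) = evZ R z.
Proof. by rewrite /ev /= {2}/evZ /= mul0r addr0. Qed.

Lemma evZ2 z : ev R (Z0, z) = evZ R z * golden.
Proof. by rewrite /ev /= {1}/evZ /= add0r. Qed.

Lemma unit_icosidodecahedronP (p : 'rV[R]_3) :
  unit_icosidodecahedron p <-> exists2 i, (i < size ico_pts)%N & p = pt ico_pts 2^-1 i.
Proof.
rewrite -pts_range; have two : (2 : R) != 0 by rewrite pnatr_eq0.
have e1 i : 2^-1 * ev R (Z0, Z.mul 2%zz (sgnZ i)) = (-1) ^+ i * golden.
  by rewrite evZ2 evZM ev_sgn (_ : evZ R 2%zz = 2) //; field.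
have e0 : 2^-1 * ev R zt0 = 0 by rewrite ev0 mulr0.
have e2 i : 2^-1 * ev R (sgnZ i, Z0) = (-1) ^+ i / 2.
  by rewrite evZ1 ev_sgn mulrC.
have e3 i : 2^-1 * ev R (Z0, sgnZ i) = (-1) ^+ i * golden / 2.
  by rewrite evZ2 ev_sgn mulrC.
have e4 i : 2^-1 * ev R (sgnZ i, sgnZ i) = (-1) ^+ i * golden ^+ 2 / 2.
  by rewrite /ev /= ev_sgn golden_sqr; ring.
split.
- case=> [[i /(cyclic_shiftsP _ (e1 i) e0 e0)[q qs ->]]|[i [j [k /(cyclic_shiftsP _ (e2 i) (e3 j) (e4 k))[q qs ->]]]]].
    by exists q => //; move: qs; case: i; rewrite !inE => /or3P[]/eqP->.
  by exists q => //; move: qs; case: i; case: j; case: k; rewrite !inE => /or3P[]/eqP->.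
- case=> q; rewrite mem_cat => /orP[]/flattenP[r /mapP[b _ ->] qr] ->.
    by left; exists b; apply/(cyclic_shiftsP _ (e1 b) e0 e0); exists q.
  right; exists b.1.1, b.1.2, b.2.
  by apply/(cyclic_shiftsP _ (e2 _) (e3 _) (e4 _)); exists q.
Qed.

Lemma unit_cuboctahedronP (p : 'rV[R]_3) :
  unit_cuboctahedron p <-> exists2 i, (i < size cub_pts)%N & p = pt cub_pts (Num.sqrt 2)^-1 i.
Proof.
rewrite -pts_range.
have e0 : (Num.sqrt 2)^-1 * ev R zt0 = 0 by rewrite ev0 mulr0.
have e2 i : (Num.sqrt 2)^-1 * ev R (sgnZ i, Z0) = (-1) ^+ i / Num.sqrt 2.
  by rewrite evZ1 ev_sgn mulrC.
split.
- case=> i [j /(cyclic_shiftsP _ (e2 i) (e2 j) e0)[q qs ->]].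
  by exists q => //; move: qs; case: i; case: j; rewrite !inE => /or3P[]/eqP->.
- case=> q /flattenP[r /mapP[b _ ->] qr] ->.
  by exists b.1, b.2; apply/(cyclic_shiftsP _ (e2 _) (e2 _) e0); exists q.
Qed.
End UnitSets.

Local Close Scope ring_scope.

(** * Boolean checks on a table of classes *)

Section Checks.
Variables (n : nat) (T : seq (seq nat)).
Let I := iota 0 n.
Let t := entry T.

Definition symmetry_ok (g : seq nat) : bool :=
  all (fun i => (nth 0 g i < n) &&
         all (fun j => t (nth 0 g i) (nth 0 g j) == t i j) I) I.

(* A class-preserving permutation that fixes 0 and j fixes everything. *)
Definition rigid_ok (j : nat) : bool :=
  has (fun m =>
    all (fun m' => (t 0 m' == t 0 m) && (t j m' == t j m) ==> (m' == m)) I &&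
    all (fun k => all (fun k' =>
      [&& t 0 k == t 0 k', t j k == t j k' & t m k == t m k'] ==> (k == k')) I) I) I.

Definition class_pairs (d : nat) : seq (nat * nat) :=
  [seq p <- [seq (i, j) | i <- I, j <- I] | t p.1 p.2 == d].

(** The number 4 matches the bound on the edges at a vertex: if all pairs of class [d] are edges, no
    other edge fits. *)
Definition transitive_ok (gens : seq (seq nat)) (d : nat) : bool :=
  let s := class_pairs d in
  all (mem (reach (fun p : nat * nat => [seq (nth 0 g p.1, nth 0 g p.2) | g <- gens])
                  (n * n) (head (0, 0) s))) s &&
  all (fun i => count (fun j => t i j == d) I == 4) I.

(** Then the graph whose edges are the pairs with class in [B] is disconnected: no such pair leads
    from [L], which contains 0, to a vertex outside. *)
Definition closed_ok (L B : seq nat) : bool :=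
  [&& 0 \in L, all (fun i => all (fun j => (i \in L) && (t i j \in B) ==> (j \in L)) I) I
    & has (fun k => k \notin L) I].

Definition classes_ok (D B : seq nat) : bool :=
  all (fun i => all (fun j => [|| t i j \in D, t i j \in B | i == j]) I) I.

Definition swap_ok (H : seq (seq nat)) (d : nat) : bool :=
  all (fun i => all (fun j => (t i j == d) ==>
    has (fun k => (entry H k i == j) && (entry H k j == i)) I) I) I.

Fixpoint table_walks (d k i j : nat) : nat :=
  if k is k'.+1 then sumn [seq table_walks d k' l j | l <- I & t i l == d] else (i == j : bool).

(** This number depends on the edge graph alone, so it is preserved by automorphisms that are not
    isometries, unlike the classes themselves. *)
Definition walk_sum d i j := table_walks d 2 i j + table_walks d 3 i j.

Definition asymmetric_ok (d : nat) : bool :=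
  let s := [seq j <- I | t 0 j == d] in
  all (fun x => all (fun y => all (fun y' =>
    uniq [:: x; y; y'] ==> (walk_sum d x y != walk_sum d x y')) s) s) s.
End Checks.

(** * Incidence in maps, stabilizers, and the consequences of index 2 *)

Section MapFacts.
Variable M : finite_map.

Lemma edge_end_eq (e : edge M) (u v w : vertex M) :
  ve u e -> ve v e -> ve w e -> v != u -> w != u -> v = w.
Proof.
by move=> hu hv hw; apply: (card2_other (edge_ends e)); rewrite inE.
Qed.

Lemma edge_other_end (e : edge M) u : ve u e -> exists2 v, v != u & ve v e.
Proof.
have /eqP/cards2P[a [b [ab ee]]] := edge_ends e.
have hE w : ve w e = (w == a) || (w == b) by move/setP/(_ w): ee; rewrite !inE.
by rewrite hE => /orP[]/eqP->; [exists b | exists a]; rewrite ?hE ?eqxx ?orbT // eq_sym.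
Qed.

Lemma joinedP (u v : vertex M) : reflect (u <> v /\ exists2 e, ve u e & ve v e) (joined u v).
Proof.
apply: (iffP andP) => [[/eqP uv /existsP[e /andP[ue ve]]]|[/eqP uv [e ue ve]]].
  by split=> //; exists e.
by split=> //; apply/existsP; exists e; rewrite ue ve.
Qed.

Lemma joined_sym (u v : vertex M) : joined u v = joined v u.
Proof.
by rewrite /joined eq_sym; congr (_ && _); apply: eq_existsb => e; rewrite andbC.
Qed.

Lemma face_other_edge (f : face M) v e : flag v e f -> exists2 d, d != e & flag v d f.
Proof.
move=> vef; have /eqP/cards2P[a [b [ab ee]]] := face_corners (v := v) (f := f) (ex_intro _ e vef).
have hE d : flag v d f = (d == a) || (d == b) by move/setP/(_ d): ee; rewrite !inE.
by move: vef; rewrite hE => /orP[]/eqP->; [exists b | exists a]; rewrite ?hE ?eqxx ?orbT // eq_sym.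
Qed.

Lemma face_edge_eq (f : face M) v e d d' :
  flag v e f -> flag v d f -> flag v d' f -> d != e -> d' != e -> d = d'.
Proof.
move=> h h1 h2; apply: (card2_other (face_corners (v := v) (f := f) (ex_intro _ e h)));
by rewrite inE.
Qed.

Lemma edge_side_exists (e : edge M) : exists f, ef e f.
Proof.
have /eqP/cards2P[a [b [ab /setP/(_ a)]]] := edge_sides e.
by rewrite !inE eqxx; exists a.
Qed.

Lemma aut_joined s u v : s \in automorphisms M ->
  joined (vperm s u) (vperm s v) = joined u v.
Proof.
move=> /automorphismP[sv _]; apply/joinedP/joinedP => -[uv [e ue ve]]; split.
- by move=> e'; apply: uv; rewrite e'.
- exists ((eperm s)^-1%g e); first by rewrite -sv permKV.
  by rewrite -sv permKV.
- by move/perm_inj.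
- by exists (eperm s e); rewrite sv.
Qed.

Lemma aut_flag s v e f : s \in automorphisms M ->
  flag (vperm s v) (eperm s e) (fperm s f) = flag v e f.
Proof. by move=> /automorphismP[sv sf]; rewrite /flag sv sf. Qed.

Definition stab v := [set s in automorphisms M | vperm s v == v]%SET.

(** By regularity the stabilizer of [v] takes one flag at [v] to every flag at [v], and each edge at
    [v] belongs to two of these. *)
Lemma stab_card v : regular_map M -> 2 * #|[set e | ve v e]%SET| <= #|stab v|.
Proof.
move=> reg; have [e0 ve0] := vertex_nonisolated v; have [f0 ef0] := edge_side_exists e0.
pose B := [set p : edge M * face M | ve v p.1 && ef p.1 p.2]%SET.
have -> : 2 * #|[set e | ve v e]%SET| = #|B|.
  rewrite -[RHS]sum1_card (eq_bigl (fun p : edge M * face M => ve v p.1 && ef p.1 p.2)); last first.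
    by move=> p; rewrite inE.
  rewrite -(pair_big_dep (fun e => ve v e) (fun e f => ef e f) (fun _ _ => 1)) /=.
  rewrite (eq_bigr (fun=> 2)); last first.
    move=> e _; rewrite -[RHS](edge_sides e) -sum1_card; apply: eq_bigl => f.
    by rewrite inE.
  by rewrite sum_nat_const mulnC; congr (_ * _); apply: eq_card => e; rewrite inE.
apply: leq_trans (leq_imset_card (fun s : cell_perm M => (eperm s e0, fperm s f0)) (stab v)).
apply/subset_leq_card/fintype.subsetP => -[e f]; rewrite inE /= => vef.
have [|s sA [sv se sf]] := reg v e0 f0 v e f _ vef; first by rewrite /flag ve0.
by apply/imsetP; exists s; rewrite ?se ?sf // inE sA sv eqxx.
Qed.
End MapFacts.

(** Outside [B] there is only one right coset, which therefore contains both [s] and [t]. *)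
Lemma index2_div (gT : finGroupType) (A B : {group gT}) s t : (B \subset A)%g ->
  #|A : B|%g = 2 -> s \in A -> t \in A -> s \notin B -> t \notin B -> (s * t^-1)%g \in B.
Proof.
move=> sBA i2 sA tA sB tB; rewrite -mem_rcoset.
have h x : x \in A -> (B :* x)%g \in rcosets B A by move=> xA; apply/rcosetsP; exists x.
suff <- : (B :* s = B :* t)%g by apply: rcoset_refl.
have rc x : x \notin B -> (B :* x)%g != B.
  by apply: contraNneq => <-; apply: rcoset_refl.
have hB : (B : {set gT}) \in rcosets B A by have := h 1%g (group1 A); rewrite rcoset1.
exact: (card2_other (i2 : #|rcosets B A| = 2) hB (h s sA) (h t tA) (rc s sB) (rc t tB)).
Qed.

Section Index2.
Variables (R : realType) (X : polyhedron R).
Notation V := (vertex X).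
Local Open Scope classical_set_scope.

Lemma vperm_inj : {in automorphisms X &, injective (@vperm X)}.
Proof.
move=> [[s1 s2] s3] [[t1 t2] t3] /automorphismP[] /= sv sf /automorphismP[] /= tv tf.
rewrite /vperm /= => e1; move: sv tv; rewrite /vperm /eperm /= e1 => sv tv.
have e2 : s2 = t2.
  apply/permP => e; apply: (@edge_inj _ X); apply/setP => v; rewrite !inE.
  by rewrite -(permKV t1 v) sv tv.
move: sf tf; rewrite /eperm /fperm /= e2 => sf tf; congr ((_, _), _).
apply/permP => f; apply: (@face_inj _ X); apply/setP => e; rewrite !inE.
by rewrite -(permKV t2 e) sf tf.
Qed.

Definition vertex_symmetries : {set {perm V}} :=
  [set s : {perm V} | `[< exists2 g, symmetry X g & forall v : V, pos (s v) = g (pos v) >]]%SET.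

Lemma vertex_symmetriesP (s : {perm V}) :
  reflect (exists2 g, symmetry X g & forall v : V, pos (s v) = g (pos v)) (s \in vertex_symmetries).
Proof. by rewrite finset.in_set; apply: asboolP. Qed.

Lemma vertex_symmetries_group_set : group_set vertex_symmetries.
Proof.
apply/group_setP; split.
  apply/vertex_symmetriesP; exists id; first exact: symmetry_id.
  by move=> v; rewrite perm1.
move=> s t /vertex_symmetriesP[g Sg gs] /vertex_symmetriesP[h Sh ht].
apply/vertex_symmetriesP; exists (h \o g); first exact: symmetry_comp.
by move=> v; rewrite permM ht gs.
Qed.
Canonical vertex_symmetry_group : {group {perm V}} := Group vertex_symmetries_group_set.

Definition vertex_stab v := [set s in vertex_symmetries | s v == v]%SET.

(** At least half of the stabilizer of [v] consists of symmetries: multiplication by the inverse of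
    one non-symmetry in it maps all its non-symmetries injectively to symmetries that fix [v]. *)
Lemma vertex_stab_card v : regular_index2 X ->
  #|[set e | ve v e]%SET| <= #|vertex_stab v|.
Proof.
move=> [reg i2]; rewrite -(leq_pmul2l (m := 2)) //; apply: leq_trans (stab_card v reg) _.
have sGA : (symmetries X \subset automorphisms X)%SET.
  by apply/fintype.subsetP => s /symmetriesP[].
pose Gv := (stab v :&: symmetries X)%SET.
have hG : #|Gv| <= #|vertex_stab v|.
  rewrite -(card_in_imset (f := @vperm X) (D := Gv)); last first.
    by move=> s t /setIP[/setIdP[sA _] _] /setIP[/setIdP[tA _] _]; apply: vperm_inj.
  apply/subset_leq_card/fintype.subsetP => _ /imsetP[s + ->].
  move=> /setIP[/setIdP[_ sv] /symmetriesP[_ sg]].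
  by apply/setIdP; split=> //; apply/vertex_symmetriesP.
apply: leq_trans (_ : 2 * #|Gv| <= _); last by rewrite leq_mul2l.
rewrite -(cardsID (symmetries X) (stab v)) mul2n -addnn leq_add2l.
have [->|[t]] := finset.set_0Vmem (stab v :\: symmetries X)%SET; first by rewrite cards0.
rewrite inE => /andP[tG /setIdP[tA tv]].
rewrite -(card_imset _ (mulIg t^-1%g)); apply/subset_leq_card/fintype.subsetP.
move=> _ /imsetP[s /setDP[/setIdP[sA sv] sG] ->].
apply/setIP; split; last first.
  exact: (index2_div (A := automorphism_group X) (B := symmetry_group X) sGA i2 sA tA sG tG).
apply/setIdP; split; first by rewrite -[_ \in _]/(_ \in automorphism_group X) groupM ?groupV.
have -> : vperm (s * t^-1)%g = (vperm s * (vperm t)^-1)%g by [].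
by rewrite permM (eqP sv) -{1}(eqP tv) permK.
Qed.

Lemma symmetry_perm g : symmetry X g ->
  exists2 s : {perm V}, s \in vertex_symmetries & forall v : V, pos (s v) = g (pos v).
Proof.
move=> Sg; have [ig [gv _ _]] := Sg.
have h (v : V) : exists w : V, pos w = g (pos v).
  have : vertex_set X (g (pos v)) by rewrite -gv; exists (pos v) => //; exists v.
  by case=> w _ e; exists w.
pose f (v : V) : V := projT1 (cid (h v)); have fE v : pos (f v) = g (pos v) by rewrite /f; case: cid.
have fi : injective f.
  move=> u v e; apply: (@pos_inj _ X); apply: (isometry_inj (isometry_similarity ig)).
  by rewrite -!fE e.
exists (perm fi); last by move=> v; rewrite permE.
by apply/vertex_symmetriesP; exists g => // v; rewrite permE.
Qed.

Lemma vertex_symmetries_transitive u v : vertex_transitive X ->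
  exists2 s, s \in vertex_symmetries & s u = v.
Proof.
move=> /(_ u v)[g Sg guv]; have [s sS sE] := symmetry_perm Sg.
by exists s => //; apply: (@pos_inj _ X); rewrite sE.
Qed.

Lemma joined_segment (u v : V) : joined u v <-> u <> v /\ segments X [set pos u; pos v].
Proof.
split=> [/joinedP[uv [e ue ve_]]|[uv [e _ se]]].
  split=> //; exists e => //; rewrite /segment; apply/seteqP; split=> x.
    move=> [w] /= we <-.
    have [->|wu] := eqVneq w u; [by left|right; congr pos].
    by apply: edge_end_eq ue we ve_ wu _; apply/eqP => /esym.
  by case=> ->; [exists u | exists v].
apply/joinedP; split=> //; exists e.
  have [w /= we /(@pos_inj _ X) <-] : segment e (pos u) by rewrite se; left.
  exact: we.
have [w /= we /(@pos_inj _ X) <-] : segment e (pos v) by rewrite se; right.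
exact: we.
Qed.

Lemma symmetry_segments (s : {perm V}) u v : s \in vertex_symmetries ->
  joined u v -> joined (s u) (s v).
Proof.
move=> /vertex_symmetriesP[g [_ [_ gs _]] sE] /joined_segment[uv suv].
apply/joined_segment; split; first by move/perm_inj.
rewrite -gs; exists [set pos u; pos v] => //.
by rewrite image_setU !image_set1 !sE.
Qed.

Lemma vertex_symmetries_joined (s : {perm V}) u v : s \in vertex_symmetries ->
  joined (s u) (s v) = joined u v.
Proof.
move=> sS; apply/idP/idP; last exact: symmetry_segments.
move/(symmetry_segments (groupVr (G := vertex_symmetry_group) sS)).
by rewrite !permK.
Qed.

Lemma neighbours_card v : #|[set w : V | joined v w]%SET| <= #|[set e | ve v e]%SET|.
Proof.
pose other (e : edge X) := odflt v [pick w | (w != v) && ve w e].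
apply: leq_trans (leq_imset_card other _); apply/subset_leq_card/fintype.subsetP => w.
rewrite inE => /joinedP[vw [e vE we]]; apply/imsetP; exists e; first by rewrite inE.
rewrite /other; case: pickP => [x /andP[xv xe]|/(_ w)] /=.
  by apply: edge_end_eq vE we xe _ xv; apply/eqP => /esym.
by rewrite we andbT => /negbFE/eqP wv; case: vw.
Qed.
End Index2.

(** * A directed polyhedron on a coded vertex set: its symmetries and the class of its edges *)

Section Coded.
Variables (R : realType) (X : polyhedron R) (n : nat) (T : seq (seq nat)).
Notation V := (vertex X).
Variable c : V -> nat.
Hypothesis c_lt : forall v, c v < n.
Hypothesis c_inj : injective c.
Hypothesis c_surj : forall k, k < n -> exists v, c v = k.
Notation cl u v := (entry T (c u) (c v)).
Hypothesis dist_cl : forall u v u' v' : V,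
  dist (pos u) (pos v) = dist (pos u') (pos v') <-> cl u v = cl u' v'.

Let I := iota 0 n.

Lemma c_I v : c v \in I. Proof. by rewrite mem_iota c_lt. Qed.

Lemma all_c (P : pred nat) v : all P I -> P (c v).
Proof. by move=> /allP; apply; apply: c_I. Qed.

Lemma perm_codes : perm_eq [seq c v | v <- enum V] I.
Proof.
apply: uniq_perm; [by rewrite map_inj_uniq ?enum_uniq | exact: iota_uniq |].
move=> k; apply/mapP/idP => [[v _ ->]|]; first exact: c_I.
by rewrite mem_iota => /andP[_ /c_surj[v <-]]; exists v; rewrite ?mem_enum.
Qed.

Lemma sum_codes (P : pred nat) (F : nat -> nat) :
  \sum_(v : V | P (c v)) F (c v) = sumn [seq F i | i <- I & P i].
Proof.
rewrite sumnE big_map big_filter -(perm_big _ perm_codes) big_map.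
by rewrite big_enum_cond.
Qed.

Lemma card_codes (P : pred nat) : #|[set v : V | P (c v)]%SET| = count P I.
Proof.
rewrite -sum1_card (eq_bigl (fun v => P (c v))); last by move=> v; rewrite inE.
by rewrite (sum_codes P (fun=> 1)) sumnE big_map big_filter sum1_count.
Qed.

Definition class_perms : {set {perm V}} :=
  [set s : {perm V} | [forall u, [forall v, cl (s u) (s v) == cl u v]]]%SET.

Lemma class_permsP (s : {perm V}) :
  reflect (forall u v, cl (s u) (s v) = cl u v) (s \in class_perms).
Proof.
rewrite inE; apply: (iffP idP) => [h u v|h].
  by move: h => /forallP/(_ u)/forallP/(_ v)/eqP.
by apply/forallP => u; apply/forallP => v; rewrite h.
Qed.

Lemma class_perms_group_set : group_set class_perms.
Proof.
apply/group_setP; split; first by apply/class_permsP => u v; rewrite !perm1.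
move=> s t /class_permsP hs /class_permsP ht; apply/class_permsP => u v.
by rewrite !permM ht hs.
Qed.
Canonical class_perm_group : {group {perm V}} := Group class_perms_group_set.

Lemma vertex_symmetries_class : vertex_symmetries X \subset class_perms.
Proof.
apply/fintype.subsetP => s /vertex_symmetriesP[g [ig _] sE]; apply/class_permsP => u v.
by apply/dist_cl; rewrite !sE ig.
Qed.

Lemma coded_perm g : symmetry_ok n T g ->
  (forall i, (i < n) -> entry T i i = 0) ->
  (forall i j, i < n -> j < n -> entry T i j = 0 -> i = j) ->
  exists2 s : {perm V}, s \in class_perms & forall v, c (s v) = nth 0 g (c v).
Proof.
move=> ok diag diag0.
have glt v : nth 0 g (c v) < n by case/andP: (all_c v ok).
have gcl u v : entry T (nth 0 g (c u)) (nth 0 g (c v)) = cl u v.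
  by case/andP: (all_c u ok) => _ /(all_c v)/eqP.
have h v : exists w, c w = nth 0 g (c v) by apply: c_surj.
pose f v := projT1 (cid (h v)); have fE v : c (f v) = nth 0 g (c v) by rewrite /f; case: cid.
have fi : injective f.
  move=> u v e; apply: c_inj; apply: diag0 => //.
  by rewrite -gcl -!fE e diag.
exists (perm fi); last by move=> v; rewrite permE.
by apply/class_permsP => u v; rewrite !permE !fE gcl.
Qed.

Variables (H : seq (seq nat)) (gens : seq (seq nat)) (D B L : seq nat) (j0 : nat).
Hypothesis diag : forall i, i < n -> entry T i i = 0.
Hypothesis diag0 : forall i j, i < n -> j < n -> entry T i j = 0 -> i = j.
Hypothesis gens_ok : all (symmetry_ok n T) gens.
Hypothesis half_ok : all (symmetry_ok n T) H.
Hypothesis half_size : size H = n.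
Hypothesis j0_lt : j0 < n.
Hypothesis j0_D : entry T 0 j0 \in D.
Hypothesis j0_rigid : rigid_ok n T j0.
Hypothesis D_trans : all (transitive_ok n T gens) D.
Hypothesis DB_ok : classes_ok n T D B.
Hypothesis L_ok : closed_ok n T L B.
Hypothesis half_real : forall k, k < n -> exists2 h, direct_isometry h &
  forall v w : V, c w = entry H k (c v) -> h (pos v) = pos w.

Variable a : R.
Hypothesis dirX : directed_type a X.

Lemma edges_at_const (u v : V) : #|[set e | ve u e]%SET| = #|[set e | ve v e]%SET|.
Proof. by have [p [q [_ _ [_ hq]]]] := pmap_type X; rewrite !hq. Qed.

Lemma edges_at_ge3 (v : V) : 3 <= #|[set e | ve v e]%SET|.
Proof. by have [p [q [_ q3 [_ hq]]]] := pmap_type X; rewrite hq. Qed.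

Lemma stab_class_card v0 : c v0 = 0 -> #|[set s in class_perms | s v0 == v0]%SET| <= 4.
Proof.
move=> c0; have [x cx] := c_surj j0_lt.
have <- : #|[set w : V | entry T 0 (c w) == entry T 0 j0]%SET| = 4.
  rewrite (card_codes (fun j => entry T 0 j == entry T 0 j0)).
  move/allP: D_trans => /(_ _ j0_D)/andP[_ /(all_c v0)/eqP].
  by rewrite c0.
rewrite -(card_in_imset (f := fun s : {perm V} => s x)); last first.
  move=> s t /setIdP[/class_permsP sK /eqP s0] /setIdP[/class_permsP tK /eqP t0] st.
  apply/permP => y; have /hasP[m mI /andP[/allP mu ku]] := j0_rigid.
  have [z cz] : exists z, c z = m by apply: c_surj; rewrite mem_iota in mI.
  (* [r] fixes [v0] and [x], hence also [z], the only vertex with its classes to these two; every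
     vertex is determined by its classes to the three. *)
  pose r := (s * t^-1)%g.
  have rK u v : cl (r u) (r v) = cl u v.
    by rewrite /r !permM -[LHS]tK !permKV sK.
  have r0 : r v0 = v0 by rewrite /r permM s0; apply: (canLR (permK t)); rewrite t0.
  have rx : r x = x by rewrite /r permM st permK.
  have e0 w : entry T 0 (c (r w)) = entry T 0 (c w) by rewrite -c0 -{1}r0 rK.
  have ex w : entry T j0 (c (r w)) = entry T j0 (c w) by rewrite -cx -{1}rx rK.
  have rz : r z = z.
    apply: c_inj; apply/eqP; rewrite cz; apply: (implyP (mu _ (c_I (r z)))).
    by rewrite e0 ex cz !eqxx.
  have ez w : entry T m (c (r w)) = entry T m (c w) by rewrite -cz -{1}rz rK.
  have ry : r y = y.
    apply: c_inj; apply/eqP; apply: (implyP (all_c y (all_c (r y) ku))).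
    by rewrite e0 ex ez !eqxx.
  by rewrite -[in RHS]ry /r permM permKV.
apply/subset_leq_card/fintype.subsetP => _ /imsetP[s /setIdP[/class_permsP sK /eqP s0] ->].
by rewrite inE -cx -c0 -{1}s0 sK.
Qed.

Lemma exists_v0 : exists v0, c v0 = 0.
Proof. by apply: c_surj; apply: leq_ltn_trans j0_lt. Qed.

Lemma stab_subgroup (G : {group {perm V}}) v : group_set [set s in G | s v == v]%SET.
Proof.
apply/group_setP; split; first by rewrite inE group1 perm1 eqxx.
move=> s t /setIdP[sG /eqP sv] /setIdP[tG /eqP tv].
by rewrite inE groupM // permM sv tv eqxx.
Qed.

Lemma class_perms_symmetries : class_perms = vertex_symmetries X.
Proof.
have [v0 c0] := exists_v0; have [r vt _ _] := dirX.
have sub : vertex_stab v0 \subset [set s in class_perms | s v0 == v0]%SET.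
  by apply/fintype.subsetP => s /setIdP[sS sv]; rewrite inE sv (fintype.subsetP vertex_symmetries_class).
have eqs : vertex_stab v0 = [set s in class_perms | s v0 == v0]%SET.
  apply/eqP; rewrite eqEcard sub /=.
  have /dvdnP[k hk] := @cardSg _ (Group (stab_subgroup class_perm_group v0))
    (Group (stab_subgroup (vertex_symmetry_group X) v0)) sub.
  have q4 := stab_class_card c0.
  have p3 := leq_trans (edges_at_ge3 v0) (vertex_stab_card v0 r).
  have pq := subset_leq_card sub.
  move: hk; rewrite /= -/(vertex_stab v0) => hk.
  move: p3 q4 pq hk; set p := #|vertex_stab v0|; set q := #|_| => p3 q4 pq hk.
  (* A divisor of a number at most 4 that is itself at least 3 equals that number. *)
  by clear -p3 q4 pq hk; case: k hk => [|[|k]] hk; lia.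
apply/eqP; rewrite finset.eqEsubset vertex_symmetries_class andbT; apply/fintype.subsetP => s sK.
have [t tS tv] := vertex_symmetries_transitive v0 (s v0) vt.
have tK : t \in class_perms by apply: (fintype.subsetP vertex_symmetries_class).
have : (s * t^-1)%g \in vertex_stab v0.
  rewrite eqs inE permM -tv permK eqxx andbT.
  by rewrite -[_ \in _]/(_ \in class_perm_group) groupM ?groupV.
case/setIdP=> + _; rewrite -[_ \in _]/(_ \in vertex_symmetry_group X).
by move=> h; rewrite -(mulgKV t s) -[_ \in _]/(_ \in vertex_symmetry_group X) groupM.
Qed.

Lemma edges_at_le4 v : #|[set e | ve (v : V) e]%SET| <= 4.
Proof.
have [v0 c0] := exists_v0; rewrite (edges_at_const _ v0); have [r _ _ _] := dirX.
apply: leq_trans (vertex_stab_card v0 r) _; apply: leq_trans (stab_class_card c0).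
by rewrite /vertex_stab class_perms_symmetries.
Qed.

(** The generators preserve classes, so they come from symmetries of [X] and respect edges; and they
    move the ordered pairs of class [d] transitively. *)
Lemma joined_class d (u v u' v' : V) : d \in D ->
  cl u v = d -> cl u' v' = d -> joined u v = joined u' v'.
Proof.
move=> dD huv huv'.
have /allP/(_ d dD)/andP[/allP tr _] := D_trans.
pose p0 := head (0, 0) (class_pairs n T d).
have key (x y x' y' : V) : (c x, c y) = p0 ->
    (c x', c y') \in reach (fun p : nat * nat => [seq (nth 0 g p.1, nth 0 g p.2) | g <- gens]) (n * n) p0 ->
    joined x' y' = joined x y.
  move=> e0 hr; pose Pr p := exists2 q : V * V, (c q.1, c q.2) = p & joined q.1 q.2 = joined x y.
  suff [[x1 y1] /= [/c_inj-> /c_inj->]] : Pr (c x', c y') by [].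
  apply: (reachP _ _ hr); first by exists (x, y).
  move=> _ r [q <- qj] /mapP[g gG ->]; have [s sK sE] := coded_perm (allP gens_ok g gG) diag diag0.
  exists (s q.1, s q.2); rewrite /= ?sE //.
  by rewrite vertex_symmetries_joined // -class_perms_symmetries.
have inp (x y : V) : cl x y = d -> (c x, c y) \in class_pairs n T d.
  move=> h; rewrite mem_filter /= h eqxx /=.
  by apply/allpairsP; exists (c x, c y); rewrite !c_I.
have hp0 : p0 \in class_pairs n T d.
  have := inp _ _ huv; rewrite /p0; case: (class_pairs n T d) => // *; exact: mem_head.
have [x [y e0]] : exists x y, (c x, c y) = p0.
  move: hp0; rewrite mem_filter => /andP[_ /allpairsP[[i j] [/= iI jI ->]]].
  rewrite !mem_iota in iI jI; have [x <-] := c_surj iI; have [y <-] := c_surj jI.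
  by exists x, y.
by rewrite (key x y u v) ?(key x y u' v') //; apply: tr; apply: inp.
Qed.

(** If some edge has a class in [D], all pairs of this class are edges, four at each vertex, which
    exhausts the edges there. Otherwise all edges have classes in [B], and a path of edges from
    vertex 0 never leaves [L], against connectedness. *)
Lemma edge_class : exists2 d, d \in D & forall u v : V, joined u v = (cl u v == d).
Proof.
have [/existsP[x /existsP[y /andP[xy dD]]]|no] := boolP [exists x : V, [exists y, joined x y && (cl x y \in D)]].
  exists (cl x y) => // u v; apply/idP/idP => [uv|/eqP e]; last first.
    by rewrite (joined_class (d := cl x y) dD e erefl).
  suff : v \in [set w : V | cl u w == cl x y]%SET by rewrite inE.
  suff /eqP-> : [set w : V | cl u w == cl x y]%SET == [set w | joined u w]%SET by rewrite inE.
  rewrite eqEcard; apply/andP; split.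
    apply/fintype.subsetP => w; rewrite !inE => /eqP e.
    by rewrite (joined_class (d := cl x y) dD e erefl).
  apply: leq_trans (neighbours_card u) _; apply: leq_trans (edges_at_le4 u) _.
  rewrite (card_codes (fun j => entry T (c u) j == cl x y)).
  by have /allP/(_ _ dD)/andP[_ /(all_c u)/eqP->] := D_trans.
have [v0 c0] := exists_v0.
have /and3P[L0 Lcl /hasP[k]] := L_ok; rewrite mem_iota => kn.
have [w <-] := c_surj kn; suff -> : c w \in L by [].
have /connectP[p pp ->] := map_connected v0 w.
rewrite -c0 in L0; elim: p v0 {c0} L0 pp => //= x p IH v0 L0 /andP[/existsP[e /andP[ve0 vex]] pp].
apply: IH pp; have [->//|nx] := eqVneq x v0.
have jx : joined v0 x by apply/joinedP; split; [move/esym/eqP; rewrite (negbTE nx) | exists e].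
apply: (implyP (all_c x (all_c v0 Lcl))); rewrite L0 /=.
case/or3P: (all_c x (all_c v0 DB_ok)) => // h.
  by case/existsP: no; exists v0; apply/existsP; exists x; rewrite jx h.
by move: nx; rewrite (c_inj (eqP h)) eqxx.
Qed.

(** The half-turn [h] that exchanges two joined vertices preserves classes, so on the vertices it
    agrees with some symmetry [g]. Segments and polygons only involve vertices, hence [h] itself is
    a symmetry, and it is direct whether or not [g] is. *)
Lemma swap_not_directed d : (forall u v : V, joined u v = (cl u v == d)) -> ~~ swap_ok n T H d.
Proof.
move=> jE; apply/negP => sw; have [_ _ _ [u [v [uv]]]] := dirX; case.
have := all_c v (all_c u sw); rewrite -jE uv => /hasP[k]; rewrite mem_iota => kn.
case/andP=> /eqP huv /eqP hvu.
have [h dh hE] := half_real kn.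
have kH : nth [::] H k \in H by rewrite mem_nth ?half_size.
have [s sK sE] := coded_perm (allP half_ok _ kH) diag diag0.
have hs (w : V) : h (pos w) = pos (s w) by apply: hE; rewrite sE.
move: sK; rewrite class_perms_symmetries => /vertex_symmetriesP[g [ig [g1 g2 g3]] gE].
have hg (w : V) : h (pos w) = g (pos w) by rewrite hs gE.
suff Sh : symmetry X h.
  by exists h; split=> //; rewrite hs; congr pos; apply: c_inj; rewrite sE.
have im (A : set ('rV[R]_3)) : (A `<=` vertex_set X -> h @` A = g @` A)%classic.
  by move=> sA; apply: eq_imagel => x /sA[w _ <-].
have seg (e : edge X) : (segment e `<=` vertex_set X)%classic by move=> _ [w _ <-]; exists w.
split; first exact: direct_isometry_isometry.
split.
- by rewrite im.
- rewrite -[RHS]g2; apply: eq_imagel => _ [e _ <-]; exact: im.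
- rewrite -[RHS]g3; apply: eq_imagel => _ [f _ <-]; apply: eq_imagel => _ [e _ <-]; exact: im.
Qed.
End Coded.

(** * Corners of faces and walks in the edge graph *)

Section Corners.
Variables (R : realType) (X : polyhedron R).
Notation V := (vertex X).
Implicit Types (x v y z u w : V) (f g h : face X) (e d : edge X).

Lemma edge_uniq x v e d : x != v -> ve x e -> ve v e -> ve x d -> ve v d -> e = d.
Proof.
move=> xv xe ve_ xd vd; apply: (@edge_inj _ X); apply/setP => w; rewrite !inE.
have hE b : ve x b -> ve v b -> ve w b = (w == x) || (w == v).
  move=> xb vb; apply/idP/orP => [wb|[/eqP->//|/eqP->//]].
  have [|wx] := eqVneq w x; [by left|right; apply/eqP].
  by apply: edge_end_eq xb wb vb wx _; rewrite eq_sym.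
by rewrite !hE.
Qed.

Definition onF f x v : Prop := exists e, [/\ x != v, ve x e, ve v e & ef e f].
Definition cornerF f x v y : Prop := [/\ onF f x v, onF f v y & x != y].

Lemma onF_sym f x v : onF f x v -> onF f v x.
Proof. by move=> [e [xv xe ve_ ef_]]; exists e; rewrite eq_sym. Qed.

Lemma onF_joined f x v : onF f x v -> joined x v.
Proof. by move=> [e [/eqP xv xe ve_ _]]; apply/joinedP; split=> //; exists e. Qed.

Lemma corner_next f x v : onF f x v -> exists y, cornerF f x v y.
Proof.
move=> oF; have [e [xv xe ve_ ef_]] := oF.
have [d de /andP[vd df]] := face_other_edge (f := f) (v := v) (e := e) (introT andP (conj ve_ ef_)).
have [y yv yd] := edge_other_end vd.
exists y; split=> //; first by exists d; rewrite eq_sym.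
apply: contraNneq de => xy; apply/eqP; apply: (@edge_uniq x v) => //.
by rewrite xy.
Qed.

Lemma onF_third f v x y z : onF f v x -> onF f v y -> onF f v z -> x != y -> x != z -> y = z.
Proof.
move=> [a [vx va xa af]] [b [vy vb yb bf]] [d [vz vd zd df]] xy xz.
have ab : b != a.
  apply: contraNneq xy => ba; rewrite ba in yb.
  by apply/eqP; apply: (edge_end_eq va xa yb); rewrite eq_sym.
have ad : d != a.
  apply: contraNneq xz => ba; rewrite ba in zd.
  by apply/eqP; apply: (edge_end_eq va xa zd); rewrite eq_sym.
have bd : b = d by apply: (face_edge_eq (f := f) (v := v) (e := a)) => //; apply/andP.
rewrite -bd in zd; by apply: (edge_end_eq vb yb zd); rewrite eq_sym.
Qed.

Lemma corner_uniq f x v y z : cornerF f x v y -> cornerF f x v z -> y = z.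
Proof. by move=> [/onF_sym h1 h2 xy] [_ h3 xz]; apply: onF_third h1 h2 h3 xy xz. Qed.

Lemma corner_sym f x v y : cornerF f x v y -> cornerF f y v x.
Proof. by move=> [h1 h2 h3]; split; rewrite 1?eq_sym //; apply: onF_sym. Qed.

Lemma aut_onF s f x v : s \in automorphisms X -> onF f x v ->
  onF (fperm s f) (vperm s x) (vperm s v).
Proof.
move=> /automorphismP[sv sf] [e [xv xe ve_ ef_]]; exists (eperm s e).
by rewrite !sv sf (inj_eq perm_inj).
Qed.

Lemma aut_corner s f x v y : s \in automorphisms X -> cornerF f x v y ->
  cornerF (fperm s f) (vperm s x) (vperm s v) (vperm s y).
Proof.
by move=> sA [h1 h2 h3]; split; rewrite ?(inj_eq perm_inj) //; apply: aut_onF.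
Qed.

Lemma regular_onF f g x v x' v' : regular_map X -> onF f x v -> onF g x' v' ->
  exists s, [/\ s \in automorphisms X, vperm s x = x', vperm s v = v' & fperm s f = g].
Proof.
move=> reg [e [xv xe ve_ ef_]] [d [xv' xd vd df]].
have [||s sA [sv se sf]] := reg v e f v' d g; try exact/andP.
exists s; split=> //; have /automorphismP[av _] := sA.
have sxd : ve (vperm s x) d by rewrite -se av.
by apply: (edge_end_eq vd sxd xd) => //; rewrite -sv (inj_eq perm_inj).
Qed.

Lemma onF_two x v : joined x v -> exists f g,
  [/\ f != g, onF f x v, onF g x v & forall h, onF h x v -> h = f \/ h = g].
Proof.
move=> /joinedP[/eqP xv [e xe ve_]].
have /eqP/cards2P[f [g [fg ee]]] := edge_sides e.
have hE h : ef e h = (h == f) || (h == g) by move/setP/(_ h): ee; rewrite !inE.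
exists f, g; split=> //.
- by exists e; rewrite hE eqxx.
- by exists e; rewrite hE eqxx orbT.
move=> h [d [_ xd vd dh]]; have ed : e = d by apply: (@edge_uniq x v).
by move: dh; rewrite -ed hE => /orP[]/eqP->; [left|right].
Qed.

(* If the two faces at an edge xv continued to the same neighbour of v, the
   edges around v would close up after two of them. *)
Lemma corner_pair x v : regular_map X -> joined x v -> 3 <= #|[set e | ve v e]%SET| ->
  exists y y' s, [/\ y != y', x != y /\ x != y', joined v y /\ joined v y',
     [/\ s \in automorphisms X, vperm s x = x & vperm s y = y']
   & forall z, (exists h, cornerF h x v z) <-> z = y \/ z = y'].
Proof.
move=> reg xv q3; have [f [g [fg fx gx fgE]]] := onF_two xv.
(* Regularity gives an automorphism that keeps the directed edge and takes one of its sides to the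
   other, hence the continuation along [f] to the one along [g]. *)
have [s [sA sx sv sf]] := regular_onF reg fx gx.
have [y cy] := corner_next fx; exists y, (vperm s y), s.
have := aut_corner sA cy; rewrite sx sv sf => cy'; move: (vperm s y) cy' => y' cy'.
have [_ vy xy] := cy; have [_ vy' xy'] := cy'.
split=> //; last 1 first.
- move=> z; split=> [[h ch]|[->|->]]; [|by exists f|by exists g].
  have [hx _ _] := ch; case: (fgE h hx) => hE; [left|right]; rewrite hE in ch.
    exact: corner_uniq ch cy.
  exact: corner_uniq ch cy'.
- apply/negP => /eqP yy; rewrite -yy in vy' xy' cy' => {y' yy}.
  have [e [_ xe vE _]] := fx; have [d [_ vd yd _]] := vy.
  have xv' : x != v by have [? []] := fx.
  have yv' : v != y by have [? []] := vy.
  suff sub : [set e | ve v e]%SET \subset [set e; d]%SET.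
    by have := leq_trans q3 (subset_leq_card sub); rewrite cards2; case: eqP.
  have two h b : (h = f \/ h = g) -> flag v b h -> b = e \/ b = d.
    move=> hh /andP[vb bh]; have [|nbe] := eqVneq b e; [by left|right].
    have ed : d != e.
      apply: contraNneq xy => de; rewrite de in yd.
      by apply/eqP; apply: (edge_end_eq vE xe yd) => //; rewrite eq_sym.
    have onf h' : h' = f \/ h' = g -> flag v e h' /\ flag v d h'.
      by case=> ->; split; apply/andP; split=> //;
        [have [e1 [_ ? ? ?]] := fx; rewrite (edge_uniq (e := e) (d := e1) xv')
        |have [e1 [_ ? ? ?]] := vy; rewrite (edge_uniq (e := d) (d := e1) yv')
        |have [e1 [_ ? ? ?]] := gx; rewrite (edge_uniq (e := e) (d := e1) xv')
        |have [e1 [_ ? ? ?]] := vy'; rewrite (edge_uniq (e := d) (d := e1) yv')].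
    have [fe fd] := onf h hh.
    by apply: (face_edge_eq (f := h) (v := v) (e := e)) => //; apply/andP.
  have side h b : b = e \/ b = d -> ef b h -> h = f \/ h = g.
    case=> -> bh; first by apply: fgE; exists e.
    have [e1 [_ ? ? ?]] := vy; have [e2 [_ ? ? ?]] := vy'.
    have e1d : e1 = d by apply: (edge_uniq yv').
    have e2d : e2 = d by apply: (edge_uniq yv').
    have [|hf] := eqVneq h f; [by left|right].
    have df : ef d f by rewrite -e1d.
    have dg : ef d g by rewrite -e2d.
    by apply: (card2_other (edge_sides d) (x := f)); rewrite ?inE // eq_sym.
  apply/fintype.subsetP => b; rewrite !inE => vb.
  suff [->|->] : b = e \/ b = d by rewrite eqxx ?orbT.
  have /connectP[p pp ->] := vertex_cycle vE vb.
  move: pp (or_introl (erefl e) : e = e \/ e = d).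
  move: {1 2 4 5 7}e => b0; elim: p b0 {vb} => //= b1 p IH b0.
  move=> /andP[/and3P[_ vb1 /existsP[h /andP[h0 h1]]] pp] hb0.
  apply: IH pp _; apply: (two h); last exact/andP.
  exact: side hb0 h0.
- by split; [apply: onF_joined vy | apply: onF_joined vy'].
Qed.

Fixpoint walks k u v : nat :=
  if k is k'.+1 then \sum_(t : V | joined u t) walks k' t v else (u == v : bool).

Lemma aut_walks s k u v : s \in automorphisms X ->
  walks k (vperm s u) (vperm s v) = walks k u v.
Proof.
move=> sA; elim: k u => [|k IH] u /=; first by rewrite (inj_eq perm_inj).
rewrite (reindex_inj (@perm_inj _ (vperm s))) /=.
by apply: eq_big => t; rewrite ?aut_joined // => _; apply: IH.
Qed.
End Corners.

Section CodedWalks.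
Variables (R : realType) (X : polyhedron R) (n : nat) (T : seq (seq nat)).
Notation V := (vertex X).
Variable c : V -> nat.
Hypothesis c_lt : forall v, c v < n.
Hypothesis c_inj : injective c.
Hypothesis c_surj : forall k, k < n -> exists v, c v = k.
Notation cl u v := (entry T (c u) (c v)).
Variable d : nat.
Hypothesis jE : forall u v : V, joined u v = (cl u v == d).

Lemma walks_table k (u v : V) : walks k u v = table_walks n T d k (c u) (c v).
Proof.
elim: k u => [|k IH] u /=; first by rewrite (inj_eq c_inj).
rewrite -(sum_codes c_lt c_inj c_surj (fun l => entry T (c u) l == d)
  (fun l => table_walks n T d k l (c v))).
by apply: eq_big => t; [exact: jE | move=> _; exact: IH].
Qed.

Lemma aut_walk_sum s (x y : V) : s \in automorphisms X ->
  walk_sum n T d (c (vperm s x)) (c (vperm s y)) = walk_sum n T d (c x) (c y).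
Proof. by move=> sA; rewrite /walk_sum -!walks_table !aut_walks. Qed.

(** By [corner_pair] some automorphism fixes [x] and takes a further neighbour of [v0] to a
    different one, which the walk counts from [x] forbid. *)
Lemma asymmetric_not_regular (v0 : V) : c v0 = 0 -> regular_map X -> ~~ asymmetric_ok n T d.
Proof.
move=> c0 reg; apply/negP => as_.
have q3 : 3 <= #|[set e | ve v0 e]%SET|.
  by have [p [q [_ ? [_ hq]]]] := pmap_type X; rewrite hq.
have [x xv] : exists x : V, joined x v0.
  have [e v0e] := vertex_nonisolated v0; have [x xv xe] := edge_other_end v0e.
  by exists x; apply/joinedP; split; [exact/eqP | exists e].
have [y [y' [s [yy [xy xy'] [vy vy'] [sA sx sy] _]]]] := corner_pair reg xv q3.
have mem (w : V) : joined v0 w -> c w \in [seq j <- iota 0 n | entry T 0 j == d].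
  by rewrite jE c0 => h; rewrite mem_filter h (c_I c_lt).
move: as_; rewrite /asymmetric_ok => /allP/(_ (c x))/=.
rewrite joined_sym in xv => /(_ (mem _ xv))/allP/(_ _ (mem _ vy))/allP/(_ _ (mem _ vy')).
rewrite /= !inE !(inj_eq c_inj) negb_or xy xy' yy /=.
by rewrite -(aut_walk_sum x y sA) sx sy eqxx.
Qed.
End CodedWalks.

(** * Edges along the diagonals of the pentagons: the corners and the faces are forced *)

Definition adjacents (v : nat) : seq nat := [seq x <- iota 0 30 | icl v x == 2].

(** The vertices joined to [v] form a rectangle. Its sides of class 1 come from two diagonals of one
    pentagon of S, those of class 5 from different pentagons; its diagonals, of class 6, belong to
    walks that go straight on and are excluded. *)
Definition corner (x v y : nat) : bool :=
  [&& icl v x == 2, icl v y == 2 & icl x y \in [:: 1; 5]].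

(* Four consecutive vertices of a face boundary of the pentagonal (b = false)
   or of the hexagonal (b = true) polyhedron. *)
Definition window (b : bool) (x v y z : nat) : bool :=
  [&& corner x v y, corner v y z & icl x z \in (if b then [:: 4] else [:: 1; 5])].

Definition faces (b : bool) : seq (seq nat) := if b then hex_faces else pent_faces.
Definition directed_faces b := faces b ++ [seq rev s | s <- faces b].
Definition cyc (s : seq nat) (i : nat) : nat := nth 0 s (i %% size s).

Lemma icl_sym_ok : all (fun i => all (fun j => icl i j == icl j i) (iota 0 30)) (iota 0 30).
Proof. vm_cast_no_check (erefl true). Qed.

(** Counts of walks cannot distinguish the classes 1 and 5, which Galois conjugation exchanges, but
    they separate both from class 6. *)
Lemma corner_walks_ok : all (fun v => all (fun x => all (fun y => all (fun y' =>
  uniq [:: x; y; y'] && (walk_sum 30 ico_table 2 x y == walk_sum 30 ico_table 2 x y')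
  ==> (icl x y \in [:: 1; 5]) && (icl x y' \in [:: 1; 5]))
  (adjacents v)) (adjacents v)) (adjacents v)) (iota 0 30).
Proof. vm_cast_no_check (erefl true). Qed.

Lemma corner_two_ok : all (fun v => all (fun x => all (fun y => all (fun y' => all (fun z =>
  [&& corner x v y, corner x v y', y != y' & corner x v z] ==> (z == y) || (z == y'))
  (adjacents v)) (adjacents v)) (adjacents v)) (adjacents v)) (iota 0 30).
Proof. vm_cast_no_check (erefl true). Qed.

(** Three steps along a pentagon leave two for the way back, so its [x] and [z] have a common
    neighbour; in a hexagonal window they have none. Thus the kind of a window can be read off the
    edge graph and is invariant under automorphisms. *)
Lemma window_walks_ok : all (fun v => all (fun x => all (fun y => all (fun z =>
  corner x v y && corner v y z ==>
  window (table_walks 30 ico_table 2 2 x z == 0) x v y z)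
  (adjacents y)) (adjacents v)) (adjacents v)) (iota 0 30).
Proof. vm_cast_no_check (erefl true). Qed.

Lemma corner_face_ok : all (fun b => all (fun v => all (fun x => all (fun y => corner x v y ==>
  has (fun s => has (fun i => [&& cyc s i == x, cyc s i.+1 == v & cyc s i.+2 == y])
                    (iota 0 (size s))) (directed_faces b))
  (adjacents v)) (adjacents v)) (iota 0 30)) bools.
Proof. vm_cast_no_check (erefl true). Qed.

(** Along a listed face three consecutive vertices leave only one fourth vertex for a window of kind
    [b], so a walk made of such windows can never leave the face. *)
Lemma directed_faces_ok : all (fun b => all (fun s => all (fun x => x < 30) s && (0 < size s) &&
    all (fun i => corner (cyc s i) (cyc s i.+1) (cyc s i.+2) &&
      all (fun z => window b (cyc s i) (cyc s i.+1) (cyc s i.+2) z ==> (z == cyc s (i + 3)))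
        (adjacents (cyc s i.+2))) (iota 0 (size s))) (directed_faces b)) bools.
Proof. vm_cast_no_check (erefl true). Qed.

Lemma icl_sym i j : i < 30 -> j < 30 -> icl i j = icl j i.
Proof. by move=> hi hj; apply/eqP; move: icl_sym_ok => /all_iota/(_ _ hi)/all_iota/(_ _ hj). Qed.

Lemma mem_bools b : b \in bools. Proof. by case: b. Qed.

Lemma cyc_mod s i : cyc s (i %% size s) = cyc s i.
Proof. by rewrite /cyc modn_mod. Qed.

Lemma cyc_add s i j : cyc s (i %% size s + j) = cyc s (i + j).
Proof. by rewrite /cyc modnDml. Qed.

Lemma directed_faceP b s : s \in directed_faces b ->
  [/\ 0 < size s, forall i, cyc s i < 30,
      forall i, corner (cyc s i) (cyc s i.+1) (cyc s i.+2)
    & forall i z, z < 30 -> window b (cyc s i) (cyc s i.+1) (cyc s i.+2) z -> z = cyc s i.+3].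
Proof.
move=> hs; have /allP/(_ b (mem_bools b))/allP/(_ s hs)/andP[/andP[/allP hlt s0] /all_iota h] := directed_faces_ok.
have lt i : cyc s i < 30 by apply: hlt; rewrite /cyc mem_nth // ltn_mod.
have hh i : corner (cyc s i) (cyc s i.+1) (cyc s i.+2) &&
    all (fun z => window b (cyc s i) (cyc s i.+1) (cyc s i.+2) z ==> (z == cyc s i.+3))
        (adjacents (cyc s i.+2)).
  have := h _ (ltn_pmod i s0); rewrite cyc_mod -[(i %% _).+2]addn2 -[(i %% _).+1]addn1.
  by rewrite !cyc_add addn1 addn2 addn3.
split=> // [i|i z zlt hz]; first by case/andP: (hh i).
have /andP[_ /allP/(_ z)] := hh i; rewrite hz => h'; apply/eqP/h'.
by move: hz => /and3P[_ /and3P[_ h2 _] _]; rewrite mem_filter h2 mem_iota.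
Qed.

Lemma corner_faceP b x v y : x < 30 -> v < 30 -> y < 30 -> corner x v y ->
  exists2 s, s \in directed_faces b & exists i, [/\ cyc s i = x, cyc s i.+1 = v & cyc s i.+2 = y].
Proof.
move=> hx hv hy hc; have /allP/(_ b (mem_bools b))/all_iota/(_ v hv)/allP h := corner_face_ok.
have [h1 h2 _] := and3P hc.
have adj w : w < 30 -> icl v w == 2 -> w \in adjacents v by move=> ? ?; rewrite mem_filter mem_iota; apply/andP.
have := h x (adj _ hx h1) => /allP/(_ y (adj _ hy h2)); rewrite hc.
by case/hasP=> s ss /hasP[i _ /and3P[/eqP e1 /eqP e2 /eqP e3]]; exists s => //; exists i.
Qed.

Section IcoFaces.
Variables (R : realType) (X : polyhedron R).
Notation V := (vertex X).
Variable c : V -> nat.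
Hypothesis c_lt : forall v, c v < 30.
Hypothesis c_inj : injective c.
Hypothesis c_surj : forall k, k < 30 -> exists v, c v = k.
Hypothesis jE : forall u v : V, joined u v = (icl (c u) (c v) == 2).
Hypothesis reg : regular_map X.
Implicit Types (x v y z u w : V) (f g h : face X).

Lemma mem_adjacents v w : joined v w -> c w \in adjacents (c v).
Proof. by rewrite jE => h; rewrite mem_filter h mem_iota c_lt. Qed.

(** The two continuations found by [corner_pair] are exchanged with [x] fixed, so they have equal
    walk counts from [x] and must be the two neighbours of [x] in the rectangle around [v]. There
    are only two such vertices, hence every [corner] occurs in a face. *)
Lemma corner_iff x v y : (exists h, cornerF h x v y) <-> corner (c x) (c v) (c y).
Proof.
have q3 : 3 <= #|[set e | ve v e]%SET|.
  by have [p [q [_ ? [_ hq]]]] := pmap_type X; rewrite hq.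
have key : joined x v -> exists y1 y2, [/\ y1 != y2, corner (c x) (c v) (c y1), corner (c x) (c v) (c y2)
    & forall z, (exists h, cornerF h x v z) <-> z = y1 \/ z = y2].
  move=> xv; have [y1 [y2 [s [yy [xy1 xy2] [vy1 vy2] [sA sx sy] zE]]]] := corner_pair reg xv q3.
  exists y1, y2; rewrite joined_sym in xv.
  have /all_iota/(_ _ (c_lt v))/allP/(_ _ (mem_adjacents xv))/allP := corner_walks_ok.
  move=> /(_ _ (mem_adjacents vy1))/allP/(_ _ (mem_adjacents vy2)).
  rewrite -(aut_walk_sum c_lt c_inj c_surj jE x y1 sA) sx sy eqxx /=.
  rewrite !inE !(inj_eq c_inj) negb_or xy1 xy2 yy /= => /andP[h1 h2].
  by rewrite !jE in xv vy1 vy2; split=> //; rewrite /corner xv ?vy1 ?vy2 !inE ?h1 ?h2.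
split=> [[h ch]|hc].
  have [/onF_joined xv _ _] := ch; have [y1 [y2 [_ h1 h2 /(_ y)[/(_ (ex_intro _ h ch)) hy _]]]] := key xv.
  by case: hy => ->.
have [h1 h2 _] := and3P hc; have [xv vy] : joined v x /\ joined v y by rewrite !jE.
have [|y1 [y2 [yy hy1 hy2 zE]]] := key; first by rewrite joined_sym.
apply/zE; have vj z : corner (c x) (c v) (c z) -> joined v z by rewrite jE => /and3P[].
have /all_iota/(_ _ (c_lt v))/allP/(_ _ (mem_adjacents xv))/allP := corner_two_ok.
move=> /(_ _ (mem_adjacents (vj _ hy1)))/allP/(_ _ (mem_adjacents (vj _ hy2)))/allP.
move=> /(_ _ (mem_adjacents vy)); rewrite hy1 hy2 hc !(inj_eq c_inj) yy /=.
by case/orP=> /eqP; [left|right].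
Qed.

Lemma window_kind : exists b, forall f x v y z, cornerF f x v y -> cornerF f v y z ->
  window b (c x) (c v) (c y) (c z).
Proof.
have win f x v y z : cornerF f x v y -> cornerF f v y z ->
    window (walks 2 x z == 0) (c x) (c v) (c y) (c z).
  move=> h1 h2; rewrite (walks_table c_lt c_inj c_surj jE).
  have [xv vy _] := h1; have [_ yz _] := h2.
  have /all_iota/(_ _ (c_lt v))/allP := window_walks_ok.
  move=> /(_ _ (mem_adjacents (onF_joined (onF_sym xv))))/allP.
  move=> /(_ _ (mem_adjacents (onF_joined vy)))/allP.
  move=> /(_ _ (mem_adjacents (onF_joined yz)))/implyP; apply.
  by apply/andP; split; apply/corner_iff; exists f.
have [[f [x [v [y [z [h1 h2]]]]]]|no] := pselect (exists f x v y z, cornerF f x v y /\ cornerF f v y z); last first.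
  by exists true => f x v y z h1 h2; case: no; exists f, x, v, y, z.
exists (walks 2 x z == 0) => f' x' v' y' z' h1' h2'.
have [_ vy _] := h1; have [_ vy' _] := h1'.
(* An automorphism that carries the face and the middle edge of one window to those of the other
   carries the outer vertices along, because corners of a face are unique. *)
have [s [sA sv sy sf]] := regular_onF reg vy vy'.
have := win _ _ _ _ _ h1' h2'; suff -> : walks 2 x' z' = walks 2 x z by [].
have := aut_corner sA h2; rewrite sv sy sf => h2s.
have := corner_sym (aut_corner sA h1); rewrite sv sy sf => h1s.
rewrite (corner_uniq h2' h2s) (corner_uniq (corner_sym h1') h1s).
exact: aut_walks.
Qed.

Definition decode_at (d0 : V) (k : nat) : V := odflt d0 [pick v | c v == k].

Lemma decode_atK d0 k : k < 30 -> c (decode_at d0 k) = k.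
Proof.
move=> /c_surj[v cv]; rewrite /decode_at; case: pickP => [w /eqP//|/(_ v)].
by rewrite cv eqxx.
Qed.

(** From one common corner on, the windows force the boundary of [f] to follow [s]. Any edge of [f]
    is linked to this walk by [face_circuit], and at each vertex of the walk the two edges of [f]
    already belong to it. *)
Lemma face_walk_of b f s i x v y : (forall f x v y z, cornerF f x v y -> cornerF f v y z ->
    window b (c x) (c v) (c y) (c z)) ->
  s \in directed_faces b -> cyc s i = c x -> cyc s i.+1 = c v -> cyc s i.+2 = c y -> cornerF f x v y ->
  forall e, ef e f <-> exists k, forall w, ve w e = ((c w == cyc s k) || (c w == cyc s k.+1)).
Proof.
move=> win hs ex ev ey hc.
have [s0 slt _ snext] := directed_faceP hs.
pose l k := decode_at x (cyc s k).
have cl k : c (l k) = cyc s k by rewrite decode_atK.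
have lE w k : c w = cyc s k -> w = l k by move=> h; apply: c_inj; rewrite cl.
have per k m : l (k + m * size s) = l k by rewrite /l /cyc addnC modnMDl.
have st k : cornerF f (l (i + k)) (l (i + k).+1) (l (i + k).+2).
  elim: k => [|k IH].
    by rewrite addn0 -(lE x i) -?(lE v i.+1) -?(lE y i.+2).
  rewrite addnS; have [_ h2 _] := IH; have [z hz] := corner_next h2.
  rewrite -(lE z (i + k).+3) //; apply: snext => //.
  by have := win _ _ _ _ _ IH hz; rewrite !cl.
have {}st k : cornerF f (l k) (l k.+1) (l k.+2).
  (* So far only the indices from [i] on are covered; adding [i] whole rounds moves every [k]
     there. *)
  have := st (k + i * size s - i).
  have -> : i + (k + i * size s - i) = k + i * size s by rewrite subnKC // (leq_trans _ (leq_addl _ _)) // leq_pmulr.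
  by rewrite -!addSn !per.
have edge k e w : ve (l k) e -> ve (l k.+1) e -> ve w e = (c w == cyc s k) || (c w == cyc s k.+1).
  move=> h1 h2; have [[_ [lne _ _ _]] _ _] := st k.
  apply/idP/orP => [hw|[/eqP/lE->|/eqP/lE->] //].
  have [->|wl] := eqVneq w (l k); first by left; rewrite cl.
  by right; rewrite -cl (inj_eq c_inj); apply/eqP; apply: (edge_end_eq h1 hw h2) => //; rewrite eq_sym.
have [e0 [e0l e0k]] : exists e, ve (l 0) e /\ ve (l 1) e /\ ef e f.
  by have [[e [_ h1 h2 h3]] _ _] := st 0; exists e.
have step e d k : ef e f -> ef d f -> ve (l k) e -> ve (l k.+1) e ->
    [exists w, ve w e && ve w d] -> exists m, ve (l m) d /\ ve (l m.+1) d.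
  move=> eF dF h1 h2 /existsP[w /andP[]]; rewrite (edge _ _ _ h1 h2) => hw wd.
  have next m : ve (l m.+1) d -> exists m, ve (l m) d /\ ve (l m.+1) d.
    move=> md; have [u um ud] := edge_other_end md.
    have [ol or lne] := st m.
    have ou : onF f (l m.+1) u by exists d; rewrite eq_sym.
    have [ul|ul] := eqVneq u (l m); first by exists m; rewrite -ul.
    exists m.+1; split=> //.
    by rewrite -(onF_third (onF_sym ol) ou or _ lne) // eq_sym.
  case/orP: hw => /eqP/lE hw; rewrite hw in wd; last exact: next wd.
  (* Periodicity gives even the vertex with index 0 a predecessor. *)
  have [m hm] : exists m, l k = l m.+1.
    exists (k + size s).-1; rewrite prednK ?addn_gt0 ?s0 ?orbT //.
    by rewrite -[size s]mul1n per.
  by apply: (next m); rewrite -hm.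
move=> e; split=> [eF|[k ek]]; last first.
  have [[d [lne h1 h2 h3]] _ _] := st k.
  rewrite (edge_uniq lne (e := e) (d := d)) // ek -!cl eqxx ?orbT //.
have [m [h1 h2]] : exists m, ve (l m) e /\ ve (l m.+1) e; last by exists m => w; apply: edge.
have [e0r e0F] := e0k; have /connectP[p pp ->] := face_circuit e0F eF.
have : exists m, ve (l m) e0 /\ ve (l m.+1) e0 by exists 0.
elim: p e0 pp {e0l e0k e0r e0F eF} => //= d p IH e0 /andP[/and3P[h0 hd hw] pp] [m [h1 h2]].
by apply: IH pp _; apply: step h0 hd h1 h2 hw.
Qed.
End IcoFaces.

Local Open Scope classical_set_scope.

(** * Polyhedra given by their points, segments and polygons *)

Section Models.
Variable R : realType.
Notation point := 'rV[R]_3.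
Implicit Types p q : nat -> point.

Definition face_cycle p (s : seq nat) : set (set point) :=
  [set A | exists2 k, k < size s & A = [set p (cyc s k); p (cyc s k.+1)]].

(* X is, up to the names of its cells, the polyhedron with vertices p 0, ..., p 29,
   all segments between points of class 2 and the faces of kind b. *)
Definition is_model (X : polyhedron R) p b : Prop :=
  [/\ vertex_set X = [set x | exists2 i, i < 30 & x = p i],
      segments X = [set A | exists i j, [/\ i < 30, j < 30, icl i j = 2 & A = [set p i; p j]]]
    & polygons X = [set A | exists2 s, s \in faces b & A = face_cycle p s]].

Lemma model_maps_onto X Y p q b (h : point -> point) : (forall i, i < 30 -> h (p i) = q i) ->
  is_model X p b -> is_model Y q b -> maps_onto h X Y.
Proof.
move=> hp [v1 s1 f1] [v2 s2 f2].
have him i j : i < 30 -> j < 30 -> h @` [set p i; p j] = [set q i; q j].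
  by move=> hi hj; rewrite image_setU !image_set1 !hp.
split.
- rewrite v1 v2; apply/seteqP; split=> x; first by move=> [_ [i hi ->] <-]; exists i; rewrite ?hp.
  by move=> [i hi ->]; exists (p i); rewrite ?hp //; exists i.
- rewrite s1 s2; apply/seteqP; split=> A.
    by move=> [_ [i [j [hi hj c ->]]] <-]; exists i, j; rewrite him.
  by move=> [i [j [hi hj c ->]]]; exists [set p i; p j]; rewrite ?him //; exists i, j.
- rewrite f1 f2.
  have hs s : s \in faces b -> polygon_image h (face_cycle p s) = face_cycle q s.
    move=> sb; have sd : s \in directed_faces b by rewrite mem_cat sb.
    have [_ slt _ _] := directed_faceP sd.
    apply/seteqP; split=> A; first by move=> [_ [k hk ->] <-]; exists k; rewrite ?him.
    by move=> [k hk ->]; exists [set p (cyc s k); p (cyc s k.+1)]; rewrite ?him //; exists k.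
  apply/seteqP; split=> A; first by move=> [_ [s sb ->] <-]; exists s; rewrite ?hs.
  by move=> [s sb ->]; exists (face_cycle p s); rewrite ?hs //; exists s.
Qed.

Definition same_poly (s t : seq nat) : bool :=
  let sub s t := all (fun k => has (fun l =>
    ((cyc s k == cyc t l) && (cyc s k.+1 == cyc t l.+1)) ||
    ((cyc s k == cyc t l.+1) && (cyc s k.+1 == cyc t l))) (iota 0 (size t))) (iota 0 (size s)) in
  sub s t && sub t s.

Lemma same_polyP p s t : same_poly s t -> face_cycle p s = face_cycle p t.
Proof.
move=> /andP[/all_iota h1 /all_iota h2]; apply/seteqP; split=> _ [k hk ->].
  have /hasP[l + /orP[/andP[/eqP-> /eqP->]|/andP[/eqP-> /eqP->]]] := h1 k hk;
    by rewrite mem_iota => hl; exists l => //; rewrite setUC.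
have /hasP[l + /orP[/andP[/eqP-> /eqP->]|/andP[/eqP-> /eqP->]]] := h2 k hk;
  by rewrite mem_iota => hl; exists l => //; rewrite setUC.
Qed.

Lemma segment_ends (X : polyhedron R) (e : edge X) (u v : vertex X) :
  u <> v -> ve u e -> ve v e -> segment e = [set pos u; pos v].
Proof.
move=> uv ue ve_; apply/seteqP; split=> x.
  move=> [w] /= we <-; have [->|wu] := eqVneq w u; [by left|right; congr pos].
  by apply: edge_end_eq ue we ve_ wu _; apply/eqP => /esym.
by case=> ->; [exists u | exists v].
Qed.
End Models.

Lemma same_poly_ok : all (fun b => all (fun s => has (same_poly s) (faces b)) (directed_faces b)) bools.
Proof. vm_cast_no_check (erefl true). Qed.

(** * Classification: coding the vertices and excluding classes *)

Section Coding.
Variables (R : realType) (X : polyhedron R) (pts : seq vt) (vals : seq zt).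
Variables (T H : seq (seq nat)) (anti : seq nat) (s a : R) (g : 'rV[R]_3 -> 'rV[R]_3).
Variable U : set ('rV[R]_3).
Hypothesis ok : points_ok pts vals T H anti.
Hypothesis s_gt0 : (0 < s)%R.
Hypothesis sim : similarity a g.
Hypothesis UE : forall x, U x <-> exists2 i, i < size pts & x = pt pts s i.
Hypothesis XE : vertex_set X = g @` U.

Lemma coding : exists c : vertex X -> nat,
  [/\ forall v, c v < size pts, injective c, forall k, k < size pts -> exists v, c v = k
    & forall v, pos v = g (pt pts s (c v))].
Proof.
have h (v : vertex X) : exists i, i < size pts /\ pos v = g (pt pts s i).
  have : vertex_set X (pos v) by exists v.
  by rewrite XE => -[_ /UE[i hi ->] <-]; exists i.
pose c v := projT1 (cid (h v)).
have cP v : c v < size pts /\ pos v = g (pt pts s (c v)) by rewrite /c; case: cid.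
exists c; split=> [v|u v e|k hk|v]; first by case: (cP v).
- by apply: (@pos_inj _ X); case: (cP u) (cP v) => _ -> [_ ->]; rewrite e.
- have : vertex_set X (g (pt pts s k)) by rewrite XE; exists (pt pts s k) => //; apply/UE; exists k.
  case=> v _ /esym; have [hv ->] := cP v => /(isometry_inj sim) /(pt_inj ok s_gt0 hk hv) ->.
  by exists v.
- by case: (cP v).
Qed.

Variable c : vertex X -> nat.
Hypothesis c_lt : forall v, c v < size pts.
Hypothesis posE : forall v, pos v = g (pt pts s (c v)).

Lemma coded_dist (u v u' v' : vertex X) :
  dist (pos u) (pos v) = dist (pos u') (pos v') <-> entry T (c u) (c v) = entry T (c u') (c v').
Proof.
have [a0 gd] := sim; rewrite !posE !gd -(pt_dist_eq ok s_gt0) //.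
by split=> [/mulfI|->] //; apply; rewrite gt_eqF.
Qed.

Lemma coded_half_turn k : k < size pts -> exists2 h, direct_isometry h &
  forall v w : vertex X, c w = entry H k (c v) -> h (pos v) = pos w.
Proof.
move=> hk; have [h dh hE] := direct_isometry_conj sim (half_turn_direct (pt_norm_neq0 ok s_gt0 hk)).
by exists h => // v w cw; rewrite !posE hE (half_turn_pt ok) // cw.
Qed.
End Coding.

Lemma points_diag pts vals T H a : points_ok pts vals T H a ->
  (forall i, i < size pts -> entry T i i = 0) /\
  (forall i j, i < size pts -> j < size pts -> entry T i j = 0 -> i = j).
Proof.
case/andP => /and5P[_ _ /all_iota h _ _] _; split=> [i hi|i j hi hj e].
  by move: (h i hi) => /all_iota/(_ i hi)/eqP; rewrite eqxx => /eqP.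
by move: (h i hi) => /all_iota/(_ j hj)/eqP; rewrite e eqxx => /esym/eqP.
Qed.

(** The pairs of each of these classes form one orbit under all isometries of the solid, four pairs
    at each vertex. The remaining classes are orthogonality and antipodality: their graph consists
    of three squares for the cuboctahedron and of five octahedra for the icosidodecahedron, and
    [antipodal_part] is the component of vertex 0. *)
Definition cub_good := [:: 1; 3].
Definition ico_good := [:: 1; 2; 3; 5; 6; 7].
Definition antipodal_part (n : nat) (T : seq (seq nat)) (B : seq nat) :=
  [seq i <- iota 0 n | (i == 0) || (entry T 0 i \in B)].

Lemma cub_classes_ok :
  [&& all (symmetry_ok 12 cub_table) (cub_anti :: cub_gens),
      all (symmetry_ok 12 cub_table) cub_half,
      entry cub_table 0 4 \in cub_good,
      rigid_ok 12 cub_table 4 &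
      all (transitive_ok 12 cub_table (cub_anti :: cub_gens)) cub_good] &&
  [&& classes_ok 12 cub_table cub_good [:: 2; 4],
      closed_ok 12 cub_table (antipodal_part 12 cub_table [:: 2; 4]) [:: 2; 4],
      swap_ok 12 cub_table cub_half 3 &
      asymmetric_ok 12 cub_table 1].
Proof. vm_cast_no_check (erefl true). Qed.

Lemma ico_classes_ok :
  [&& all (symmetry_ok 30 ico_table) (ico_anti :: ico_gens),
      all (symmetry_ok 30 ico_table) ico_half,
      entry ico_table 0 7 \in ico_good,
      rigid_ok 30 ico_table 7 &
      all (transitive_ok 30 ico_table (ico_anti :: ico_gens)) ico_good] &&
  [&& classes_ok 30 ico_table ico_good [:: 4; 8],
      closed_ok 30 ico_table (antipodal_part 30 ico_table [:: 4; 8]) [:: 4; 8],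
      all (swap_ok 30 ico_table ico_half) [:: 3; 6; 7] &
      all (asymmetric_ok 30 ico_table) [:: 1; 5]].
Proof. vm_cast_no_check (erefl true). Qed.

Lemma cuboctahedron_not_directed (R : realType) (a : R) (X : polyhedron R) :
  is_cuboctahedron a (vertex_set X) -> ~ directed_type a X.
Proof.
move=> [g sim XE] dirX.
have s0 : (0 < (Num.sqrt 2)^-1 :> R)%R by rewrite invr_gt0 sqrtr_gt0 ltr0n.
have UE := @unit_cuboctahedronP R.
have [c [c_lt c_inj c_surj posE]] := coding cub_points_ok s0 sim UE XE.
have dcl := coded_dist cub_points_ok s0 sim c_lt posE.
have half := coded_half_turn cub_points_ok s0 sim c_lt posE.
have [diag diag0] := points_diag cub_points_ok.
have [/and5P[k1 k2 k3 k4 k5] /and4P[k6 k7 k8 k9]] := andP cub_classes_ok.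
have [d dD jE] := edge_class c_lt c_inj c_surj dcl diag diag0 k1 (isT : 4 < 12) k3 k4 k5 k6 k7 dirX.
have [v0 c0] := c_surj 0 isT; have [[reg _] _ _ _] := dirX.
have h1 := asymmetric_not_regular c_lt c_inj c_surj jE c0 reg.
have h2 := swap_not_directed c_lt c_inj c_surj dcl diag diag0 k2 (erefl : size cub_half = 12)
  (isT : 4 < 12) k3 k4 k5 half dirX jE.
move: dD h1 h2; rewrite !inE => /orP[]/eqP->; first by rewrite k9.
by rewrite k8.
Qed.

Definition face_coded (X : finite_map) (c : vertex X -> nat) (f : face X) (s : seq nat) : Prop :=
  forall e : edge X, ef e f <-> exists k, forall w, ve w e = ((c w == cyc s k) || (c w == cyc s k.+1)).

Section CodedModel.
Variables (R : realType) (X : polyhedron R) (c : vertex X -> nat) (p : nat -> 'rV[R]_3) (b : bool).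
Hypothesis c_lt : forall v, c v < 30.
Hypothesis c_inj : injective c.
Hypothesis c_surj : forall k, k < 30 -> exists v, c v = k.
Hypothesis pE : forall v, pos v = p (c v).
Hypothesis jE : forall u v : vertex X, joined u v = (icl (c u) (c v) == 2).

Lemma coded_vertex k : k < 30 -> exists2 v : vertex X, c v = k & pos v = p k.
Proof. by move=> /c_surj[v cv]; exists v; rewrite ?pE cv. Qed.

Lemma coded_segment (u v : vertex X) : joined u v -> exists e : edge X,
  segment e = [set pos u; pos v] /\ forall w, ve w e = ((c w == c u) || (c w == c v)).
Proof.
move=> /joinedP[uv [e ue ve_]]; exists e; split; first exact: segment_ends.
move=> w; rewrite !(inj_eq c_inj); apply/idP/orP => [we|[/eqP->|/eqP->]//].
have [|wu] := eqVneq w u; [by left|right; apply/eqP].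
by apply: edge_end_eq ue we ve_ wu _; apply/eqP => /esym.
Qed.

Lemma coded_polygon f s : s \in directed_faces b -> face_coded c f s -> polygon f = face_cycle p s.
Proof.
move=> hs fE; have [sz slt sc _] := directed_faceP hs.
have ksegs k : exists e : edge X, segment e = [set p (cyc s k); p (cyc s k.+1)] /\
    forall w, ve w e = ((c w == cyc s k) || (c w == cyc s k.+1)).
  have [u cu pu] := coded_vertex (slt k); have [v cv pv] := coded_vertex (slt k.+1).
  have [|e] := @coded_segment u v; last by rewrite cu cv pu pv; exists e.
  rewrite jE cu cv; have /and3P[+ _ _] := sc k.
  by rewrite icl_sym.
apply/seteqP; split=> A.
  move=> [e /fE[k ek] <-]; exists (k %% size s); first by rewrite ltn_mod.
  rewrite cyc_mod -[(_ %% _).+1]addn1 cyc_add addn1; have [d' [<- dk]] := ksegs k.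
  by congr segment; apply: (@edge_inj _ X); apply/setP => w; rewrite !inE ek dk.
move=> [k _ ->]; have [e [<- ek]] := ksegs k; exists e => //; apply/fE; exists k; exact: ek.
Qed.

Lemma coded_model : (forall f, exists2 s, s \in directed_faces b & face_coded c f s) ->
  (forall s, s \in faces b -> exists f, face_coded c f s) -> is_model X p b.
Proof.
move=> fs sf; split.
- apply/seteqP; split=> x; first by move=> [v _ <-]; exists (c v).
  by move=> [i /coded_vertex[v _ pv] ->]; exists v.
- apply/seteqP; split=> A.
    move=> [e _ <-]; have [u uv] : exists u, ve u e.
      have /eqP/cards2P[u [v [_ /setP/(_ u)]]] := edge_ends e.
      by rewrite !inE eqxx; exists u.
    have [v vu vE] := edge_other_end uv; exists (c u), (c v); split=> //.
      by apply/eqP; rewrite -jE; apply/joinedP; split; [apply/eqP; rewrite eq_sym | exists e].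
    by rewrite -!pE; apply: segment_ends => //; apply/eqP; rewrite eq_sym.
  move=> [i [j [/coded_vertex[u cu pu] /coded_vertex[v cv pv] ij ->]]].
  have [|e [eE _]] := @coded_segment u v; first by rewrite jE cu cv ij.
  by exists e => //; rewrite eE pu pv.
- apply/seteqP; split=> A.
    move=> [f _ <-]; have [s hs fE] := fs f.
    have /allP/(_ b (mem_bools b))/allP/(_ s hs)/hasP[t tb st] := same_poly_ok.
    by exists t => //; rewrite (coded_polygon hs fE) // (same_polyP p st).
  move=> [s sb ->]; have [f fE] := sf s sb.
  by exists f => //; apply: coded_polygon fE; rewrite mem_cat sb.
Qed.
End CodedModel.

Lemma icosidodecahedron_directed (R : realType) (a : R) (X : polyhedron R) :
  is_icosidodecahedron a (vertex_set X) -> directed_type a X ->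
  exists g b, similarity a g /\ is_model X (fun i => g (pt ico_pts 2^-1%R i)) b.
Proof.
move=> [g sim XE] dirX.
have s0 : (0 < 2^-1 :> R)%R by rewrite invr_gt0 ltr0n.
have UE := @unit_icosidodecahedronP R.
have [c [c_lt c_inj c_surj posE]] := coding ico_points_ok s0 sim UE XE.
have dcl := coded_dist ico_points_ok s0 sim c_lt posE.
have half := coded_half_turn ico_points_ok s0 sim c_lt posE.
have [diag diag0] := points_diag ico_points_ok.
have s30 : size ico_pts = 30 by vm_compute.
rewrite {}s30 in c_lt c_surj half diag diag0.
have [/and5P[k1 k2 k3 k4 k5] /and4P[k6 k7 k8 k9]] := andP ico_classes_ok.
have [d dD jE] := edge_class c_lt c_inj c_surj dcl diag diag0 k1 (isT : 7 < 30) k3 k4 k5 k6 k7 dirX.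
have [v0 c0] := c_surj 0 isT; have [[reg _] _ _ _] := dirX.
have d2 : d = 2.
  have h1 := asymmetric_not_regular c_lt c_inj c_surj jE c0 reg.
  have h2 := swap_not_directed c_lt c_inj c_surj dcl diag diag0 k2 (erefl : size ico_half = 30)
    (isT : 7 < 30) k3 k4 k5 half dirX jE.
  have [//|nd] := eqVneq d 2; have : (d \in [:: 3; 6; 7]) || (d \in [:: 1; 5]).
    by move: dD nd; rewrite !inE; case: (d) => [|[|[|[|[|[|[|[|?]]]]]]]].
  case/orP=> hd; first by rewrite (allP k8) in h2.
  by rewrite (allP k9) in h1.
rewrite {}d2 {k1 k2 k3 k4 k5 k6 k7 k8 k9 dcl dD} in jE; have [b win] := window_kind c_lt c_inj c_surj jE reg.
exists g, b; split; first exact: sim.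
have [p pE ->] : exists2 p, forall v, pos v = p (c v) & (fun i => g (pt ico_pts 2^-1%R i)) = p.
  by exists (fun i => g (pt ico_pts 2^-1%R i)).
move: posE half => _ _.
apply: (coded_model c_lt c_inj c_surj pE jE) => [f|s sb].
  have [e ef_] := face_nonempty f.
  have [u [v [uv uE vE]]] : exists u v, [/\ u != v, ve u e & ve v e].
    have /eqP/cards2P[u [v [uv /setP ee]]] := edge_ends e; exists u, v.
    by move: (ee u) (ee v); rewrite !inE !eqxx orbT.
  have [|y hc] := @corner_next _ X f u v; first by exists e.
  have cc : corner (c u) (c v) (c y) by apply/(corner_iff c_lt c_inj c_surj jE reg); exists f.
  have [s hs [i [e1 e2 e3]]] := corner_faceP b (c_lt u) (c_lt v) (c_lt y) cc.
  exists s => //; exact: (face_walk_of c_lt c_inj c_surj win hs e1 e2 e3 hc).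
have hs : s \in directed_faces b by rewrite mem_cat sb.
have [_ slt sc _] := directed_faceP hs.
have [u cu] := c_surj _ (slt 0); have [v cv] := c_surj _ (slt 1); have [y cy] := c_surj _ (slt 2).
have [|f hf] := (corner_iff c_lt c_inj c_surj jE reg u v y).2; first by rewrite cu cv cy.
exists f; apply: (face_walk_of (i := 0) c_lt c_inj c_surj win hs _ _ _ hf); exact/esym.
Qed.

(** * Existence: the two polyhedra and their coding *)

Lemma faces_complex_ok b : complex_ok 30 ico_edges (faces b).
Proof. by case: b; [exact: hex_complex_ok | exact: pent_complex_ok]. Qed.

Definition ico_map b : finite_map := complex_map (faces_complex_ok b).
Notation ive := (cve 30 ico_edges).
Notation ief b := (cef 30 ico_edges (faces b)).
Definition face_size (b : bool) := if b then 6 else 5.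
Notation nF b := (size (faces b)).

Lemma ico_edges_ok :
  all (fun e => all (fun e' => (e == e') || has (fun v => ive v e != ive v e') (iota 0 30))
    (iota 0 (size ico_edges))) (iota 0 (size ico_edges)) &&
  all (fun v => count (ive v) (iota 0 (size ico_edges)) == 4) (iota 0 30).
Proof. vm_cast_no_check (erefl true). Qed.

Lemma ico_faces_ok : all (fun b =>
  all (fun f => all (fun f' => (f == f') || has (fun e => ief b e f != ief b e f')
    (iota 0 (size ico_edges))) (iota 0 (nF b))) (iota 0 (nF b)) &&
  all (fun f => count (fun e => ief b e f) (iota 0 (size ico_edges)) == face_size b) (iota 0 (nF b))) bools.
Proof. vm_cast_no_check (erefl true). Qed.

Lemma ico_joined_ok : all (fun i => all (fun j =>
   ((i != j) && has (fun e => ive i e && ive j e) (iota 0 (size ico_edges))) == (icl i j == 2))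
  (iota 0 30)) (iota 0 30).
Proof. vm_cast_no_check (erefl true). Qed.

Lemma ico_face_edges_ok : all (fun b => all (fun f => let s := nth [::] (faces b) f in
  all (fun e => ief b e f == has (fun k => all (fun w =>
     ive w e == ((w == cyc s k) || (w == cyc s k.+1))) (iota 0 30)) (iota 0 (size s)))
  (iota 0 (size ico_edges))) (iota 0 (nF b))) bools.
Proof. vm_cast_no_check (erefl true). Qed.

Lemma ico_edge_inj b : injective (fun e : edge (ico_map b) => [set v : vertex (ico_map b) | ve v e]%SET).
Proof.
move=> e e' /setP h; apply/val_inj/eqP.
have /andP[/all_ord/(_ e)/all_ord/(_ e')/orP[//|/has_ord[v nv]] _] := ico_edges_ok.
by have := h v; rewrite !inE => hv; case/negP: nv; apply/eqP; exact: hv.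
Qed.

Lemma ico_face_inj b : injective (fun f : face (ico_map b) => [set e : edge (ico_map b) | ef e f]%SET).
Proof.
move=> f f' /setP h; apply/val_inj/eqP.
have /allP/(_ b (mem_bools b))/andP[/all_ord/(_ f)/all_ord/(_ f')/orP[//|/has_ord[e ne]] _] := ico_faces_ok.
by have := h e; rewrite !inE => he; case/negP: ne; apply/eqP; exact: he.
Qed.

Lemma ico_has_type b : has_type (ico_map b) (face_size b) 4.
Proof.
split=> [f|v].
  have /allP/(_ b (mem_bools b))/andP[_ /all_ord/(_ f)/eqP <-] := ico_faces_ok.
  exact: (card_ord_set _ (fun e => ief b e f)).
have /andP[_ /all_ord/(_ v)/eqP <-] := ico_edges_ok.
exact: (card_ord_set _ (fun e => ive v e)).
Qed.

Section Existence.
Variable R : realType.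
Notation point := 'rV[R]_3.
Definition ico_pt (i : nat) : point := pt ico_pts 2^-1%R i.

Lemma half_gt0 : (0 < 2^-1 :> R)%R. Proof. by rewrite invr_gt0 ltr0n. Qed.

Lemma size_ico_pts : size ico_pts = 30. Proof. by vm_compute. Qed.

Lemma ico_pt_inj i j : i < 30 -> j < 30 -> ico_pt i = ico_pt j -> i = j.
Proof. by have := pt_inj ico_points_ok half_gt0; rewrite size_ico_pts; apply. Qed.

Lemma ico_pt_dist i j k l : i < 30 -> j < 30 -> k < 30 -> l < 30 ->
  dist (ico_pt i) (ico_pt j) = dist (ico_pt k) (ico_pt l) <-> icl i j = icl k l.
Proof. by have := pt_dist_eq ico_points_ok half_gt0; rewrite size_ico_pts; apply. Qed.

Lemma ico_half_turn k i : k < 30 -> i < 30 ->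
  half_turn (ico_pt k) (ico_pt i) = ico_pt (entry ico_half k i).
Proof. by have := half_turn_pt ico_points_ok half_gt0; rewrite size_ico_pts; apply. Qed.

Lemma ico_half_direct k : k < 30 -> direct_isometry (half_turn (ico_pt k)).
Proof.
by move=> hk; apply: half_turn_direct; apply: (pt_norm_neq0 ico_points_ok half_gt0); rewrite size_ico_pts.
Qed.

Lemma ico_antipode i : i < 30 -> ico_pt (nth 0 ico_anti i) = (- ico_pt i)%R.
Proof. by have := antipode_pt (R := R) 2^-1 ico_points_ok; rewrite size_ico_pts; apply. Qed.

Lemma ico_pos_inj b : injective (fun v : vertex (ico_map b) => ico_pt (v : 'I_30)).
Proof. by move=> u v /ico_pt_inj h; apply/val_inj/h. Qed.

Lemma ico_map_type b : exists p q, [/\ 3 <= p, 3 <= q & has_type (ico_map b) p q].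
Proof. by exists (face_size b), 4; split; [case: b | | exact: ico_has_type]. Qed.

Definition ico_poly b : polyhedron R :=
  @Polyhedron R (ico_map b) (fun v => ico_pt (v : 'I_30)) (@ico_pos_inj b)
    (@ico_edge_inj b) (@ico_face_inj b) (ico_map_type b).

Definition code b (v : vertex (ico_poly b)) : nat := val (v : 'I_30).

Lemma code_lt b (v : vertex (ico_poly b)) : code v < 30. Proof. exact: ltn_ord. Qed.
Lemma code_inj b : injective (@code b). Proof. exact: val_inj. Qed.
Lemma code_surj b k : k < 30 -> exists v : vertex (ico_poly b), code v = k.
Proof. by move=> hk; exists (Ordinal hk). Qed.
Lemma posE b (v : vertex (ico_poly b)) : pos v = ico_pt (code v). Proof. by []. Qed.

Lemma ico_joined b (u v : vertex (ico_poly b)) : joined u v = (icl (code u) (code v) == 2).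
Proof.
have /all_ord/(_ (u : 'I_30))/all_ord/(_ (v : 'I_30))/eqP <- := ico_joined_ok.
rewrite /joined -val_eqE; congr (_ && _).
apply/existsP/idP => [[e he]|/has_ord[e he]]; last by exists e.
exact: (ord_has (P := fun e => ive u e && ive v e) he).
Qed.

Lemma ico_face_coded b (f : face (ico_poly b)) :
  face_coded (@code b) f (nth [::] (faces b) (f : 'I_(nF b))).
Proof.
set s := nth _ _ _; have hs : s \in directed_faces b by rewrite mem_cat mem_nth.
have [s0 _ _ _] := directed_faceP hs.
move=> e; have /allP/(_ b (mem_bools b))/all_ord/(_ (f : 'I_(nF b)))/all_ord/(_ (e : 'I_(size ico_edges)))/eqP h := ico_face_edges_ok.
rewrite [ef e f]h -/s; split=> [/hasP[k _ /all_iota hk]|[k hk]].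
  by exists k => w; apply/eqP; apply: hk; exact: code_lt.
apply/hasP; exists (k %% size s); first by rewrite mem_iota ltn_mod.
apply/allP => w; rewrite mem_iota => hw; apply/eqP.
by rewrite cyc_mod -[(_ %% _).+1]addn1 cyc_add addn1; exact: (hk (Ordinal hw)).
Qed.

Lemma ico_poly_model b : is_model (ico_poly b) ico_pt b.
Proof.
apply: (coded_model (@code_lt b) (@code_inj b) (@code_surj b) (@posE b) (@ico_joined b)) => [f|s sb].
  by exists (nth [::] (faces b) (f : 'I_(nF b))); [rewrite mem_cat mem_nth | exact: ico_face_coded].
have hi : index s (faces b) < nF b by rewrite index_mem.
exists (Ordinal hi : face (ico_poly b)); have := @ico_face_coded b (Ordinal hi).
by rewrite /= nth_index.
Qed.
End Existence.

(** * Existence: automorphisms, flag orbits and index 2 *)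

Section AutSymmetry.
Variables (R : realType) (X : polyhedron R) (s : cell_perm X) (h : 'rV[R]_3 -> 'rV[R]_3).
Hypothesis sA : s \in automorphisms X.
Hypothesis hE : forall v : vertex X, h (pos v) = pos (vperm s v).

Lemma aut_segment e : h @` segment e = segment (eperm s e).
Proof.
have /automorphismP[sv _] := sA; apply/seteqP; split=> x.
  by move=> [_ [v /= ve_ <-] <-]; exists (vperm s v); rewrite /= ?sv // hE.
move=> [v /= ve_ <-]; exists (pos ((vperm s)^-1%g v)); last by rewrite hE permKV.
by exists ((vperm s)^-1%g v); rewrite //= -sv permKV.
Qed.

Lemma aut_polygon f : polygon_image h (polygon f) = polygon (fperm s f).
Proof.
have /automorphismP[_ sf] := sA; apply/seteqP; split=> x.
  by move=> [_ [e /= ef_ <-] <-]; exists (eperm s e); rewrite /= ?sf // aut_segment.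
move=> [e /= ef_ <-]; exists (segment ((eperm s)^-1%g e)); last by rewrite aut_segment permKV.
by exists ((eperm s)^-1%g e); rewrite //= -sf permKV.
Qed.

Lemma aut_maps_onto : maps_onto h X X.
Proof.
split; apply/seteqP; split=> x.
- by move=> [_ [v _ <-] <-]; exists (vperm s v).
- by move=> [v _ <-]; exists (pos ((vperm s)^-1%g v)); rewrite ?hE ?permKV //; exists ((vperm s)^-1%g v).
- by move=> [_ [v _ <-] <-]; exists (eperm s v); rewrite ?aut_segment.
- by move=> [v _ <-]; exists (segment ((eperm s)^-1%g v)); rewrite ?aut_segment ?permKV //; exists ((eperm s)^-1%g v).
- by move=> [_ [v _ <-] <-]; exists (fperm s v); rewrite ?aut_polygon.
- by move=> [v _ <-]; exists (polygon ((fperm s)^-1%g v)); rewrite ?aut_polygon ?permKV //; exists ((fperm s)^-1%g v).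
Qed.
End AutSymmetry.

Notation fmove b g x :=
  (nth 0 g x.1.1, edge_image 30 ico_edges g x.1.2, face_image (faces b) g x.2).
Definition flag_succ b (gs : seq (seq nat)) (x : nat * nat * nat) : seq (nat * nat * nat) :=
  [seq fmove b g x | g <- gs].
Definition base_flag b : nat * nat * nat := head (0, 0, 0) (flags 30 ico_edges (faces b)).

Definition ico_rotations := [seq nth [::] ico_half k | k <- [:: 0; 1; 6]].

Lemma ico_aut_ok : all (fun b => all (aut_ok 30 ico_edges (faces b))
  [:: ico_conj, ico_anti & ico_rotations]) bools.
Proof. vm_cast_no_check (erefl true). Qed.

(* The flags fall into two orbits under the symmetry group, exchanged by conjugation. *)
Lemma ico_flags_ok : all (fun b => let x := base_flag b in
  let r := reach (flag_succ b (ico_anti :: ico_rotations)) (30 * 30) x in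
  let r' := reach (flag_succ b (ico_anti :: ico_rotations)) (30 * 30) (fmove b ico_conj x) in
  (x \in flags 30 ico_edges (faces b)) &&
  all (fun y => (y \in r) || (y \in r')) (flags 30 ico_edges (faces b))) bools.
Proof. vm_cast_no_check (erefl true). Qed.

(** A changed class shows that no isometry induces the conjugation. *)
Lemma ico_conj_moves :
  has (fun i => has (fun j => icl (nth 0 ico_conj i) (nth 0 ico_conj j) != icl i j) (iota 0 30)) (iota 0 30).
Proof. vm_cast_no_check (erefl true). Qed.

Lemma ico_vertices_ok :
  let r := reach (fun i => [seq nth 0 g i | g <- ico_rotations]) (30 * 30) 0 in
  all (fun i => i \in r) (iota 0 30).
Proof. vm_cast_no_check (erefl true). Qed.

Lemma ico_rotation_index g : g \in ico_rotations -> exists2 k, k < 30 & g = nth [::] ico_half k.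
Proof. by case/mapP=> k hk ->; exists k => //; move: hk; rewrite !inE => /or3P[]/eqP->. Qed.

Local Opaque ico_rotations ico_anti ico_conj.

Lemma mem_flags n E F v e f : ((v, e, f) \in flags n E F) =
  [&& cve n E v e && cef n E F e f, v < n, e < size E & f < size F].
Proof.
rewrite mem_filter /=; congr (_ && _); apply/allpairsP/and3P => [[[[v' e'] f'] [/=]]|[hv he hf]].
  case/allpairsP=> [[v2 e2] [/= h1 h2 [-> ->]]] h3 [-> -> ->].
  by rewrite !mem_iota in h1 h2 h3.
exists ((v, e), f); split; rewrite ?mem_iota //.
by apply/allpairsP; exists (v, e); rewrite !mem_iota.
Qed.

Lemma mem_tail (T : eqType) (x a : T) l : x \in l -> x \in a :: l.
Proof. by rewrite in_cons => ->; rewrite orbT. Qed.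

Section IcoSymmetry.
Variables (R : realType) (b : bool).
Notation P := (ico_poly R b).
Notation V := (vertex P).
Notation pt := (@ico_pt R).

Definition fcode (x : vertex P * edge P * face P) : nat * nat * nat :=
  (val (x.1.1 : 'I_30), val (x.1.2 : 'I_(size ico_edges)), val (x.2 : 'I_(size (faces b)))).

Lemma fcode_inj : injective fcode.
Proof. by move=> [[v e] f] [[v' e'] f'] [] /val_inj-> /val_inj-> /val_inj->. Qed.

Definition fapply (s : cell_perm P) (x : vertex P * edge P * face P) :=
  (vperm s x.1.1, eperm s x.1.2, fperm s x.2).

Lemma fapplyM s t x : fapply (s * t)%g x = fapply t (fapply s x).
Proof. by rewrite /fapply /vperm /eperm /fperm /= !permM. Qed.

Lemma ico_aut g : g \in [:: ico_conj, ico_anti & ico_rotations] ->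
  exists2 s : cell_perm P, s \in automorphisms P &
    (forall v, code (vperm s v) = nth 0 g (code v)) /\ forall x, fcode (fapply s x) = fmove b g (fcode x).
Proof.
move=> hg; have /allP/(_ b (mem_bools b))/allP/(_ g hg)/(aut_of (faces_complex_ok b)) := ico_aut_ok.
case=> s sA [sv se sf]; exists s => //; split=> // x.
by rewrite /fcode /fapply /= se sf; congr (_, _, _); exact: sv.
Qed.

Lemma ico_rotation g : g \in ico_rotations ->
  exists h s, [/\ direct_isometry h, s \in automorphisms P, forall v : V, h (pos v) = pos (vperm s v) &
    (forall v, code (vperm s v) = nth 0 g (code v)) /\ forall x, fcode (fapply s x) = fmove b g (fcode x)].
Proof.
move=> hg; have [k hk gE] := ico_rotation_index hg.
have hg' : g \in [:: ico_conj, ico_anti & ico_rotations] by apply: mem_tail; apply: mem_tail.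
have [s sA [sv sf]] := ico_aut hg'.
exists (half_turn (pt k)), s; split; [exact: ico_half_direct | exact: sA | | by split].
move=> v; rewrite !posE sv ico_half_turn ?code_lt //.
by rewrite gE.
Qed.

Lemma ico_symmetry g : g \in ico_anti :: ico_rotations ->
  exists2 s : cell_perm P, s \in symmetries P &
    (forall v, code (vperm s v) = nth 0 g (code v)) /\ forall x, fcode (fapply s x) = fmove b g (fcode x).
Proof.
rewrite in_cons => /orP[/eqP->|/ico_rotation[h [s [dh sA hs sE]]]]; last first.
  exists s => //; apply/symmetriesP; split=> //; exists h => //.
  by split; [exact: direct_isometry_isometry | exact: aut_maps_onto hs].
have ha : ico_anti \in [:: ico_conj, ico_anti & ico_rotations] by apply: mem_tail; apply: mem_head.
have [s sA [sv sf]] := ico_aut ha.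
exists s => //; apply/symmetriesP; split=> //.
have hs (v : V) : (- pos v)%R = pos (vperm s v).
  by rewrite !posE sv ico_antipode ?code_lt.
exists (fun x => - x)%R => //; split; last exact: aut_maps_onto hs.
by move=> x y; apply/dist_eqP; rewrite !dotmulE !mxE; ring.
Qed.

Lemma symmetry_class s (u v : V) : s \in symmetries P ->
  icl (code (vperm s u)) (code (vperm s v)) = icl (code u) (code v).
Proof.
case/symmetriesP=> _ [g [ig _] gE]; apply/(ico_pt_dist R); rewrite ?code_lt // -!posE.
by rewrite !gE ig.
Qed.

Lemma flag_reach (x y : vertex P * edge P * face P) :
  fcode y \in reach (flag_succ b (ico_anti :: ico_rotations)) (30 * 30) (fcode x) ->
  exists2 s, s \in symmetries P & fapply s x = y.
Proof.
move=> hr; suff [s sS /fcode_inj sx] : exists2 s, s \in symmetries P & fcode (fapply s x) = fcode y.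
  by exists s.
apply: (reachP (Pr := fun z => exists2 s, s \in symmetries P & fcode (fapply s x) = z) _ _ hr).
  exists 1%g; first exact: (group1 (symmetry_group P)).
  by congr fcode; case: x {hr} => [[? ?] ?]; rewrite /fapply /vperm /eperm /fperm /= !perm1.
move=> _ z [s sS <-] /mapP[g hg ->]; have [t tS [_ tE]] := ico_symmetry hg.
exists (s * t)%g; first exact: (groupM (G := symmetry_group P)).
by rewrite fapplyM tE.
Qed.

Lemma flag_in_flags (v : V) e f : flag v e f -> fcode (v, e, f) \in flags 30 ico_edges (faces b).
Proof.
by move=> h; rewrite mem_flags; apply/and4P; split; [exact: h | exact: ltn_ord ..].
Qed.

Lemma flags_decode x : x \in flags 30 ico_edges (faces b) ->
  exists v e f, flag v e f /\ fcode (v, e, f) = x.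
Proof.
case: x => [[i j] k]; rewrite mem_flags => /and4P[h hi hj hk].
exists (Ordinal hi : vertex P), (Ordinal hj : edge P), (Ordinal hk : face P).
by split; first exact: h.
Qed.

Lemma base_flagP : exists v e f, flag v e f /\ fcode (v, e, f) = base_flag b.
Proof. by apply: flags_decode; have /allP/(_ b (mem_bools b))/andP[] := ico_flags_ok. Qed.

Lemma conj_autP : exists2 t : cell_perm P, t \in automorphisms P &
  t \notin symmetries P /\ forall x, fcode (fapply t x) = fmove b ico_conj (fcode x).
Proof.
have [t tA [tv tf]] := ico_aut (mem_head ico_conj (ico_anti :: ico_rotations)).
exists t => //; split=> //; apply/negP => tS.
have /hasP[i + /hasP[j + /negP ij]] := ico_conj_moves; rewrite !mem_iota => hi hj; apply: ij.
have := symmetry_class (Ordinal hi : V) (Ordinal hj : V) tS.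
by rewrite !tv => /eqP.
Qed.

Lemma flag_orbits : exists v0 e0 f0 (t : cell_perm P), [/\ flag v0 e0 f0,
  t \in automorphisms P, t \notin symmetries P &
  forall v e f, flag v e f -> exists2 s, s \in symmetries P &
    fapply s (v0, e0, f0) = (v, e, f) \/ fapply (t * s)%g (v0, e0, f0) = (v, e, f)].
Proof.
have [v0 [e0 [f0 [h0 c0]]]] := base_flagP; have [t tA [tS tE]] := conj_autP.
exists v0, e0, f0, t; split=> // v e f h.
have /allP/(_ b (mem_bools b))/andP[_ /allP/(_ _ (flag_in_flags h))] := ico_flags_ok.
rewrite -c0 -tE; case/orP=> /flag_reach[s sS sE]; exists s => //; [by left|right].
by rewrite fapplyM.
Qed.

Lemma fapply_uniq s t v e f : s \in automorphisms P -> t \in automorphisms P -> flag v e f ->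
  fapply s (v, e, f) = fapply t (v, e, f) -> s = t.
Proof.
move=> sA tA h st; apply/eqP; rewrite eq_mulgV1; apply/eqP.
have stA : (s * t^-1)%g \in automorphisms P.
  by rewrite -[_ \in _]/(_ \in automorphism_group P) groupM ?groupV.
have : fapply (s * t^-1)%g (v, e, f) = (v, e, f).
  rewrite fapplyM st -fapplyM mulgV.
  by rewrite /fapply /vperm /eperm /fperm /= !perm1.
by case=> sv se sf; apply: flag_free stA h sv se sf.
Qed.

Lemma symmetries_sub : symmetries P \subset automorphisms P.
Proof. by apply/fintype.subsetP => s /symmetriesP[]. Qed.

Lemma ico_regular : regular_map P.
Proof.
have [v0 [e0 [f0 [t [h0 tA tS orb]]]]] := flag_orbits.
have from v e f : flag v e f -> exists2 s, s \in automorphism_group P & fapply s (v0, e0, f0) = (v, e, f).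
  move=> /orb[s /(fintype.subsetP symmetries_sub) sA [sE|sE]]; [by exists s | exists (t * s)%g => //].
  by apply: groupM.
move=> v e f v' e' f' /from[s sA sE] /from[s' sA' sE'].
exists (s^-1 * s')%g; first exact: (groupM (groupVr sA) sA').
have : fapply (s^-1 * s')%g (v, e, f) = (v', e', f').
  by rewrite -sE -fapplyM mulgA mulgV mul1g.
by case.
Qed.

(** An automorphism is determined by the image of one flag, so the two flag orbits of the symmetry
    group yield exactly two cosets of it, the second being that of the conjugation [t]. *)
Lemma ico_index2 : regular_index2 P.
Proof.
split; first exact: ico_regular.
have [v0 [e0 [f0 [t [h0 tA tS orb]]]]] := flag_orbits.
pose G := symmetry_group P; pose A := automorphism_group P.
have AE : (A : {set _}) = (G :|: (G :* t^-1)%g)%SET.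
  apply/setP => s; apply/idP/finset.setUP => [sA|[|/rcosetP[g gG ->]]]; last 2 first.
  - exact: (fintype.subsetP symmetries_sub).
  - by rewrite groupM ?groupV //; apply: (fintype.subsetP symmetries_sub).
  have sVA : (s^-1)%g \in automorphisms P by exact: groupVr sA.
  have : flag (vperm s^-1%g v0) (eperm s^-1%g e0) (fperm s^-1%g f0) by rewrite aut_flag.
  move/orb=> [g gS [gE|gE]].
    left; rewrite -groupV; suff <- : g = (s^-1)%g by [].
    by apply: (fapply_uniq _ sVA h0 gE); apply: (fintype.subsetP symmetries_sub).
  right; apply/rcosetP; exists (g^-1)%g; first exact: (groupVr (G := G)).
  have gA : g \in A by apply: (fintype.subsetP symmetries_sub).
  have tgA : (t * g)%g \in A by apply: groupM.
  by rewrite -invMg (fapply_uniq tgA sVA h0 gE) invgK.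
have dis : (G :&: (G :* t^-1)%g)%SET = finset.set0.
  apply/setP => s; rewrite finset.in_set0; apply/negP => /finset.setIP[sG /rcosetP[g gG sE]].
  case/negP: tS; rewrite -[_ \in _]/(_ \in G) -groupV.
  by have -> : (t^-1 = g^-1 * s)%g; [rewrite sE mulKg | rewrite groupM ?groupV].
have : #|A| = #|G| + #|G| by rewrite AE cardsU dis cards0 subn0 card_rcoset.
move=> cA; rewrite -[LHS]/(#|A : G|%g) -divgS; last exact: symmetries_sub.
by rewrite cA addnn -mul2n mulnK ?cardG_gt0.
Qed.

Lemma ico_vertex_transitive : vertex_transitive P.
Proof.
have from (v0 v : V) : code v0 = 0 -> exists2 s, s \in vertex_symmetry_group P & s v0 = v.
  move=> c0; have hr := all_iota ico_vertices_ok (code_lt v).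
  suff [s sS /code_inj <-] : exists2 s, s \in vertex_symmetry_group P & code (s v0) = code v by exists s.
  apply: (reachP (Pr := fun z => exists2 s, s \in vertex_symmetry_group P & code (s v0) = z) _ _ hr).
    by exists 1%g; [exact: group1 | rewrite perm1].
  move=> _ z [s sS <-] /mapP[g hg ->]; have hg' : g \in ico_anti :: ico_rotations by apply: mem_tail.
  have [t /symmetriesP[_ tS] [tE _]] := ico_symmetry hg'.
  exists (s * vperm t)%g; last by rewrite permM tE.
  by apply: groupM; [exact: sS | apply/vertex_symmetriesP; exact: tS].
have [v0 c0] := @code_surj R b 0 isT.
move=> u v; have [s sS su] := from v0 u c0; have [t tS tv] := from v0 v c0.
have /vertex_symmetriesP[g Sg gE] : (s^-1 * t)%g \in vertex_symmetry_group P by rewrite groupM ?groupV.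
by exists g; [exact: Sg | rewrite -gE permM -su permK tv].
Qed.
End IcoSymmetry.

Lemma ico_pt_vev (R : realType) i : ico_pt R i = (2^-1 *: vev R (nth vt0 ico_pts i))%R.
Proof. by []. Qed.

Lemma evE (R : realType) x : ev R x = (evZ R x.1 + evZ R x.2 * golden R)%R.
Proof. by []. Qed.

Local Opaque pt vev ev.

(** * Metric properties: directedness, edge length, non-similarity *)

Notation ipt := (nth vt0 ico_pts).

(* A rotation exchanging the ends of the edge would map some third vertex to a
   vertex that makes it orientation-reversing. *)
Lemma no_swap_ok : has (fun k => all (fun l =>
    (icl 0 l == icl 7 k) && (icl 7 l == icl 0 k) ==>
    let x := trp (ipt 7) (ipt 0) (ipt k) in let y := trp (ipt 0) (ipt 7) (ipt l) in
    ztpos (ztB x y) || ztpos (ztB y x)) (iota 0 30)) (iota 0 30).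
Proof. vm_cast_no_check (erefl true). Qed.

(** The vertices lie on a sphere around 0, so the centre of a regular pentagon, a multiple of the
    sum of its vertices, is perpendicular to its plane. *)
Definition face_normal (s : seq nat) : vt := foldr vtD vt0 [seq ipt k | k <- s].

Definition planar_ok (s : seq nat) : bool :=
  let h k := ip (face_normal s) (ipt k) in
  ztpos (h (head 0 s)) && all (fun k => zteq (h k) (h (head 0 s))) s.

(** The plane of [s] strictly supports the solid, and a nonzero triple product of three points of
    [s] ensures that they are not collinear. *)
Definition hull_ok (s : seq nat) : bool :=
  let h k := ip (face_normal s) (ipt k) in
  [&& planar_ok s, all (fun k => (k \in s) || ztpos (ztB (h (head 0 s)) (h k))) (iota 0 30),
    all (fun k => k < 30) s, 2 < size s
    & let x := trp (ipt (cyc s 0)) (ipt (cyc s 1)) (ipt (cyc s 2)) in ztpos x || ztpos (ztN x)].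

(** The pentagrams, listed after the twelve convex pentagons, have the vertices of the pentagonal
    faces of S; so each edge is a diagonal of a face of S. *)
Lemma edge_hull_ok : all (fun i => all (fun j => (icl i j == 2) ==>
    has (fun s => (i \in s) && (j \in s)) (drop 12 pent_faces)) (iota 0 30)) (iota 0 30).
Proof. vm_cast_no_check (erefl true). Qed.

Lemma pentagram_hull_ok : all hull_ok (drop 12 pent_faces).
Proof. vm_cast_no_check (erefl true). Qed.

Lemma pent_planar_ok : all planar_ok pent_faces.
Proof. vm_cast_no_check (erefl true). Qed.

Lemma face_sizes_ok : all (fun b => all (fun s => (size s == face_size b) && uniq s) (faces b)) bools.
Proof. vm_cast_no_check (erefl true). Qed.

(** Every edge lies between a convex pentagon, with index below 12, and a pentagram. The directions
    in [ico_edges] are consistent along the boundary of either; running along them on pentagrams and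
    against them on convex pentagons orients the surface. *)
Definition orient (v e f : nat) : bool := (v == (nth (0, 0) ico_edges e).1) (+) (f < 12).

Notation pef := (cef 30 ico_edges pent_faces).
Notation pve := (cve 30 ico_edges).

Lemma orient_edge_ok : all (fun e => all (fun u => all (fun v =>
    [&& pve u e, pve v e & u != v] ==> (orient u e 0 != orient v e 0)) (iota 0 30)) (iota 0 30)) (iota 0 60).
Proof. vm_cast_no_check (erefl true). Qed.

Lemma orient_face_ok : all (fun v => let s := edges_at 30 ico_edges v in all (fun f => all (fun d => all (fun e =>
    [&& pef d f, pef e f & d != e] ==> (orient v d f != orient v e f)) s) s) (iota 0 24)) (iota 0 30).
Proof. vm_cast_no_check (erefl true). Qed.

Lemma orient_side_ok : all (fun e => all (fun f => all (fun g =>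
    [&& pef e f, pef e g & f != g] ==> ((f < 12) != (g < 12))) (iota 0 24)) (iota 0 24)) (iota 0 60).
Proof. vm_cast_no_check (erefl true). Qed.

Definition hex_flags := Eval vm_compute in flags 30 ico_edges (faces true).

Lemma hex_flagsE : flags 30 ico_edges (faces true) = hex_flags.
Proof. vm_cast_no_check (erefl hex_flags). Qed.

Definition adjacent_flags (x y : nat * nat * nat) : bool :=
  [|| (x.1 == y.1) && (x.2 != y.2), (x.1.1 == y.1.1) && (x.1.2 != y.1.2) && (x.2 == y.2)
    | (x.1.1 != y.1.1) && (x.1.2 == y.1.2) && (x.2 == y.2)].
Definition parity_succ (x : nat * nat * nat * bool) : seq (nat * nat * nat * bool) :=
  [seq (y, ~~ x.2) | y <- hex_flags & adjacent_flags x.1 y].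

Definition hex_flag0 := head (0, 0, 0) hex_flags.

Lemma hex_flag0_in : hex_flag0 \in hex_flags.
Proof. vm_cast_no_check (erefl true). Qed.

(* Some closed walk of odd length in the flag graph. *)
Lemma hex_odd_ok : (hex_flag0, true) \in reach parity_succ (30 * 30) (hex_flag0, false).
Proof. vm_cast_no_check (erefl true). Qed.

Local Opaque hex_flag0 hex_flags.

Section Metric.
Variable R : realType.
Notation pt := (@ico_pt R).
Notation poly b := (ico_poly R b).
Local Open Scope ring_scope.

Lemma triple_mx (n x y : 'rV[R]_3) (A : 'M[R]_3) :
  triple (n *m A) (x *m A) (y *m A) = \det A * triple n x y.
Proof. by rewrite !tripleE det_mx33 !mxE !sum3; ring. Qed.

Lemma tripleZ (a : R) (n x y : 'rV[R]_3) : triple (a *: n) (a *: x) (a *: y) = a ^+ 3 * triple n x y.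
Proof. by rewrite !tripleE !mxE; ring. Qed.

Lemma ico_pt_triple i j k : triple (pt i) (pt j) (pt k) = 2^-1 ^+ 3 * ev R (trp (ipt i) (ipt j) (ipt k)).
Proof. by rewrite -vev_triple -tripleZ. Qed.

Lemma ico_sum0 b : \sum_(v : vertex (poly b)) pos v = 0.
Proof.
have ha : ico_anti \in ico_anti :: ico_rotations by apply: mem_head.
have [s _ [sE _]] := ico_symmetry R b ha.
set S := \sum_v _; have : S = - S.
  rewrite {1}/S (reindex_inj (@perm_inj _ (vperm s))) /= -sumrN; apply: eq_bigr => v _.
  have e (w : vertex (poly b)) : pos (vperm s w) = - pos w.
    by rewrite (posE (vperm s w)) (posE w) sE ico_antipode ?code_lt.
  exact: e.
move/eqP; rewrite -addr_eq0 -mulr2n -scaler_nat scaler_eq0 pnatr_eq0 /= => /eqP; exact.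
Qed.

Lemma ico_vertex_set b : vertex_set (poly b) = [set x | exists2 i, (i < 30)%N & x = pt i].
Proof. by have [] := ico_poly_model R b. Qed.

Lemma ico_is_icosidodecahedron b : is_icosidodecahedron 1 (vertex_set (poly b)).
Proof.
exists id; first by split=> [|x y]; rewrite ?ltr01 ?mul1r.
rewrite image_id ico_vertex_set; apply/seteqP; split=> x /=.
  by move=> h; apply/unit_icosidodecahedronP; rewrite size_ico_pts.
by move/unit_icosidodecahedronP; rewrite size_ico_pts.
Qed.

Lemma isometry_perm b (g : 'rV[R]_3 -> 'rV[R]_3) : euclid_isometry g ->
  g @` vertex_set (poly b) = vertex_set (poly b) ->
  exists s : {perm vertex (poly b)}, (forall v, pos (s v) = g (pos v)) /\
    forall u v, icl (code (s u)) (code (s v)) = icl (code u) (code v).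
Proof.
move=> ig gS.
have h (v : vertex (poly b)) : exists w : vertex (poly b), pos w = g (pos v).
  have : vertex_set (poly b) (g (pos v)) by rewrite -gS; exists (pos v) => //; exists v.
  by case=> w _ e; exists w.
pose f (v : vertex (poly b)) := projT1 (cid (h v)).
have fE v : pos (f v) = g (pos v) by rewrite /f; case: cid.
have fi : injective f.
  move=> u v e; apply: (@pos_inj _ (poly b)); apply: (isometry_inj (isometry_similarity ig)).
  by rewrite -!fE e.
exists (perm fi); split=> [v|u v]; first by rewrite permE.
apply/(ico_pt_dist R); rewrite ?code_lt // -!posE.
by rewrite !permE !fE ig.
Qed.

(* A rotation permuting the vertices fixes their centroid 0, hence is linear. *)
Lemma rotation_linear b (g : 'rV[R]_3 -> 'rV[R]_3) : rotation_of (vertex_set (poly b)) g ->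
  exists2 A : 'M[R]_3, \det A = 1 & forall x, g x = x *m A.
Proof.
move=> [dg gS]; have [s [sE _]] := isometry_perm (direct_isometry_isometry dg) gS.
have [A [c [_ dA gE]]] := dg; exists A => // x; rewrite gE.
have : \sum_(v : vertex (poly b)) pos (s v) = 0.
  by rewrite -[RHS](ico_sum0 b) [RHS](reindex_inj (@perm_inj _ s)).
rewrite (eq_bigr (fun v => pos v *m A + c)); last by move=> v _; rewrite sE gE.
have lin0 : \sum_(v : vertex (poly b)) pos v *m A = 0.
  by rewrite -mulmx_suml ico_sum0; exact: mul0mx.
rewrite big_split /= lin0 add0r sumr_const -scaler_nat => /eqP.
rewrite scaler_eq0 pnatr_eq0 => /orP[/eqP c0|/eqP->]; last by rewrite addr0.
by have := etrans (esym c0) (card_ord 30).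
Qed.

Lemma symmetry_rotation b g : symmetry (poly b) g -> direct_isometry g -> rotation_of (vertex_set (poly b)) g.
Proof. by move=> [_ [gS _ _]]. Qed.

Lemma ico_not_swapped b : exists u v : vertex (poly b), joined u v /\
  ~ exists g, [/\ symmetry (poly b) g, direct_isometry g, g (pos u) = pos v & g (pos v) = pos u].
Proof.
have [u cu] := code_surj R b (isT : (7 < 30)%N); have [v cv] := code_surj R b (isT : (0 < 30)%N).
exists u, v; split; first by rewrite ico_joined cu cv.
move=> [g [Sg dg gu gv]]; have rg := symmetry_rotation Sg dg.
have [A dA gE] := rotation_linear rg.
have [s [sE sc]] := isometry_perm (direct_isometry_isometry dg) rg.2.
have su : s u = v by apply: (@pos_inj _ (poly b)); rewrite sE.
have sv : s v = u by apply: (@pos_inj _ (poly b)); rewrite sE.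
have /hasP[k + /all_iota h] := no_swap_ok; rewrite mem_iota => /andP[_ k30].
have [w cw] := code_surj R b k30.
have := h _ (code_lt (s w)); rewrite -cw.
have := sc u w; have := sc v w; rewrite su sv cu cv => -> ->; rewrite !eqxx /=.
have e : ev R (trp (ipt 0) (ipt 7) (ipt (code (s w)))) = ev R (trp (ipt 7) (ipt 0) (ipt (code w))).
  have nz : 2^-1 ^+ 3 != 0 :> R by rewrite expf_neq0 // invr_eq0 pnatr_eq0.
  have e0 : triple (pt (code (s u))) (pt (code (s v))) (pt (code (s w))) =
      triple (pt (code u)) (pt (code v)) (pt (code w)).
    by rewrite -!posE !sE !gE triple_mx dA mul1r.
  rewrite su sv cu cv !ico_pt_triple in e0; exact: mulfI nz _ _ e0.
by case/orP=> /(ev_pos R); rewrite evB e subrr ltxx.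
Qed.

Lemma ico_edge_length u v : (u < 30)%N -> (v < 30)%N -> icl u v = 2%N -> dist (pt u) (pt v) = golden R.
Proof.
move=> hu hv c; have g0 : 0 <= golden R by have /andP[] := golden_bounds R; lra.
apply/eqP; rewrite -(@eqrXn2 _ 2) ?dist_ge0 // golden_sqr.
have := pt_dist2 (R := R) 2^-1 ico_points_ok; rewrite size_ico_pts => /(_ u v hu hv) ->.
have e0 : ev R (nth zt0 ico_vals 0) = 4 + 4 * golden R by rewrite evE.
have e2 : ev R (nth zt0 ico_vals 2) = 2 + 2 * golden R by rewrite evE.
by rewrite c e0 e2; apply/eqP; field.
Qed.

Lemma diagonal_path_ge (S : set 'rV[R]_3) x y l : diagonal_path S x y l -> dist x y <= l.
Proof.
elim=> [z|a c z k _ _ IH]; first by rewrite distxx.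
by apply: le_trans (dist_triangle a c z) _; rewrite lerD2l.
Qed.

(** Subtracting a row keeps the determinant, so [x], [y - x] and [z - x] span the space, and the
    last two must contribute rank 2. *)
Lemma row_free_triple (x y z : 'rV[R]_3) : triple x y z != 0 -> row_free (col_mx (y - x) (z - x)).
Proof.
move=> t0; have : triple x (y - x) (z - x) != 0.
  by apply: contra_neq t0 => <-; rewrite !tripleE !mxE; ring.
rewrite /triple -unitfE -[_ \is a GRing.unit]/(_ \in unitmx) -row_free_unit => /eqP rk.
rewrite /row_free eqn_leq rank_leq_row /=.
have := mxrank_adds_leqif x (col_mx (y - x) (z - x)); case=> + _.
rewrite addsmxE => h; have h3 := leq_trans (eq_leq (esym rk)) h.
by rewrite -(leq_add2l 1); apply: (leq_trans h3); exact: leq_add (rank_leq_row x) (leqnn _).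
Qed.

Lemma ico_hull_face b s : hull_ok s ->
  exists F, hull_face (vertex_set (poly b)) F /\ forall k, k \in s -> F (pt k).
Proof.
move=> /and5P[/andP[h0 /allP heq] /all_iota hlt /allP s30 s2 tr].
pose n := vev R (face_normal s); pose c := dotmul n (pt (head 0%N s)).
have dE k : dotmul n (pt k) = 2^-1 * ev R (ip (face_normal s) (ipt k)).
  by rewrite ico_pt_vev dotmulZr vev_dot.
have eqc k : k \in s -> dotmul n (pt k) = c by move=> /heq/(ev_eq R) e; rewrite /c !dE e.
have inF k : k \in s -> (vertex_set (poly b) `&` [set x | dotmul n x = c]) (pt k).
  move=> ks; split; last exact: eqc.
  by rewrite ico_vertex_set; exists k => //; apply: s30.
exists (vertex_set (poly b) `&` [set x | dotmul n x = c]); split; last exact: inF.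
have cyc_in k : cyc s k \in s by rewrite /cyc mem_nth // ltn_mod (leq_trans _ s2).
exists n, c; split=> //.
- move=> n0; have : 0 < c by rewrite /c dE mulr_gt0 ?invr_gt0 ?ltr0n //; exact: ev_pos.
  by rewrite /c n0 -(scale0r (0 : 'rV[R]_3)) dotmulZl mul0r ltxx.
- move=> x; rewrite ico_vertex_set => -[k k30 ->].
  have /orP[/eqc->//|/(ev_pos R)] := hlt k k30; rewrite evB subr_gt0 => h.
  by rewrite /c !dE ler_pM2l ?invr_gt0 ?ltr0n // ltW.
exists (pt (cyc s 0)), (pt (cyc s 1)), (pt (cyc s 2)); split; try exact: inF.
apply: row_free_triple; rewrite ico_pt_triple mulf_neq0 ?expf_neq0 ?invr_eq0 ?pnatr_eq0 //.
by case/orP: tr => /(ev_pos R); rewrite ?evN ?oppr_gt0; [move/gt_eqF-> | move/lt_eqF->].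
Qed.

(** An edge is a diagonal of a single face of S, hence a path of one step, and by the triangle
    inequality no path is shorter than the straight segment. *)
Lemma ico_edges_length b : edges_have_length 1 (poly b) (golden R).
Proof.
move=> u v uv; have c : icl (code u) (code v) = 2%N by apply/eqP; rewrite -ico_joined.
have d := ico_edge_length (code_lt u) (code_lt v) c; rewrite mul1r; split; last first.
  by move=> l /diagonal_path_ge; rewrite !posE d.
rewrite -d -[dist _ _]addr0 -!posE; apply: diagonal_cons; last exact: diagonal_nil.
split; first by move/(@pos_inj _ (poly b)) => e; have /joinedP[] := uv.
have /all_iota/(_ _ (code_lt u))/all_iota/(_ _ (code_lt v)) := edge_hull_ok.
rewrite c eqxx => /hasP[s sp /andP[us vs]].
have [F [hF FE]] := ico_hull_face b (allP pentagram_hull_ok s sp).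
by exists F; split; [exact: hF | exact: FE | exact: FE].
Qed.

Lemma ico_directed_type b : directed_type 1 (poly b).
Proof.
split; [exact: ico_index2 | exact: ico_vertex_transitive | | exact: ico_not_swapped].
by exists (golden R); exact: ico_edges_length.
Qed.

Lemma face_sizeP b s : s \in faces b -> size s = face_size b /\ uniq s.
Proof.
by move=> sb; have /allP/(_ b (mem_bools b))/allP/(_ s sb)/andP[/eqP] := face_sizes_ok.
Qed.

Lemma poly_points (p : nat -> 'rV[R]_3) (s : seq nat) x : (0 < size s)%N ->
  (exists2 A, face_cycle p s A & A x) <-> exists2 k, (k < size s)%N & x = p (nth 0%N s k).
Proof.
move=> s0; have ck k : cyc s k = nth 0%N s (k %% size s) by [].
split=> [[_ [k hk ->] [->|->]]|[k hk ->]].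
- by exists (k %% size s)%N; rewrite ?ltn_mod.
- by exists (k.+1 %% size s)%N; rewrite ?ltn_mod.
exists [set p (cyc s k); p (cyc s k.+1)]; first by exists k.
by left; rewrite ck modn_small.
Qed.

(** The image of a pentagon would be a hexagon of the other polyhedron, whose six distinct vertices
    would come from five. *)
Lemma ico_not_similar : ~ similar_polyhedra (poly false) (poly true).
Proof.
move=> [c [g [sg [_ _ gP]]]].
have [_ _ fP] := ico_poly_model R false; have [_ _ fQ] := ico_poly_model R true.
pose s := nth [::] (faces false) 0.
have sF : s \in faces false by [].
have : polygons (poly true) (polygon_image g (face_cycle pt s)).
  by rewrite -gP; exists (face_cycle pt s) => //; rewrite fP; exists s.
rewrite fQ => -[t tF tE].
have [s5 us] := face_sizeP sF; have [t6 ut] := face_sizeP tF.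
have hl (l : 'I_6) : exists k : 'I_5, pt (nth 0%N t l) = g (pt (nth 0%N s k)).
  have [A At Ax] : exists2 A, face_cycle pt t A & A (pt (nth 0%N t l)).
    by apply/poly_points; rewrite t6 //; exists (val l); rewrite ?t6 ?ltn_ord.
  rewrite -tE in At; case: At Ax => B Bs <- [x Bx xE].
  have s0 : (0 < size s)%N by rewrite s5.
  have [k hk xk] := (poly_points pt x s0).1 (ex_intro2 _ _ B Bs Bx).
  by rewrite s5 in hk; exists (Ordinal hk); rewrite -xE xk.
pose h (l : 'I_6) := projT1 (cid (hl l)); have hE (l : 'I_6) : pt (nth 0%N t l) = g (pt (nth 0%N s (h l))) by rewrite /h; case: cid.
have td : t \in directed_faces true by rewrite mem_cat tF.
have [_ tlt _ _] := directed_faceP td.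
have hi : injective h.
  move=> l m e; apply/val_inj/eqP; rewrite -(nth_uniq 0%N _ _ ut) ?t6 ?ltn_ord //.
  apply/eqP/(ico_pt_inj (R := R)).
  - by have := tlt l; rewrite /cyc t6 modn_small ?ltn_ord.
  - by have := tlt m; rewrite /cyc t6 modn_small ?ltn_ord.
  by rewrite !hE e.
by have := leq_card h hi; rewrite !card_ord.
Qed.
End Metric.

(** * Genus, orientability and planarity *)

Section Topology.
Variable R : realType.
Notation P := (ico_poly R false).
Notation Q := (ico_poly R true).

Lemma pent_orientable : orientable P.
Proof.
exists (fun v e f => orient (val (v : 'I_30)) (val (e : 'I_(size ico_edges))) (val (f : 'I_(size pent_faces)))).
split.
- move=> u v e f /andP[ue _] /andP[ve_ _] uv.
  have uv' : val (u : 'I_30) != val (v : 'I_30) by apply/eqP => /val_inj.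
  have /all_iota/(_ (val (e : 'I_(size ico_edges))) (ltn_ord (e : 'I_(size ico_edges)))) := orient_edge_ok.
  move=> /all_ord/(_ (u : 'I_30))/all_ord/(_ (v : 'I_30))/implyP h.
  have : orient (val (u : 'I_30)) (val (e : 'I_(size ico_edges))) 0 != orient (val (v : 'I_30)) (val (e : 'I_(size ico_edges))) 0.
    by apply: h; apply/and3P; split; [exact: ue | exact: ve_ | exact: uv'].
  by rewrite /orient !addbT => /eqP h1 h2; apply: h1; move: h2; do 2 case: (_ == _); case: (_ < _).
- move=> v d e f /andP[vd df] /andP[vE ef_] de.
  have de' : val (d : 'I_(size ico_edges)) != val (e : 'I_(size ico_edges)) by apply/eqP => /val_inj.
  have mem (x : edge P) : ve v x -> val (x : 'I_(size ico_edges)) \in edges_at 30 ico_edges (val (v : 'I_30)).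
    by move=> vx; rewrite mem_filter; apply/andP; split; [exact: vx | rewrite mem_iota; exact: ltn_ord].
  have /all_ord/(_ (v : 'I_30))/all_ord/(_ (f : 'I_(size pent_faces)))/allP/(_ _ (mem d vd))/allP/(_ _ (mem e vE))/implyP h := orient_face_ok.
  by apply/eqP; apply: h; apply/and3P; split; [exact: df | exact: ef_ | exact: de'].
- move=> v e f g /andP[_ eF] /andP[_ eG] fg.
  have fg' : val (f : 'I_(size pent_faces)) != val (g : 'I_(size pent_faces)) by apply/eqP => /val_inj.
  have /all_ord/(_ (e : 'I_(size ico_edges)))/all_ord/(_ (f : 'I_(size pent_faces)))/all_ord/(_ (g : 'I_(size pent_faces)))/implyP h := orient_side_ok.
  have : (val (f : 'I_(size pent_faces)) < 12) != (val (g : 'I_(size pent_faces)) < 12).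
    by apply: h; apply/and3P; split; [exact: eF | exact: eG | exact: fg'].
  by rewrite /orient => /eqP h1 h2; apply: h1; move/addbI: h2.
Qed.

Lemma ico_euler b : euler_characteristic (ico_poly R b) = (30 - 60 + (nF b)%:Z)%R.
Proof. by rewrite /euler_characteristic !card_ord. Qed.

Lemma pent_genus : orientable_genus P 4.
Proof. by split; [exact: pent_orientable | rewrite ico_euler]. Qed.

Lemma hex_flag_decode x : x \in hex_flags -> exists v e f, flag v e f /\ @fcode R true (v, e, f) = x.
Proof. by rewrite -hex_flagsE; apply: flags_decode. Qed.

(** The three conditions on an orientation say that its value changes whenever exactly one member of
    a flag is exchanged; a closed walk of odd length through adjacent flags contradicts this. *)
Lemma hex_not_orientable : ~ orientable Q.
Proof.
move=> [o [o1 o2 o3]].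
have [v0 [e0 [f0 [h0 c0]]]] := hex_flag_decode hex_flag0_in.
pose Pr (x : nat * nat * nat * bool) := exists v e f,
  [/\ flag v e f, fcode (v, e, f) = x.1 & o v e f = o v0 e0 f0 (+) x.2].
have [v [e [f [_ cE oE]]]] : Pr (hex_flag0, true).
  apply: (reachP (Pr := Pr) _ _ hex_odd_ok).
    by exists v0, e0, f0; split; [exact: h0 | exact: c0 | rewrite addbF].
  move=> [x p] [y q] [v [e [f [hf cf of_]]]] /mapP[z]; rewrite mem_filter => /andP[adj zf] [-> ->].
  have [v' [e' [f' [hf' cf']]]] := hex_flag_decode zf.
  exists v', e', f'; split; [exact: hf' | exact: cf' |].
  have flip (a c : bool) : a <> c -> a = ~~ c by case: a; case: c.
  rewrite /= addbN -of_; apply: flip; move: adj; rewrite -cf -cf' /adjacent_flags /= !xpair_eqE.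
  case/or3P=> [/andP[/andP[/eqP/val_inj vv /eqP/val_inj ee] /eqP ff]|/andP[/andP[/eqP/val_inj vv /eqP ee] /eqP/val_inj ff]|/andP[/andP[/eqP vv /eqP/val_inj ee] /eqP/val_inj ff]]; subst.
  - by apply: o3 => // ffe; apply: ff; rewrite ffe.
  - by apply: o2 => // eee; apply: ee; rewrite eee.
  - by apply: o1 => // vve; apply: vv; rewrite vve.
have /fcode_inj[e1 e2 e3] : fcode (v, e, f) = fcode (v0, e0, f0) by rewrite c0; exact: cE.
by move: oE; rewrite e1 e2 e3; case: (o v0 e0 f0).
Qed.

Lemma hex_genus : nonorientable_genus Q 12.
Proof. by split; [exact: hex_not_orientable | rewrite ico_euler]. Qed.

Lemma pent_planar (f : face P) : planar_face f.
Proof.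
have fi : nth [::] pent_faces (f : 'I_(size pent_faces)) \in pent_faces by rewrite mem_nth.
have /andP[h0 /allP heq] := allP pent_planar_ok _ fi.
set s := nth _ _ _ in h0 heq; pose n := vev R (face_normal s).
have dE k : dotmul n (ico_pt R k) = (2^-1 * ev R (ip (face_normal s) (ipt k)))%R.
  by rewrite ico_pt_vev dotmulZr vev_dot.
exists n, (dotmul n (ico_pt R (head 0 s))); split.
  move=> n0; have := ev_pos R h0; rewrite -vev_dot -/n n0 -(scale0r (0 : 'rV[R]_3)) dotmulZl mul0r ltxx //.
move=> v e /andP[vE ef_]; have vs : code v \in s.
  by have vE' : (code v == _) || (code v == _) := vE; case/andP: (ef_ : pef _ _) => h1 h2; case/orP: vE' => /eqP ->.
by rewrite posE !dE (ev_eq R (heq _ vs)).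
Qed.
End Topology.

(** * Orbits of faces and directed edges, and the shapes of faces *)

Lemma window_of_faces_ok : all (fun b => all (fun s => all (fun i =>
  window b (cyc s i) (cyc s i.+1) (cyc s i.+2) (cyc s (i + 3))) (iota 0 (size s))) (faces b)) bools.
Proof. vm_cast_no_check (erefl true). Qed.

Lemma face_window_ok : all (fun b => all (fun s => all (fun v => all (fun x => all (fun y => all (fun z =>
  [&& x \in s, v \in s, y \in s, z \in s, x != y & v != z] ==> window b x v y z)
  (adjacents y)) (adjacents v)) (adjacents v)) s) (faces b)) bools.
Proof. vm_cast_no_check (erefl true). Qed.

(** The class of two vertices two steps apart on a pentagonal face is 5 for convex pentagons and 1
    for pentagrams. Isometries preserve it, which keeps the two orbits of faces apart. *)
Lemma face_kind_ok : all (fun b => all (fun s => all (fun t => same_poly s t ==>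
  (icl (cyc s 0) (cyc s 2) == icl (cyc t 0) (cyc t 2)) || b) (faces b)) (directed_faces b)) bools &&
  all (fun f => let s := nth [::] pent_faces f in
    all (fun i => icl (cyc s i) (cyc s i.+2) == if f < 12 then 5 else 1) (iota 0 5)) (iota 0 24) &&
  all (fun s => all (fun i => icl (cyc s i) (cyc s i.+2) == icl (cyc s 0) (cyc s 2)) (iota 0 5))
    (directed_faces false).
Proof. vm_cast_no_check (erefl true). Qed.

Lemma edge_orbit_ok : let r := reach (fun p : nat * nat =>
    [seq (nth 0 g p.1, nth 0 g p.2) | g <- ico_rotations]) (30 * 30) (7, 0) in
  all (fun p => p \in r) ico_edges.
Proof. vm_cast_no_check (erefl true). Qed.

Lemma edges_oriented_ok : all (fun i => all (fun j => (icl i j == 2) ==>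
  ((i, j) \in ico_edges) || ((j, i) \in ico_edges)) (iota 0 30)) (iota 0 30) &&
  all (fun p : nat * nat => [&& p.1 < 30, p.2 < 30 & icl p.1 p.2 == 2]) ico_edges.
Proof. vm_cast_no_check (erefl true). Qed.

Notation face_orbit_list b f0 :=
  (reach (fun f => [seq face_image (faces b) g f | g <- ico_rotations]) (30 * 30) f0).

Lemma face_orbit_ok :
  (let r := face_orbit_list false 0 in all (fun f => f \in r) (iota 0 12)) &&
  (let r := face_orbit_list false 12 in all (fun f => f \in r) (iota 12 12)) &&
  (let r := face_orbit_list true 0 in all (fun f => f \in r) (iota 0 20)).
Proof. vm_cast_no_check (erefl true). Qed.

Definition turn_sign (v x y : nat) : bool :=
  ztpos (trp (ipt v) (vtB (ipt x) (ipt v)) (vtB (ipt y) (ipt v))).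
Definition turn_ccw (v x y z : nat) : bool :=
  2 <= turn_sign v x y + turn_sign v y z + turn_sign v z x.
Definition turn_rank (u v w : nat) : nat :=
  count (fun x => (icl v x == 2) && turn_ccw v u x w) (iota 0 30).
(** Two rounds are tested, since after one round of odd length the parity of the step has
    changed. *)
Definition shape_ok (a c : nat) (s : seq nat) : bool :=
  all (fun i => turn_rank (cyc s i) (cyc s i.+1) (cyc s i.+2) == if odd i then c else a)
    (iota 0 (size s).*2).

(** [ztpos] answering true is a proof of positivity, but answering false is not a refutation.
    Certifying one of the three signs in each case makes [turn_sign] exact. *)
Lemma turn_sign_ok : all (fun v => all (fun x => all (fun y =>
  let t := trp (ipt v) (vtB (ipt x) (ipt v)) (vtB (ipt y) (ipt v)) in
  [|| ztpos t, ztpos (ztN t) | zteq t zt0]) (adjacents v)) (adjacents v)) (iota 0 30).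
Proof. vm_cast_no_check (erefl true). Qed.

Definition convex_ok (n : vt) (s : seq nat) : bool :=
  all (fun i => zteq (ip n (ipt (cyc s i))) (ip n (ipt (cyc s 0))) && all (fun j =>
    (cyc s j != cyc s i) && (cyc s j != cyc s i.+1) ==>
    ztpos (trp n (vtB (ipt (cyc s i.+1)) (ipt (cyc s i))) (vtB (ipt (cyc s j)) (ipt (cyc s i)))))
    (iota 0 (size s))) (iota 0 (size s)).

Definition doubled (s : seq nat) : seq nat := [seq cyc s i.*2 | i <- iota 0 5].

Definition regular5_ok (s : seq nat) : bool :=
  all (fun i => (icl (cyc s i) (cyc s i.+1) == icl (cyc s 0) (cyc s 1)) &&
                (icl (cyc s i) (cyc s i.+2) == icl (cyc s 0) (cyc s 2))) (iota 0 5).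

(** The sense in which a listed face runs around its outward normal varies, so both signs are
    tried. *)
Definition some_normal (P : vt -> bool) (s : seq nat) : bool :=
  P (face_normal s) || P (vtB vt0 (face_normal s)).

Lemma pent_shape_ok : all (fun s => [&& (cyc s 0, cyc s 1) \in ico_edges, shape_ok 0 0 s &
    some_normal (fun n => convex_ok n s) s]) (take 12 pent_faces) &&
  all (fun s => [&& (cyc s 0, cyc s 1) \in ico_edges, shape_ok 2 2 s, size s == 5,
    some_normal (fun n => convex_ok n (doubled s)) s & regular5_ok (doubled s)]) (drop 12 pent_faces).
Proof. vm_cast_no_check (erefl true). Qed.

(** The shape [r,l,r,l] has period 2 and a hexagon even length, so only the direction of traversal
    and the parity of the starting vertex matter. *)
Definition turns (s : seq nat) := [:: s; rot 1 s; rev s; rot 1 (rev s)].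

(** The first conjunct finds four vertices of the hexagon that are not coplanar. The other two
    provide a starting edge in each of the two orbits of directed edges, namely [ico_edges] and the
    reversed pairs. *)
Lemma hex_shape_ok : all (fun s =>
  let x := trp (vtB (ipt (cyc s 1)) (ipt (cyc s 0))) (vtB (ipt (cyc s 2)) (ipt (cyc s 0)))
               (vtB (ipt (cyc s 3)) (ipt (cyc s 0))) in
  [&& ztpos x || ztpos (ztN x),
   has (fun t => ((cyc t 0, cyc t 1) \in ico_edges) && shape_ok 0 2 t) (turns s) &
   has (fun t => ((cyc t 1, cyc t 0) \in ico_edges) && shape_ok 0 2 t) (turns s)]) hex_faces.
Proof. vm_cast_no_check (erefl true). Qed.

Lemma turns_walk_ok : all (fun b => all (fun s => all (fun t => all (fun i =>
  [&& cyc t i < 30, cyc t i != cyc t i.+2 & icl (cyc t i) (cyc t i.+1) == 2] &&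
  (cyc t i \in s)) (iota 0 (size t)) && (0 < size t)) (turns s)) (faces b)) bools.
Proof. vm_cast_no_check (erefl true). Qed.

Lemma window_faces b s i : s \in faces b ->
  window b (cyc s i) (cyc s i.+1) (cyc s i.+2) (cyc s i.+3).
Proof.
move=> sb; have hs : s \in directed_faces b by rewrite mem_cat sb.
have [s0 _ _ _] := directed_faceP hs.
have /allP/(_ b (mem_bools b))/allP/(_ s sb)/all_iota/(_ _ (ltn_pmod i s0)) := window_of_faces_ok.
by rewrite cyc_mod -[(i %% _).+2]addn2 -[(i %% _).+1]addn1 !cyc_add addn1 addn2 addn3.
Qed.

(** The first corner occurs in a listed face, and from there on each window leaves only one
    choice. *)
Lemma walk_of_windows b (w : nat -> nat) : (forall k, w k < 30) ->
  (forall k, window b (w k) (w k.+1) (w k.+2) (w k.+3)) ->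
  exists2 s, s \in directed_faces b & exists i, forall k, w k = cyc s (i + k).
Proof.
move=> wlt win; have /and3P[c0 _ _] := win 0.
have [s hs [i [e0 e1 e2]]] := corner_faceP b (wlt 0) (wlt 1) (wlt 2) c0.
have [_ _ _ snext] := directed_faceP hs.
exists s => //; exists i => k.
suff [] : [/\ w k = cyc s (i + k), w k.+1 = cyc s (i + k).+1 & w k.+2 = cyc s (i + k).+2] by [].
elim: k => [|k [h0 h1 h2]]; first by rewrite addn0 e0 e1 e2.
rewrite addnS; split=> //; apply: snext; first exact: wlt.
by rewrite -h0 -h1 -h2.
Qed.

Lemma poly_walk (R : realType) (p : nat -> 'rV[R]_3) s (w : nat -> nat) i : 0 < size s ->
  (forall k, w k = cyc s (i + k)) ->
  face_cycle p s = [set A | exists k, A = [set p (w k); p (w k.+1)]].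
Proof.
move=> s0 wE; apply/seteqP; split=> A.
  move=> [k _ ->]; exists (k + i * size s - i); rewrite !wE addnS subnKC; last first.
    by rewrite (leq_trans _ (leq_addl _ _)) // leq_pmulr.
  by rewrite /cyc -addSn !(addnC _ (i * _)) !modnMDl.
move=> [k ->]; exists ((i + k) %% size s); first by rewrite ltn_mod.
by rewrite !wE addnS cyc_mod -[(_ %% _).+1]addn1 cyc_add addn1.
Qed.

Section General.
Variables (R : realType) (X : polyhedron R).

Lemma segment_inj : injective (@segment R X).
Proof.
have key e v : ve v e <-> segment e (@pos R X v).
  by split=> [h|[w /= we /(@pos_inj _ X) <-] //]; exists v.
move=> e d h; apply: (@edge_inj _ X); apply/setP => v; rewrite !inE.
by apply/idP/idP => /key; [rewrite h | rewrite -h] => /key.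
Qed.

Lemma polygon_inj : injective (@polygon R X).
Proof.
have key f e : ef e f <-> polygon f (@segment R X e).
  by split=> [h|[w /= we /segment_inj <-] //]; exists e.
move=> f g h; apply: (@face_inj _ X); apply/setP => v; rewrite !inE.
by apply/idP/idP => /key; [rewrite h | rewrite -h] => /key.
Qed.

Lemma rotation_of_comp (S : set 'rV[R]_3) g h : rotation_of S g -> rotation_of S h -> rotation_of S (h \o g).
Proof.
move=> [dg gS] [dh hS]; split; first exact: direct_isometry_comp.
by rewrite -image_comp gS hS.
Qed.

Lemma rotation_of_inverse (S : set 'rV[R]_3) g : rotation_of S g ->
  exists h, [/\ rotation_of S h, cancel g h & cancel h g].
Proof.
move=> [dg gS]; have [h [dh gK hK]] := direct_isometry_inverse dg; exists h; split=> //.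
split=> //; rewrite -{1}gS image_comp -[RHS]image_id; apply: eq_imagel => x _.
exact: gK.
Qed.

Lemma rotation_of_id (S : set 'rV[R]_3) : rotation_of S id.
Proof.
split; last by rewrite image_id.
by exists 1%:M%R, 0%R; split; rewrite ?trmx1 ?mul1mx ?det1 // => x; rewrite mulmx1 addr0.
Qed.
End General.

Section Orbits.
Variables (R : realType) (b : bool).
Notation P := (ico_poly R b).
Notation V := (vertex P).
Notation pt := (@ico_pt R).
Notation S := (vertex_set P).

Definition face_list (f : face P) : seq nat := nth [::] (faces b) (val (f : 'I_(nF b))).

Lemma face_list_in f : face_list f \in faces b.
Proof. exact: (mem_nth [::] (ltn_ord (f : 'I_(nF b)))). Qed.

Lemma face_list_directed f : face_list f \in directed_faces b.
Proof. by rewrite mem_cat face_list_in. Qed.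

Lemma polygon_list f : polygon f = face_cycle pt (face_list f).
Proof.
exact: (coded_polygon (@code_inj R b) (@code_surj R b) (@posE R b) (@ico_joined R b)
  (face_list_directed f) (@ico_face_coded R b f)).
Qed.

Lemma face_of_list s : s \in faces b -> exists f : face P, face_list f = s.
Proof.
move=> sb; have hi : index s (faces b) < nF b by rewrite index_mem.
by exists (Ordinal hi : face P); rewrite /face_list /= nth_index.
Qed.

(** Rotations preserve classes, hence windows, so the image of a face is again a walk of windows and
    follows a listed face. *)
Lemma rotation_image_face g s : rotation_of S g -> s \in faces b ->
  exists2 t, t \in faces b & polygon_image g (face_cycle pt s) = face_cycle pt t /\
    (icl (cyc t 0) (cyc t 2) = icl (cyc s 0) (cyc s 2) \/ b).
Proof.
move=> rg sb; have [sg [sE sc]] := isometry_perm (direct_isometry_isometry rg.1) rg.2.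
have hs : s \in directed_faces b by rewrite mem_cat sb.
have [s0 slt _ _] := directed_faceP hs.
have [v0 _] := @code_surj R b 0 isT.
pose l k : V := decode_at (@code R b) v0 (cyc s k).
have lK k : code (l k) = cyc s k by apply: decode_atK; [exact: code_surj | exact: slt].
pose w k := code (sg (l k)).
have wc i j : icl (w i) (w j) = icl (cyc s i) (cyc s j) by rewrite /w sc !lK.
have wP k : pt (w k) = g (pt (cyc s k)) by rewrite -lK -!posE sE.
have win k : window b (w k) (w k.+1) (w k.+2) (w k.+3).
  by rewrite /window /corner !wc; exact: window_faces.
have [t' ht' [i tE]] := walk_of_windows (fun k => code_lt (sg (l k))) win.
have {}tE k : w k = cyc t' (i + k) := tE k.
have [t0 _ _ _] := directed_faceP ht'.
have /allP/(_ b (mem_bools b))/allP/(_ t' ht')/hasP[t tb st] := same_poly_ok.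
exists t => //; split.
  rewrite -(same_polyP pt st) (poly_walk pt t0 tE); apply/seteqP; split=> A.
    by move=> [_ [k _ ->] <-]; exists k; rewrite image_setU !image_set1 !wP.
  move=> [k ->]; exists [set pt (cyc s k); pt (cyc s k.+1)]; last by rewrite image_setU !image_set1 !wP.
  exists (k %% size s); first by rewrite ltn_mod.
  by rewrite cyc_mod -[(_ %% _).+1]addn1 cyc_add addn1.
have [hb|hb] := boolP b; [by right | left].
have /andP[/andP[/allP/(_ b (mem_bools b))/allP/(_ t' ht')/allP/(_ t tb) k1 _] /allP k3] := face_kind_ok.
move: k1; rewrite st (negbTE hb) orbF /= => /eqP <-; rewrite -wc !tE addn0.
have t'f : t' \in directed_faces false by rewrite -(negbTE hb).
have /all_iota/(_ (i %% 5)) := k3 _ t'f; rewrite ltn_mod => /(_ isT).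
have t5 : size t' = 5.
  move: t'f; rewrite mem_cat => /orP[/face_sizeP[]//|/mapP[u uf ->]].
  by rewrite size_rev; case: (face_sizeP uf).
by rewrite -{1 2}t5 cyc_mod -[(_ %% _).+2]addn2 cyc_add addn2 => /eqP.
Qed.

Lemma rotation_step g : g \in ico_rotations -> exists h, [/\ rotation_of S h,
  forall i, i < 30 -> h (pt i) = pt (nth 0 g i) &
  forall f : face P, exists2 f' : face P, val (f' : 'I_(nF b)) = face_image (faces b) g (val (f : 'I_(nF b))) &
    polygon_image h (polygon f) = polygon f'].
Proof.
move=> hg; have [h [s [dh sA hE [sv sf]]]] := ico_rotation R b hg.
exists h; split.
- by split; [exact: dh | case: (aut_maps_onto sA hE)].
- move=> i hi; have [v <-] := code_surj R b hi.
  by rewrite -sv -!posE; exact: hE.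
move=> f; exists (fperm s f); last exact: (aut_polygon sA hE).
have [v _] := @code_surj R b 0 isT; have [e _] := face_nonempty f.
by have /(congr1 snd) := sf (v, e, f).
Qed.

Lemma face_reach (f0 f : face P) :
  val (f : 'I_(nF b)) \in face_orbit_list b (val (f0 : 'I_(nF b))) ->
  exists2 g, rotation_of S g & polygon f = polygon_image g (polygon f0).
Proof.
pose Pr z := exists2 g, rotation_of S g & exists2 f1 : face P, val (f1 : 'I_(nF b)) = z &
  polygon f1 = polygon_image g (polygon f0).
move=> hr; suff [g rg [f1 /val_inj <- gE]] : Pr (val (f : 'I_(nF b))) by exists g.
apply: (reachP (Pr := Pr) _ _ hr).
  exists id; first exact: rotation_of_id.
  exists f0 => //; apply/seteqP; split=> A; first by move=> hA; exists A; rewrite ?image_id.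
  by move=> [B hB <-]; rewrite image_id.
move=> _ z [g rg [f1 <- fE]] /mapP[k hk ->]; have [h [rh _ hf]] := rotation_step hk.
exists (h \o g); first exact: rotation_of_comp.
have [f2 f2E p2] := hf f1; exists f2; first exact: f2E.
by rewrite -p2 fE polygon_image_comp.
Qed.

Lemma edge_reach i j : (i, j) \in ico_edges ->
  exists2 g, rotation_of S g & g (pt 7) = pt i /\ g (pt 0) = pt j.
Proof.
move=> hij; pose Pr (z : nat * nat) := [/\ z.1 < 30, z.2 < 30 &
  exists2 g, rotation_of S g & g (pt 7) = pt z.1 /\ g (pt 0) = pt z.2].
have hr := allP edge_orbit_ok _ hij.
suff [_ _ [g rg gE]] : Pr (i, j) by exists g.
apply: (reachP (Pr := Pr) _ _ hr).
  split; [exact: isT | exact: isT |].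
  by exists id; [exact: rotation_of_id | split; exact: erefl].
move=> x _ [x1 x2 [g rg [g1 g2]]] /mapP[k hk ->]; have [h [rh hE _]] := rotation_step hk.
have lt y : y < 30 -> nth 0 k y < 30.
  move=> hy; have [l hl ->] := ico_rotation_index hk.
  by have := half_entry_lt ico_points_ok; rewrite size_ico_pts; apply.
split; [exact: lt | exact: lt |].
exists (h \o g); first exact: rotation_of_comp.
by split; rewrite /= ?g1 ?g2 hE.
Qed.

Lemma pt_directed_edge i j : i < 30 -> j < 30 -> icl i j = 2 -> directed_edges P (pt i, pt j).
Proof.
move=> hi hj c; have [u cu] := code_surj R b hi; have [v cv] := code_surj R b hj.
by exists u, v; rewrite ico_joined !posE cu cv c.
Qed.

Lemma edge_orbit_directed i j : i < 30 -> j < 30 -> icl i j = 2 ->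
  directed_edge_orbit P [set d' | exists2 g, rotation_of S g & d' = (g (pt i), g (pt j))].
Proof.
move=> hi hj c; split; last by exists (pt i, pt j) => //; exact: pt_directed_edge.
move=> _ [g rg ->]; have [sg [sE sc]] := isometry_perm (direct_isometry_isometry rg.1) rg.2.
have [u cu] := code_surj R b hi; have [v cv] := code_surj R b hj.
rewrite -cu -cv -!posE -!sE !posE; apply: pt_directed_edge; rewrite ?code_lt //.
by rewrite sc cu cv.
Qed.

Lemma decode_exists : exists d : nat -> V, forall k, k < 30 -> code (d k) = k.
Proof.
have [v0 _] := @code_surj R b 0 isT; exists (decode_at (@code R b) v0) => k.
by apply: decode_atK; exact: code_surj.
Qed.

Lemma turns_walk (f : face P) t : t \in turns (face_list f) ->
  [/\ 0 < size t, forall i, cyc t i < 30, forall i, cyc t i != cyc t i.+2,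
      forall i, icl (cyc t i) (cyc t i.+1) = 2 & forall i, cyc t i \in face_list f].
Proof.
move=> ht; have /allP/(_ b (mem_bools b))/allP/(_ _ (face_list_in f))/allP/(_ t ht)/andP[/all_iota h t0] := turns_walk_ok.
have hh i : [&& cyc t i < 30, cyc t i != cyc t i.+2 & icl (cyc t i) (cyc t i.+1) == 2] && (cyc t i \in face_list f).
  have := h _ (ltn_pmod i t0).
  by rewrite cyc_mod -[(i %% _).+2]addn2 -[(i %% _).+1]addn1 !cyc_add addn1 addn2.
by split=> // i; case/andP: (hh i) => /and3P[? ? /eqP ?].
Qed.

Lemma face_walk_turn (f : face P) t (d : nat -> V) : (forall k, k < 30 -> code (d k) = k) ->
  t \in turns (face_list f) -> face_walk f (fun i => d (cyc t i)).
Proof.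
move=> dK /turns_walk[_ tlt t2 tc tf] i.
have ne m n : cyc t m != cyc t n -> d (cyc t m) <> d (cyc t n).
  by move=> h e; move: h; rewrite -(dK _ (tlt m)) -(dK _ (tlt n)) e eqxx.
have : joined (d (cyc t i)) (d (cyc t i.+1)) by rewrite ico_joined !dK ?tc.
move/joinedP => [uv [e ue vE]]; split; [exact: uv | exact: ne |].
exists e; split; [|exact: ue | exact: vE].
have h1 : cve 30 ico_edges (cyc t i) (val (e : 'I_(size ico_edges))) by rewrite -(dK _ (tlt i)); exact: ue.
have h2 : cve 30 ico_edges (cyc t i.+1) (val (e : 'I_(size ico_edges))) by rewrite -(dK _ (tlt i.+1)); exact: vE.
have n12 : cyc t i != cyc t i.+1 by apply/eqP => h; apply: uv; rewrite h.
suff : cef 30 ico_edges (faces b) (val (e : 'I_(size ico_edges))) (val (f : 'I_(nF b))) by [].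
move: h1 h2 n12 (tf i) (tf i.+1); rewrite /cve /cef -/(face_list f).
case/orP=> /eqP->; case/orP=> /eqP->; rewrite ?eqxx // => _ h h'; exact/andP.
Qed.

Lemma ico_centroid : centroid P = 0%R.
Proof. by rewrite /centroid ico_sum0 scaler0. Qed.

Lemma turn_sign_pos (v x y : V) : icl (code v) (code x) = 2 -> icl (code v) (code y) = 2 ->
  (0 < triple (pos v - 0) (pos x - pos v) (pos y - pos v))%R = turn_sign (code v) (code x) (code y).
Proof.
move=> vx vy; rewrite subr0 !posE !ico_pt_vev -!scalerBr -!vevB tripleZ vev_triple pmulr_rgt0; last first.
  by rewrite exprn_gt0 ?invr_gt0 ?ltr0n.
have adj (u : V) : icl (code v) (code u) = 2 -> code u \in adjacents (code v).
  by move=> h; rewrite mem_filter h eqxx mem_iota; exact: code_lt.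
have /all_iota/(_ _ (code_lt v))/allP/(_ _ (adj x vx))/allP/(_ _ (adj y vy)) := turn_sign_ok.
rewrite /turn_sign; case/or3P=> [h|h|h].
- by rewrite h (ev_pos R h).
- apply/idP/idP => [h'|/(ev_pos R)]; last by [].
  by have := ev_pos R h; rewrite evN oppr_gt0 => h2; have := lt_trans h' h2; rewrite ltxx.
- apply/idP/idP => [|/(ev_pos R)]; last by [].
  by rewrite (ev_eq R h) ev0 ltxx.
Qed.

Lemma turn_rankP (u v w : V) : icl (code v) (code u) = 2 -> icl (code v) (code w) = 2 ->
  #|[set x | joined v x && ccw v u x w]%SET| = turn_rank (code u) (code v) (code w).
Proof.
move=> vu vw; rewrite /turn_rank.
rewrite -(card_ord_set 30 (fun x => (icl (code v) x == 2) && turn_ccw (code v) (code u) x (code w))).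
apply: eq_card => x; rewrite !inE ico_joined; have [vx|//] := eqVneq (icl (code v) (code x)) 2.
by rewrite /= /ccw ico_centroid !turn_sign_pos.
Qed.

Lemma has_shape_turn (f : face P) t O a c : t \in turns (face_list f) ->
  O (pt (cyc t 0), pt (cyc t 1)) -> shape_ok (direction_rank a) (direction_rank c) t ->
  has_shape O f a c a c.
Proof.
move=> ht hO sh; have [d dK] := decode_exists; have [t0 tlt t2 tc tf] := turns_walk ht.
exists (fun i => d (cyc t i)); split; first exact: face_walk_turn.
  by rewrite !posE !dK.
move=> i; have fw := face_walk_turn dK ht i; split.
- by rewrite ico_joined !dK ?tc.
- by rewrite ico_joined !dK ?tc.
- by case: fw.
rewrite turn_rankP !dK // ?tc //; last by rewrite icl_sym ?tc.
have hs : 0 < (size t).*2 by rewrite double_gt0.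
have cm j : cyc t (i %% (size t).*2 + j) = cyc t (i + j).
  by rewrite /cyc -modnDml modn_dvdm ?modnDml // -mul2n dvdn_mull.
have /all_iota/(_ _ (ltn_pmod i hs))/eqP := sh.
rewrite -[(i %% _).+2]addn2 -[(i %% _).+1]addn1 -{1}[i %% _]addn0 !cm addn0 addn1 addn2 => ->.
have -> : odd (i %% (size t).*2) = odd i.
  by rewrite {2}(divn_eq i (size t).*2) oddD oddM odd_double andbF.
have -> : odd i = odd (i %% 4) by rewrite {1}(divn_eq i 4) oddD oddM andbF.
by have := ltn_pmod i (isT : 0 < 4); case: (i %% 4) => [|[|[|[|?]]]].
Qed.

Lemma convex_polygonP n s : 0 < size s -> (forall i, cyc s i < 30) -> convex_ok n s ->
  convex_polygon (fun i => pt (cyc s i)).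
Proof.
move=> s0 slt /all_iota h; have hh i : zteq (ip n (ipt (cyc s i))) (ip n (ipt (cyc s 0))) &&
    all (fun j => (cyc s j != cyc s i) && (cyc s j != cyc s i.+1) ==>
    ztpos (trp n (vtB (ipt (cyc s i.+1)) (ipt (cyc s i))) (vtB (ipt (cyc s j)) (ipt (cyc s i)))))
    (iota 0 (size s)).
  have := h _ (ltn_pmod i s0); rewrite cyc_mod -[(i %% _).+1]addn1 cyc_add addn1; exact.
exists (2^-1 *: vev R n)%R; split=> [i|i j ji ji1].
  rewrite !ico_pt_vev -scalerBr !(dotmulZl, dotmulZr) dotmulDr dotmulNr !vev_dot.
  by case/andP: (hh i) => /(ev_eq R) -> _; rewrite subrr !mulr0.
rewrite !ico_pt_vev -!scalerBr -!vevB tripleZ vev_triple mulr_gt0 ?exprn_gt0 ?invr_gt0 ?ltr0n //.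
case/andP: (hh i) => _ /all_iota/(_ _ (ltn_pmod j s0)); rewrite cyc_mod => /implyP h'.
apply: ev_pos; apply: h'; apply/andP; split; apply/eqP => e.
  by apply: ji; rewrite e.
by apply: ji1; rewrite e.
Qed.
End Orbits.

Section FaceOrbits.
Variables (R : realType) (b : bool).
Notation P := (ico_poly R b).
Notation pt := (@ico_pt R).
Notation S := (vertex_set P).

Definition orbit_of (f0 : face P) :=
  [set F' | exists2 g, rotation_of S g & F' = polygon_image g (polygon f0)].

Lemma orbit_face (f0 : face P) F : orbit_of f0 F -> exists2 f : face P, F = polygon f &
  (icl (cyc (face_list f) 0) (cyc (face_list f) 2) =
   icl (cyc (face_list f0) 0) (cyc (face_list f0) 2) \/ b).
Proof.
move=> [g rg ->]; have [t tb [e k]] := rotation_image_face rg (face_list_in f0).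
have [f fE] := face_of_list R tb; exists f; rewrite ?fE //.
by rewrite !polygon_list e fE.
Qed.

Lemma orbit_of_face_orbit (f0 : face P) : face_orbit P (orbit_of f0).
Proof.
split; last by exists (polygon f0) => //; exists f0.
by move=> F /orbit_face[f -> _]; exists f.
Qed.

Lemma polygon_orbit (f0 f : face P) :
  val (f : 'I_(nF b)) \in face_orbit_list b (val (f0 : 'I_(nF b))) -> orbit_of f0 (polygon f).
Proof. by move=> /face_reach[g rg e]; exists g. Qed.

Lemma polygon_orbit_refl (f0 : face P) : orbit_of f0 (polygon f0).
Proof.
exists id; first exact: rotation_of_id.
apply/seteqP; split=> A; first by move=> hA; exists A; rewrite ?image_id.
by move=> [B hB <-]; rewrite image_id.
Qed.

Lemma onF_list (f : face P) (x v : vertex P) : onF f x v ->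
  code x \in face_list f /\ code v \in face_list f.
Proof.
move=> [e [_ xe ve_ ef_]].
have h1 : cve 30 ico_edges (code x) (val (e : 'I_(size ico_edges))) by exact: xe.
have h2 : cve 30 ico_edges (code v) (val (e : 'I_(size ico_edges))) by exact: ve_.
have : cef 30 ico_edges (faces b) (val (e : 'I_(size ico_edges))) (val (f : 'I_(nF b))) by exact: ef_.
move: h1 h2; rewrite /cve /cef -/(face_list f).
by case/orP=> /eqP->; case/orP=> /eqP-> => /andP[].
Qed.

Lemma onF_adjacent (f : face P) (x v : vertex P) : onF f x v -> code v \in adjacents (code x).
Proof.
move=> /onF_joined; rewrite ico_joined => h; rewrite mem_filter h mem_iota; exact: code_lt.
Qed.

Lemma ico_window (f : face P) (x v y z : vertex P) : cornerF f x v y -> cornerF f v y z ->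
  window b (code x) (code v) (code y) (code z).
Proof.
move=> [xv vy xy] [_ yz vz].
have [xf vf] := onF_list xv; have [yf zf] := onF_list yz.
have /allP/(_ b (mem_bools b))/allP/(_ _ (face_list_in f))/allP/(_ _ vf) := face_window_ok.
move=> /allP/(_ _ (onF_adjacent (onF_sym xv)))/allP/(_ _ (onF_adjacent vy))/allP/(_ _ (onF_adjacent yz)).
by move/implyP; apply; rewrite xf vf yf zf !(inj_eq (@code_inj R b)) xy vz.
Qed.
End FaceOrbits.

(** * The pentagonal polyhedron: convex pentagons and pentagrams *)

Section Pentagonal.
Variable R : realType.
Notation P := (ico_poly R false).
Notation pt := (@ico_pt R).

Lemma pent_kind (f : face P) :
  icl (cyc (face_list f) 0) (cyc (face_list f) 2) = if val (f : 'I_24) < 12 then 5 else 1.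
Proof.
have /andP[/andP[_ /all_ord/(_ (f : 'I_24))/all_iota/(_ 0 isT)/eqP h] _] := face_kind_ok.
exact: h.
Qed.

Lemma ord_in_iota m n k (P : pred nat) (i : 'I_k) : all P (iota m n) -> m <= i < m + n -> P i.
Proof. by move=> /allP h hi; apply: h; rewrite mem_iota. Qed.

Lemma pent_convex_shape (O : set ('rV[R]_3 * 'rV[R]_3)) (f : face P) :
  (forall i j, (i, j) \in ico_edges -> O (pt i, pt j)) -> val (f : 'I_24) < 12 ->
  convex_face f /\ has_shape O f dir_r dir_r dir_r dir_r.
Proof.
move=> hO f12; have ft : face_list f \in take 12 pent_faces.
  by rewrite /face_list -(nth_take [::] f12); apply: mem_nth.
have /andP[/allP/(_ _ ft)/and3P[h0 hs hc] _] := pent_shape_ok.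
have st : face_list f \in turns (face_list f) by rewrite mem_head.
have [s0 slt _ _ _] := turns_walk st; have [d dK] := decode_exists R false.
split; last by apply: (has_shape_turn (a := dir_r) (c := dir_r) st _ hs); apply: hO.
exists (fun i => d (cyc (face_list f) i)); split; first exact: face_walk_turn.
have -> : (fun i => pos (d (cyc (face_list f) i))) = (fun i => pt (cyc (face_list f) i)).
  by apply: funext => i; rewrite posE dK.
by case/orP: hc; apply: convex_polygonP.
Qed.

Lemma pent_pentagram_shape (O : set ('rV[R]_3 * 'rV[R]_3)) (f : face P) :
  (forall i j, (i, j) \in ico_edges -> O (pt i, pt j)) -> 12 <= val (f : 'I_24) ->
  pentagram_face f /\ has_shape O f dir_l dir_l dir_l dir_l.
Proof.
move=> hO f12; have ft : face_list f \in drop 12 pent_faces.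
  have -> : face_list f = nth [::] (drop 12 pent_faces) (val (f : 'I_24) - 12).
    by rewrite nth_drop subnKC.
  apply: mem_nth; have := ltn_ord (f : 'I_24); rewrite size_drop => h.
  by rewrite ltn_sub2r.
have /andP[_ /allP/(_ _ ft)/and5P[h0 hs /eqP h5 hc h2]] := pent_shape_ok.
have st : face_list f \in turns (face_list f) by rewrite mem_head.
have [s0 slt _ _ _] := turns_walk st; have [d dK] := decode_exists R false.
split; last by apply: (has_shape_turn (a := dir_l) (c := dir_l) st _ hs); apply: hO.
exists (fun i => d (cyc (face_list f) i)); split; first exact: face_walk_turn.
set s := face_list f in h5 hc h2 slt *.
have dE i : cyc (doubled s) i = cyc s i.*2.
  rewrite {1}/cyc size_map size_iota (nth_map 0) ?size_iota ?ltn_mod // nth_iota ?ltn_mod // add0n.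
  by rewrite /cyc h5 -!muln2 modnMml.
have d5 : size (doubled s) = 5 by rewrite size_map size_iota.
have dlt i : cyc (doubled s) i < 30 by rewrite dE.
have yE : (fun i => pos (d (cyc s i.*2))) = (fun i => pt (cyc (doubled s) i)).
  by apply: funext => i; rewrite posE dK // dE.
have reg i : (icl (cyc (doubled s) i) (cyc (doubled s) i.+1) == icl (cyc (doubled s) 0) (cyc (doubled s) 1)) &&
             (icl (cyc (doubled s) i) (cyc (doubled s) i.+2) == icl (cyc (doubled s) 0) (cyc (doubled s) 2)).
  have m0 : cyc (doubled s) (i %% 5) = cyc (doubled s) i by rewrite -{1}d5 cyc_mod.
  have m5 j : cyc (doubled s) (i %% 5 + j) = cyc (doubled s) (i + j) by rewrite -{1}d5 cyc_add.
  have := all_iota h2 (ltn_pmod i (isT : 0 < 5)).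
  by rewrite m0 -[(i %% _).+2]addn2 -[(i %% _).+1]addn1 !m5 addn1 addn2.
have dist_reg i j k l : icl (cyc (doubled s) i) (cyc (doubled s) j) = icl (cyc (doubled s) k) (cyc (doubled s) l) ->
    dist (pos (d (cyc s i.*2))) (pos (d (cyc s j.*2))) = dist (pos (d (cyc s k.*2))) (pos (d (cyc s l.*2))).
  by move=> e; rewrite !posE !dK // -!dE; apply/(ico_pt_dist R).
split.
- rewrite [X in convex_polygon X]yE.
  by case/orP: hc; apply: convex_polygonP; rewrite ?d5.
- by move=> i; apply: (dist_reg i i.+1 0 1); case/andP: (reg i) => /eqP.
- by move=> i; apply: (dist_reg i i.+2 0 2); case/andP: (reg i) => _ /eqP.
Qed.

Lemma pent_orbits : exists O A B,
  [/\ directed_edge_orbit P O, face_orbit P A, face_orbit P B, A <> B & polygons P = A `|` B] /\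
  (forall f : face P, A (polygon f) -> convex_face f /\ has_shape O f dir_r dir_r dir_r dir_r) /\
  (forall f : face P, B (polygon f) -> pentagram_face f /\ has_shape O f dir_l dir_l dir_l dir_l).
Proof.
pose f0 : face P := (Ordinal (isT : 0 < 24) : 'I_24).
pose f1 : face P := (Ordinal (isT : 12 < 24) : 'I_24).
pose O := [set d' | exists2 g, rotation_of (vertex_set P) g & d' = (g (pt 7), g (pt 0))].
have hO i j : (i, j) \in ico_edges -> O (pt i, pt j).
  by move=> /(edge_reach R false)[g rg [g1 g2]]; exists g; rewrite ?g1 ?g2.
have kA (f : face P) : orbit_of f0 (polygon f) -> val (f : 'I_24) < 12.
  move=> /orbit_face[f' /polygon_inj <- [|//]].
  by rewrite !pent_kind; case: (_ < 12).
have kB (f : face P) : orbit_of f1 (polygon f) -> 12 <= val (f : 'I_24).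
  move=> /orbit_face[f' /polygon_inj <- [|//]].
  by rewrite !pent_kind [12 <= _]leqNgt; case: (_ < 12).
exists O, (orbit_of f0), (orbit_of f1); split; last split.
- split; [exact: edge_orbit_directed | exact: orbit_of_face_orbit | exact: orbit_of_face_orbit | |].
    by move=> e; have := polygon_orbit_refl f0; rewrite e => /kB.
  apply/seteqP; split=> F; last by case=> /orbit_face[f -> _]; exists f.
  move=> [f _ <-]; have /andP[/andP[h0 h1] _] := face_orbit_ok.
  have [lt|ge] := ltnP (val (f : 'I_24)) 12; [left|right]; apply: polygon_orbit.
    exact: (ord_in_iota (i := (f : 'I_24)) h0).
  by apply: (ord_in_iota (i := (f : 'I_24)) h1); rewrite ge; exact: ltn_ord.
- by move=> f /kA; apply: pent_convex_shape.
- by move=> f /kB; apply: pent_pentagram_shape.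
Qed.
End Pentagonal.

(** * The hexagonal polyhedron as Petrie dual *)

Section Hexagonal.
Variable R : realType.
Notation P := (ico_poly R false).
Notation Q := (ico_poly R true).
Notation pt := (@ico_pt R).

Lemma hex_face_orbit : face_orbit Q (polygons Q).
Proof.
pose f0 : face Q := (Ordinal (isT : 0 < 20) : 'I_20).
suff -> : polygons Q = orbit_of f0 by exact: orbit_of_face_orbit.
apply/seteqP; split=> F; last by move=> /orbit_face[f -> _]; exists f.
move=> [f _ <-]; have /andP[_ h] := face_orbit_ok; apply: polygon_orbit.
exact: (ord_in_iota (i := (f : 'I_20)) h (ltn_ord (f : 'I_20))).
Qed.

Lemma triple_orthogonal (n x y z : 'rV[R]_3) : dotmul n x = 0%R -> dotmul n y = 0%R -> dotmul n z = 0%R ->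
  triple x y z != 0%R -> n = 0%R.
Proof.
move=> hx hy hz t0.
have key i j k : (triple x y z * i = dotmul n x * j.1.1 + dotmul n y * j.1.2 + dotmul n z * j.2 -> k = i -> k = 0)%R.
  by rewrite hx hy hz !mul0r !addr0 => /eqP; rewrite mulf_eq0 (negbTE t0) => /eqP-> ->.
set a := lift ord0 ord0 : 'I_3; set c := lift ord0 (lift ord0 ord0) : 'I_3.
apply: rv3P; rewrite [RHS]mxE.
(* Cramer's rule: the three coefficients are the components of the cross products of [y] and [z],
   [z] and [x], [x] and [y]. *)
- apply: (key _ ((y 0 a * z 0 c - y 0 c * z 0 a), (z 0 a * x 0 c - z 0 c * x 0 a), (x 0 a * y 0 c - x 0 c * y 0 a))%R _ _ erefl).
  by rewrite tripleE !dotmulE /=; ring.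
- apply: (key _ ((y 0 c * z 0 ord0 - y 0 ord0 * z 0 c), (z 0 c * x 0 ord0 - z 0 ord0 * x 0 c), (x 0 c * y 0 ord0 - x 0 ord0 * y 0 c))%R _ _ erefl).
  by rewrite tripleE !dotmulE /=; ring.
- apply: (key _ ((y 0 ord0 * z 0 a - y 0 a * z 0 ord0), (z 0 ord0 * x 0 a - z 0 a * x 0 ord0), (x 0 ord0 * y 0 a - x 0 a * y 0 ord0))%R _ _ erefl).
  by rewrite tripleE !dotmulE /=; ring.
Qed.

Lemma hex_not_planar (f : face Q) : ~ planar_face f.
Proof.
move=> [n [c [n0 h]]]; apply: n0.
have /allP/(_ _ (face_list_in f))/and3P[tr _ _] := hex_shape_ok.
have st : face_list f \in turns (face_list f) by rewrite mem_head.
have [d dK] := decode_exists R true; have [_ slt _ _ _] := turns_walk st.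
have hk k : dotmul n (pt (cyc (face_list f) k)) = c.
  have [_ _ [e [ef_ ke _]]] := face_walk_turn dK st k.
  by rewrite -(h _ e (introT andP (conj ke ef_))) posE dK.
have hd k : dotmul n (pt (cyc (face_list f) k) - pt (cyc (face_list f) 0))%R = 0%R.
  by rewrite dotmulDr dotmulNr !hk subrr.
apply: (triple_orthogonal (hd 1) (hd 2) (hd 3)).
rewrite !ico_pt_vev -!scalerBr -!vevB tripleZ vev_triple mulf_neq0 ?expf_neq0 ?invr_eq0 ?pnatr_eq0 //.
by case/orP: tr => /(ev_pos R); rewrite ?evN ?oppr_gt0; [move/gt_eqF-> | move/lt_eqF->].
Qed.

Lemma hex_shape (f : face Q) O : directed_edge_orbit Q O -> has_shape O f dir_r dir_l dir_r dir_l.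
Proof.
move=> [_ [_ [u [v [uv ->]]] ->]] /=; set O' := [set _ | _].
have c2 : icl (code u) (code v) = 2 by apply/eqP; rewrite -ico_joined.
have /allP/(_ _ (face_list_in f))/and3P[_ h1 h2] := hex_shape_ok.
have mv i j i' j' : (i, j) \in ico_edges -> (i', j') \in ico_edges -> exists2 g,
    rotation_of (vertex_set Q) g & g (pt i) = pt i' /\ g (pt j) = pt j'.
  move=> /(edge_reach R true)[g rg [g1 g2]] /(edge_reach R true)[g' rg' [g1' g2']].
  have [k [rk gK _]] := rotation_of_inverse rg; exists (g' \o k); first exact: rotation_of_comp.
  by split; rewrite /= -?g1 -?g2 gK.
have /andP[/all_iota/(_ _ (code_lt u))/all_iota/(_ _ (code_lt v)) + _] := edges_oriented_ok.
rewrite c2 eqxx /= => /orP[uE|vE].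
  have /hasP[t ht /andP[tE ts]] := h1; apply: (has_shape_turn (a := dir_r) (c := dir_l) ht _ ts).
  have [g rg [g1 g2]] := mv _ _ _ _ uE tE; exists g; first exact: rg.
  by congr pair; [exact: esym g1 | exact: esym g2].
have /hasP[t ht /andP[tE ts]] := h2; apply: (has_shape_turn (a := dir_r) (c := dir_l) ht _ ts).
have [g rg [g1 g2]] := mv _ _ _ _ vE tE; exists g; first exact: rg.
by congr pair; [exact: esym g2 | exact: esym g1].
Qed.

(** Both polyhedra have the same corners. At two successive corners the window has one of the two
    kinds, and three consecutive edges lie in a common pentagon exactly for the kind [false]; Petrie
    polygons are therefore the walks whose windows all have kind [true], that is, the hexagons. *)
Lemma petrie_hex : petrie_dual P Q.
Proof.
have [vP sP _] := ico_poly_model R false; have [vQ sQ fQ] := ico_poly_model R true.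
split; [by rewrite vP vQ | by rewrite sP sQ | rewrite fQ].
have iff (x v y : vertex P) := corner_iff (@code_lt R false) (@code_inj R false) (@code_surj R false)
  (@ico_joined R false) (@ico_regular R false) x v y.
have onE (f : face P) (x v : vertex P) e : onF f x v -> ve x e -> ve v e -> ef e f.
  by move=> [e' [xv xe' ve' ef']] xe ve_; rewrite (edge_uniq xv xe ve_ xe' ve').
apply/seteqP; split=> F.
  move=> [s sb ->]; have hs : s \in directed_faces true by rewrite mem_cat sb.
  have [s0 slt sc _] := directed_faceP hs; have [d dK] := decode_exists R false.
  pose w k := d (cyc s k); have wK k : code (w k) = cyc s k by apply: dK.
  have wc k : corner (code (w k)) (code (w k.+1)) (code (w k.+2)) by rewrite !wK.
  have wj k : joined (w k) (w k.+1).
    have /and3P[h _ _] := wc k; rewrite ico_joined icl_sym //; exact: code_lt.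
  have he k : exists e : edge P, ve (w k) e /\ ve (w k.+1) e.
    by have /joinedP[_ [e h1 h2]] := wj k; exists e.
  pose e k := projT1 (cid (he k)).
  have eP k : ve (w k) (e k) /\ ve (w k.+1) (e k) by rewrite /e; case: cid.
  have wne k : w k <> w k.+1 by have /joinedP[] := wj k.
  have seg k : segment (e k) = [set pt (cyc s k); pt (cyc s k.+1)].
    by case: (eP k) => h1 h2; rewrite (segment_ends (wne k) h1 h2) !posE !wK.
  exists e; last first.
    rewrite (poly_walk pt (w := fun k => cyc s k) (i := 0) s0); last by move=> k; rewrite add0n.
    apply/seteqP; split=> A; first by move=> [k ->]; exists k; rewrite ?seg.
    by move=> [k _ <-]; exists k; rewrite seg.
  split.
  - by exists w => k; case: (eP k).
  - move=> k; have [h [h1 h2 _]] := (iff _ _ _).2 (wc k); exists h.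
    by split; [apply: onE h1 _ _ | apply: onE h2 _ _]; case: (eP k); case: (eP k.+1).
  (* In a common pentagon the ends of the three edges would have class 1 or 5, whereas on a hexagon
     they have class 4. *)
  move=> k [f [f0 f1 f2]].
  have on j : ef (e j) f -> onF f (w j) (w j.+1).
    by move=> ej; exists (e j); case: (eP j) => h1 h2; split=> //; apply/eqP; exact: wne.
  have ne j : w j != w j.+2.
    by have [h [_ _ ?]] := (iff _ _ _).2 (wc j).
  have := @ico_window R false f (w k) (w k.+1) (w k.+2) (w k.+3).
  move=> /(_ (And3 (on _ f0) (on _ f1) (ne k)) (And3 (on _ f1) (on _ f2) (ne k.+1))).
  rewrite !wK => /and3P[_ _ h1]; have /and3P[_ _ h2] := window_faces k sb.
  by move: h1 h2; rewrite !inE => /orP[]/eqP->.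
move=> [e [[w wP] sh no] ->].
have on k f : ef (e k) f -> onF f (w k) (w k.+1).
  by move=> ek; exists (e k); have [h0 h1 h2] := wP k; split=> //; apply/eqP.
have ne k : w k != w k.+2.
  (* A walk that turns back repeats its edge, so that a face shared with the following edge would
     contain all three. *)
  apply/eqP => eww; have [h0 h1 h2] := wP k; have [_ h3 h4] := wP k.+1.
  rewrite -eww in h4; have ek : e k = e k.+1.
    by apply: (edge_uniq (x := w k) (v := w k.+1)) => //; apply/eqP.
  have [f [f1 f2]] := sh k.+1; apply: (no k); exists f; rewrite ek; split=> //.
have cor k : exists f, cornerF f (w k) (w k.+1) (w k.+2) /\ ef (e k) f.
  by have [f [f1 f2]] := sh k; exists f; split=> //; split; [exact: on | exact: on | exact: ne].
have win k : window true (code (w k)) (code (w k.+1)) (code (w k.+2)) (code (w k.+3)).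
  have [f [c1 ekf]] := cor k; have [f' [c2 _]] := cor k.+1.
  have cc1 := (iff _ _ _).1 (ex_intro _ f c1); have cc2 := (iff _ _ _).1 (ex_intro _ f' c2).
  have [_ vy _] := c1; have [_ yz _] := c2.
  have /all_iota/(_ _ (code_lt (w k.+1)))/allP := window_walks_ok.
  have [x1 _ _] := c1; move=> /(_ _ (onF_adjacent (onF_sym x1)))/allP.
  move=> /(_ _ (onF_adjacent vy))/allP/(_ _ (onF_adjacent yz))/implyP; rewrite cc1 cc2 => /(_ isT).
  case: (table_walks _ _ _ _ _ _ == 0) => [h|winF]; first exact: h.
  (* If the window had kind [false], the pentagon [f] through the first two edges would continue to
     the same fourth vertex and contain the third edge. *)
  have [z hz] := corner_next vy; have winz := ico_window c1 hz.
  have [t ht [i [e1 e2 e3]]] := corner_faceP false (code_lt _) (code_lt _) (code_lt _) cc1.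
  have [_ _ _ tnext] := directed_faceP ht; rewrite -e1 -e2 -e3 in winF winz.
  have zz : z = w k.+3.
    by apply: code_inj; rewrite (tnext _ _ (code_lt z) winz) (tnext _ _ (code_lt (w k.+3)) winF).
  have [_ hyz _] := hz; rewrite zz in hyz.
  have [h0 h1 h2] := wP k.+2; have [h3 h4 h5] := wP k.+1.
  by case: (no k); exists f; split; [exact: ekf | exact: onE vy h4 h5 | exact: onE hyz h1 h2].
have [s hs [i sE]] := walk_of_windows (fun k => code_lt (w k)) win.
have [s0 _ _ _] := directed_faceP hs.
have /allP/(_ true (mem_bools true))/allP/(_ s hs)/hasP[t tb st] := same_poly_ok.
exists t => //; rewrite -(same_polyP pt st) (poly_walk pt s0 sE).
have seg k : segment (e k) = [set pt (code (w k)); pt (code (w k.+1))].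
  by have [h0 h1 h2] := wP k; rewrite (segment_ends h0 h1 h2) !posE.
apply/seteqP; split=> A; first by move=> [k _ <-]; exists k; rewrite seg.
by move=> [k ->]; exists k; rewrite ?seg.
Qed.
End Hexagonal.

Theorem theorem7p2 (R : realType) :
  (~ exists (a : R) (P : polyhedron R),
       is_cuboctahedron a (vertex_set P) /\ directed_type a P) /\
  exists (a : R) (P Q : polyhedron R),
    [/\ (is_icosidodecahedron a (vertex_set P) /\ directed_type a P),
        (is_icosidodecahedron a (vertex_set Q) /\ directed_type a Q),
        ~ similar_polyhedra P Q
      & forall (b : R) (X : polyhedron R),
          is_icosidodecahedron b (vertex_set X) -> directed_type b X ->
          similar_polyhedra X P \/ similar_polyhedra X Q] /\
    (edges_have_length a P (golden R) /\ edges_have_length a Q (golden R)) /\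
    [/\ has_type P 5 4, orientable_genus P 4,
        forall f : face P, planar_face f
      & exists O A B,
        [/\ directed_edge_orbit P O,
            face_orbit P A, face_orbit P B, A <> B & polygons P = A `|` B] /\
        (forall f : face P, A (polygon f) ->
           convex_face f /\ has_shape O f dir_r dir_r dir_r dir_r) /\
        (forall f : face P, B (polygon f) ->
           pentagram_face f /\ has_shape O f dir_l dir_l dir_l dir_l)] /\
    [/\ petrie_dual P Q, has_type Q 6 4, nonorientable_genus Q 12,
        face_orbit Q (polygons Q)
      & forall f : face Q, ~ planar_face f /\
          forall O, directed_edge_orbit Q O ->
          has_shape O f dir_r dir_l dir_r dir_l].
Proof.
split; first by move=> [a [X [cX dX]]]; exact: cuboctahedron_not_directed cX dX.
exists 1%R, (ico_poly R false), (ico_poly R true).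
split; [|split; [|split]].
- split; [| |exact: ico_not_similar|].
  + by split; [exact: ico_is_icosidodecahedron | exact: ico_directed_type].
  + by split; [exact: ico_is_icosidodecahedron | exact: ico_directed_type].
  move=> c X iX dX; have [g [b [sg mX]]] := icosidodecahedron_directed iX dX.
  have [h [sh gK hK]] := similarity_inverse sg.
  have hX : similar_polyhedra X (ico_poly R b).
    exists (c^-1)%R, h; split; first exact: sh.
    by apply: (model_maps_onto _ mX (ico_poly_model R b)) => i _; rewrite gK.
  by case: b {mX} hX; [right | left].
- by split; exact: ico_edges_length.
- split; [exact: ico_has_type | exact: pent_genus | exact: pent_planar | exact: pent_orbits].
- split; [exact: petrie_hex | exact: ico_has_type | exact: hex_genus | exact: hex_face_orbit |].
  by move=> f; split; [exact: hex_not_planar | move=> O; exact: hex_shape].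
Qed.
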